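(* Let $\alpha\in(1,2)$ and let $X=(X_t)_{t\ge0}$ be a stable process with index $\alpha$ such that $\mathbb{E}(e^{-qX_t})=\exp(tq^\alpha)$ for all $t>0$, $q\ge0$. Conditionally on $T_1=t$ and $X_{T_1-}=x<1$, the random variables $\Delta_{T_1}$ and $\overline X_{T_1-}$ are independent, such that $\Delta_{T_1}$ follows a Pareto distribution with $$\mathbb{P}\{\Delta_{T_1}\in dz\mid T_1=t,\ X_{T_1-}=x\}=\alpha(1-x)^\alpha z^{-\alpha-1}\,\mathbf{1}\{z>1-x\}\,dz,$$ and for each $c\in[\max(x,0),1]$, $$\mathbb{P}\{\overline X_{T_1-}\le c\mid T_1=t,\ X_{T_1-}=x\}=\frac{h_c(x,t)}{h_1(x,t)}.$$
   Context: $X$ is a Lévy process with $X_0=X_{0-}=0$; under the stated normalization it is spectrally positive and strictly stable. Notation: $\overline X_t=\sup_{0\le s\le t}X_s$; $\overline X_{t-}=\sup_{0\le s<t}X_s$; $\Delta_t=X_t-X_{t-}$; $T_c=\inf\{t>0:X_t>c\}$. For $c>0$, $t>0$, $x\in(-\infty,c)$, $h_c(x,t)=\mathbb{P}\{X_t\in dx,\ \overline X_t\le c\}/dx$, i.e. $h_c(\cdot,t)$ is the density on $(-\infty,c)$ of $A\mapsto\mathbb{P}\{X_t\in A,\ \overline X_t\le c\}$ (the version continuous in $x$); at the boundary value $c=\max(x,0)$, $h_c(x,t)$ is understood as the limit $0$. Conditional laws are regular conditional distributions, expressed via the corresponding joint densities. *)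

(* Defs.v *)
(* The time set is [0, +oo[ inside R: values of a process at negative times are
   never looked at. *)
From HB Require Import structures.
From mathcomp Require Import all_boot all_order all_algebra.
From mathcomp Require Import all_classical all_reals all_analysis.
From mathcomp Require Import measurable_realfun.

Set Implicit Arguments.
Unset Strict Implicit.
Unset Printing Implicit Defensive.

Import Order.TTheory GRing.Theory Num.Theory.
Import numFieldNormedType.Exports.

Local Open Scope classical_set_scope.
Local Open Scope ring_scope.

Section paths.
Context {R : realType} {T : Type}.
Implicit Types (X : R -> T -> R) (c t : R) (w : T).

Definition cadlag_path (x : R -> R) : Prop :=
  (forall t, 0 <= t -> x s @[s --> t^'+] --> x t) /\
  (forall t, 0 < t -> cvg (x s @[s --> t^'-])).

(* X_{t-}, with the convention X_{0-} = 0 *)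
Definition left_value X t w : R :=
  if 0 < t then lim (X s w @[s --> t^'-]) else 0.

Definition jump X t w : R := X t w - left_value X t w.

(* suprema of real sets: along a cadlag path both sets are bounded, and the
   second one is empty (with supremum 0) only for t = 0 *)
Definition run_sup X t w : R := sup [set X s w | s in `[0, t]].
Definition run_sup_left X t w : R := sup [set X s w | s in `[0, t[].

(* +oo when the level c is never exceeded *)
Definition passage_time X c w : \bar R :=
  ereal_inf [set t%:E | t in [set t | 0 < t /\ c < X t w]].

(* On {T_c = +oo} the next three variables take their value at time
   [fine +oo = 0]. *)
Definition pre_passage X c w : R :=
  left_value X (fine (passage_time X c w)) w.

Definition passage_jump X c w : R :=
  jump X (fine (passage_time X c w)) w.

Definition pre_passage_sup X c w : R :=
  run_sup_left X (fine (passage_time X c w)) w.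

End paths.

Section independence.
Context d (T : measurableType d) (R : realType) (P : probability T R).

Definition mutually_independent n d' (S : measurableType d')
    (Y : 'I_n -> T -> S) : Prop :=
  forall B : 'I_n -> set S, (forall i, measurable (B i)) ->
    P (\bigcap_(i in [set: 'I_n]) (Y i @^-1` B i)) =
    (\prod_(i < n) P (Y i @^-1` B i))%E.

End independence.

Section two_variables.
Context d (T : measurableType d) (R : realType).
Context d1 (T1 : measurableType d1) d2 (T2 : measurableType d2).

Definition independent (Q : set T -> \bar R) (Y : T -> T1) (Z : T -> T2) : Prop :=
  forall A B, measurable A -> measurable B ->
    Q (Y @^-1` A `&` Z @^-1` B) = (Q (Y @^-1` A) * Q (Z @^-1` B))%E.

(* k y is the conditional law of Z given Y = y *)
Definition regular_conditional_law (P : probability T R)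
    (Z : T -> T2) (Y : T -> T1) (k : R.-pker T1 ~> T2) : Prop :=
  [/\ measurable_fun setT Y, measurable_fun setT Z &
    forall A B, measurable A -> measurable B ->
      P (Y @^-1` A `&` Z @^-1` B) = (\int[P]_(w in Y @^-1` A) k (Y w) B)%E].

End two_variables.

Section processes.
Context d (T : measurableType d) (R : realType) (P : probability T R).
Implicit Types X Y : R -> {RV P >-> R}.

Definition levy_process X : Prop :=
  [/\ forall w, X 0 w = 0,
      forall w, cadlag_path (fun t => X t w),
      forall n (t : nat -> R), 0 <= t 0%N ->
        {homo t : i j / (i <= j)%N >-> i <= j} ->
        mutually_independent P
          (fun (i : 'I_n) w => X (t i.+1) w - X (t i) w) &
      forall s t (B : set R), 0 <= s -> 0 <= t -> measurable B ->
        P [set w | B (X (s + t) w - X s w)] = P [set w | B (X t w)]].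

(* equality of all finite-dimensional distributions *)
Definition same_law (Y Z : R -> T -> R) : Prop :=
  forall n (t : 'I_n -> R) (B : 'I_n -> set R),
    (forall i, 0 <= t i) -> (forall i, measurable (B i)) ->
    P [set w | forall i, B i (Y (t i) w)] =
    P [set w | forall i, B i (Z (t i) w)].

(* stability in the wide sense (the strict case is b = 0): the scaling is
   required up to a drift *)
Definition stable_process (alpha : R) X : Prop :=
  levy_process X /\
  forall a : R, 0 < a -> exists b : R,
    same_law (fun t => X (a * t)) (fun t w => a `^ alpha^-1 * X t w + b * t).

(* h c x t = P(X_t in dx, sup_{s <= t} X_s <= c)/dx: for c, t > 0 the version
   of the density that is continuous in x on ]-oo, c[, and 0 at the boundary
   value c = max(x, 0) *)
Definition is_killed_density X (h : R -> R -> R -> R) : Prop :=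
  [/\ forall c t x, 0 < c -> 0 < t -> x < c -> 0 <= h c x t,
      forall c t x, 0 < c -> 0 < t -> x < c ->
        {for x, continuous (fun y => h c y t)},
      forall c t (A : set R), 0 < c -> 0 < t ->
        measurable A -> A `<=` `]-oo, c[ ->
        P [set w | A (X t w) /\ run_sup X t w <= c] =
        (\int[lebesgue_measure]_(x in A) (h c x t)%:E)%E &
      forall x t, 0 < t -> h (Num.max x 0) x t = 0].

End processes.

(* density of the Pareto law with index alpha and scale m *)
Definition pareto_density (R : realType) (alpha m z : R) : R :=
  alpha * m `^ alpha * z `^ (- alpha - 1) * \1_(`]m, +oo[) z.

(* Main.v *)
Require Import Defs.
From HB Require Import structures.
From mathcomp Require Import all_boot all_order all_algebra.
From mathcomp Require Import all_classical all_reals all_analysis.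
From mathcomp Require Import measurable_realfun ring lra.

Set Implicit Arguments.
Unset Strict Implicit.
Unset Printing Implicit Defensive.

Import Order.TTheory GRing.Theory Num.Theory.
Import numFieldNormedType.Exports.

Local Open Scope classical_set_scope.
Local Open Scope ring_scope.

(** The jump across the level is independent of the past, so the joint law of
    [T_1], [X_{T_1-}], the jump and the previous supremum should have density
    [nu(]max(z, 1 - x), +oo[) h_c(x, t)] at [(t, x)], for the events "the jump
    exceeds z" and "the supremum is at most c", with a Lévy measure [nu] of tail
    [C z^-alpha].  No Lévy-Itô decomposition is used: for small [e], consider the
    times [t <= a] at which the supremum up to [t] is at most [c], [X_t] lies in
    a given interval and [X_{t+e} - X_t > z] leads above the level.  Their total
    duration divided by [e] counts the jump across the level in the limit, and
    by stationarity and independence of the increments its expectation is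
    an integral against [P(X_e > y) / e].  Applied to large [z], the
    same counting shows that [P(X_e > 3) / e] converges, and scaling gives the
    tail of [nu]; the constant [C] cancels in the conditional law.

    For almost every [(t, x)] the map [c |-> h_c(x, t)] is continuous: splitting
    the path at [t / 2] bounds its increments by means of the laws of the supremum
    and of the drawdown, which have no atoms.  The conditional law is then
    realised as an image of two independent uniform variables, and conditional
    laws are unique up to null sets. *)

(** * Paths, running suprema and passage times *)

(** At a passage only weak information is available: [X tau] may equal the level, and so may
    [X_{tau-}]. Hence the counting of durations gives an upper bound for strict conditions, with
    windows ending above some [L < 1], and a lower bound for weak conditions, with [L = 1]; a mixed
    event is squeezed between the two. Jumps above 3 are treated alone at the start because for them
    the expected duration factorises exactly, so that one constant compares any two sequences of
    small times. The Laplace exponent enters through three facts: it forces the scaling to be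
    without drift, [q^alpha = o(q)] excludes [X_1 <= 0], and [E exp (- X_1) > 1] excludes
    [X_1 >= 0]. Supremum and drawdown are then handled by scaling and by splitting at a fixed time.
    The hypotheses on [h] are for fixed [t] and [c]; joint measurability and monotonicity in [c]
    come from averages over small balls. Passage without a jump is not excluded: there the kernel is
    a point mass, and only jumps starting exactly at the level have to be shown null. *)

Section cadlag_paths.
Context {R : realType}.
Implicit Types (x : R -> R) (s t e : R).

Lemma cadlag_right x t e : cadlag_path x -> 0 <= t -> 0 < e ->
  exists2 eta, 0 < eta & forall s, t <= s -> s < t + eta -> `|x s - x t| < e.
Proof.
move=> [xr _] t0 e0; have /cvgrPdist_lt/(_ _ e0) := xr t t0.
rewrite near_withinE => /nbhs_ballP[/= eta eta0 xe].
exists eta => // s ts ste; move: ts; rewrite le_eqVlt => /predU1P[->|ts].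
  by rewrite subrr normr0.
rewrite distrC; apply: xe => //=.
by rewrite /ball /= distrC gtr0_norm ?subr_gt0// ltrBlDl.
Qed.

Lemma cadlag_left x t e : cadlag_path x -> 0 < t -> 0 < e ->
  exists2 eta, 0 < eta <= t & forall s, t - eta < s -> s < t ->
    `|x s - lim (x u @[u --> t^'-])| < e.
Proof.
move=> [_ xl] t0 e0; have /cvgrPdist_lt/(_ _ e0) := xl t t0.
rewrite near_withinE => /nbhs_ballP[/= eta eta0 xe].
exists (Num.min eta t); first by rewrite lt_min eta0 t0 ge_min lexx orbT.
move=> s tes st; rewrite distrC; apply: xe => //=.
rewrite /ball /= gtr0_norm ?subr_gt0// ltrBlDl -ltrBlDr.
by apply: le_lt_trans tes; rewrite lerD2l lerN2 ge_min lexx.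
Qed.

(** Near each point right continuity bounds the path on one side and the left limit on the other;
    compactness of [[0, t]] makes the bound uniform. The parameter of the covering argument is the
    bound itself, tending to [+oo]. *)
Lemma cadlag_bounded x t : cadlag_path x ->
  exists M : R, forall s, 0 <= s <= t -> `|x s| <= M.
Proof.
move=> cx; have [t0|t0] := ltP t 0.
  by exists 0 => s /andP[s0 st]; have := le_lt_trans (le_trans s0 st) t0; rewrite ltxx.
have /compact_near_coveringP := @segment_compact R 0 t.
move=> /(_ _ (+oo : set_system R) (fun M s => 0 <= s -> `|x s| <= M)).
case.
- move=> s /=; rewrite in_itv/= => /andP[s0 st].
  have [er er0 xr] := cadlag_right cx s0 (@ltr01 R).
  have [M [el el0 xM]] : exists M, exists2 e, 0 < e & forall u, 0 <= u -> s - e < u -> u < s -> `|x u| <= M.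
    have [s1|] := ltP 0 s; last first.
      move=> s1; exists 0; exists 1 => // u u0 _ us.
      by have := lt_le_trans us s1; rewrite ltNge u0.
    have [e /andP[e0 es] xe] := cadlag_left cx s1 (@ltr01 R).
    exists (1 + `|lim (x u @[u --> s^'-])|); exists e => // u u0 su us.
    rewrite -[X in `|X|](subrK (lim (x u @[u --> s^'-]))).
    by rewrite (le_trans (ler_normD _ _))// lerD2r ltW// xe.
  exists (ball s (Num.min er el), [set M' | Num.max M (1 + `|x s|) <= M']).
    split; last by apply: nbhs_pinfty_ge; rewrite num_real.
    by apply: nbhsx_ballx; rewrite lt_min er0 el0.
  move=> [u M'] [/= bu]; rewrite ge_max => /andP[M1 M2] u0.
  move: bu; rewrite /ball/= lt_min !ltr_norml => /andP[/andP[a1 a2] /andP[a3 a4]].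
  have [us|us] := ltP u s.
    by apply: le_trans M1; apply: xM => //; rewrite ltrBlDr addrC -ltrBlDr.
  apply: le_trans M2; rewrite -[X in `|X|](subrK (x s)).
  rewrite (le_trans (ler_normD _ _))// lerD2r ltW// xr//.
  by rewrite -ltrBlDl -ltrN2 opprB.
- move=> M [_ Mt]; exists (M + 1) => s /andP[s0 st]; apply: Mt => //.
    by rewrite ltrDl.
  by rewrite /= in_itv/= s0.
Qed.

Lemma cadlag_shift x s : cadlag_path x -> 0 <= s ->
  cadlag_path (fun v => x (s + v) - x s).
Proof.
move=> cx s0; split=> t t0.
  apply/cvgrPdist_lt => e e0.
  have [eta eta0 xe] := cadlag_right cx (addr_ge0 s0 t0) e0.
  near=> v; rewrite opprB addrA subrK distrC.
  apply: xe; first by rewrite lerD2l.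
  rewrite -addrA ltrD2l; near: v; apply: nbhs_right_lt; by rewrite ltrDl.
have st0 : 0 < s + t by rewrite ltr_wpDl.
apply/cvg_ex; exists (lim (x u @[u --> (s + t)^'-]) - x s).
apply/cvgrPdist_lt => e e0.
have [eta /andP[eta0 _] xe] := cadlag_left cx st0 e0.
near=> v; rewrite opprB addrA subrK distrC.
apply: xe; last by rewrite ltrD2l.
rewrite -addrA ltrD2l; near: v; apply: nbhs_left_gt; by rewrite ltrBlDr ltrDl.
Unshelve. all: by end_near. Qed.

End cadlag_paths.

Section running_supremum.
Context {R : realType} {T : Type} (X : R -> T -> R) (w : T).
Hypothesis cX : cadlag_path (X^~ w).
Implicit Types s t u c : R.

Lemma has_ubound_path t : has_ubound [set X s w | s in `[0, t]].
Proof.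
have [M XM] := cadlag_bounded t cX.
exists M => _ [s /= + <-]; rewrite in_itv/= => s0t.
by rewrite (le_trans (ler_norm _))// XM.
Qed.

Lemma path_le_run_sup s t : 0 <= s <= t -> X s w <= run_sup X t w.
Proof.
move=> st; apply: ub_le_sup; first exact: has_ubound_path.
by exists s => //=; rewrite in_itv.
Qed.

Lemma run_sup_leP t c : 0 <= t ->
  run_sup X t w <= c <-> forall s, 0 <= s <= t -> X s w <= c.
Proof.
move=> t0; split=> [Sc s st|Xc]; first by rewrite (le_trans _ Sc)// path_le_run_sup.
apply: ge_sup; first by exists (X 0 w), 0 => //=; rewrite in_itv/= lexx.
by move=> _ [s /= + <-]; rewrite in_itv/=; exact: Xc.
Qed.

Lemma le_run_sup s t : 0 <= s <= t -> run_sup X s w <= run_sup X t w.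
Proof.
move=> /andP[s0 st]; apply/run_sup_leP => // u /andP[u0 us].
by rewrite path_le_run_sup// u0 (le_trans us).
Qed.

Lemma run_sup_left_leP t c : 0 < t ->
  run_sup_left X t w <= c <-> forall s, 0 <= s < t -> X s w <= c.
Proof.
move=> t0; split=> [Sc s st|Xc].
  rewrite (le_trans _ Sc)//; apply: ub_le_sup.
    apply: subset_has_ubound (has_ubound_path t) => _ [v /= + <-].
    rewrite in_itv/= => /andP[v0 /ltW vt]; exists v => //=.
    by rewrite in_itv/= v0.
  by exists s => //=; rewrite in_itv.
apply: ge_sup; first by exists (X 0 w), 0 => //=; rewrite in_itv/= lexx.
by move=> _ [s /= + <-]; rewrite in_itv/=; exact: Xc.
Qed.

Lemma run_sup_left0 : run_sup_left X 0 w = 0.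
Proof. by rewrite /run_sup_left set_itvco0 image_set0 sup0. Qed.

Lemma run_sup_left_ge s t : 0 <= s < t -> run_sup X s w <= run_sup_left X t w.
Proof.
move=> /andP[s0 st]; apply/run_sup_leP => // u /andP[u0 us].
have t0 : 0 < t by exact: le_lt_trans st.
apply: ((run_sup_left_leP _ t0).1 (lexx _)).
by rewrite u0 (le_lt_trans us).
Qed.

(** A value above [c] at [s < t] persists on some [[s, s + eta[] by right continuity, and a fine
    dyadic grid has a point there; [t] itself is a grid point. This makes the supremum accessible to
    finite-dimensional distributions. *)
Lemma run_sup_dyadic t c : 0 <= t ->
  (forall n k, (k <= 2 ^ n)%N -> X (t * (k%:R / 2 ^+ n)) w <= c) ->
  run_sup X t w <= c.
Proof.
move=> t0 Xc; apply/run_sup_leP => // s /andP[s0 st].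
move: st; rewrite le_eqVlt => /predU1P[->|st].
  by have := Xc 0%N 1%N; rewrite expr0 divr1 mulr1; apply.
have {}t0 : 0 < t by exact: le_lt_trans st.
rewrite leNgt; apply/negP => cXs.
have [eta eta0 Xeta] := cadlag_right cX s0 (etrans (subr_gt0 _ _) cXs).
have [n _ n2] := near_infty_natSinv_expn_lt (PosNum (divr_gt0 eta0 t0)).
have {}n2 := n2 n (leqnn n); rewrite /= in n2.
have p2 : 0 < 2 ^+ n :> R by rewrite exprn_gt0.
(* The successor of the integer part places the grid point just to the right of [s], the side on
   which the path is controlled. *)
pose k := (Num.truncn (s / t * 2 ^+ n)).+1.
have st0 : 0 <= s / t * 2 ^+ n by rewrite mulr_ge0// ?exprn_ge0// divr_ge0// ltW.
have kl : s / t * 2 ^+ n < k%:R by rewrite /k truncnS_gt.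
have ku : k%:R <= s / t * 2 ^+ n + 1.
  by rewrite /k -natr1 lerD2r; have /andP[] := truncn_itv st0.
have kn : (k <= 2 ^ n)%N.
  rewrite /k truncn_lt_nat// natrX.
  by rewrite gtr_pMl// ltr_pdivrMr// mul1r.
have c1 : s <= t * (k%:R / 2 ^+ n).
  rewrite mulrA ler_pdivlMr// mulrC -ler_pdivrMl// mulrA.
  by rewrite (le_trans _ (ltW kl))// mulrC mulrA.
have c2 : t * (k%:R / 2 ^+ n) < s + eta.
  rewrite -ltr_pdivlMl// ltr_pdivrMr//.
  apply: le_lt_trans ku _.
  rewrite mulrDr mulrDl mulrC [t^-1 * s]mulrC [2 ^+ n * _]mulrC ltrD2l.
  by rewrite -ltr_pdivrMr// [_^-1 * eta]mulrC.
have := Xeta _ c1 c2.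
rewrite ltr_norml => /andP[+ _].
by rewrite opprB ltrBrDr subrK ltNge Xc.
Qed.

End running_supremum.

(** After time [s] the supremum sees only [X s] and the increment process started at [s];
    independence of increments is applied in this form. *)
Lemma run_sup_split {R : realType} {T : Type} (X : R -> T -> R) (w : T) (s u : R) :
  cadlag_path (X^~ w) -> 0 <= s -> 0 <= u ->
  run_sup X (s + u) w =
  Num.max (run_sup X s w)
    (X s w + run_sup (fun v w => X (s + v) w - X s w) u w).
Proof.
move=> cX s0 u0; set X' := fun v _ => _.
have cX' : cadlag_path (X'^~ w).
  exact: (cadlag_shift cX s0).
have us : 0 <= s <= s + u by rewrite s0 lerDl.
have su0 := addr_ge0 s0 u0.
apply/eqP; rewrite eq_le; apply/andP; split.
  apply/run_sup_leP => // v /andP[v0 vsu]; rewrite le_max.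
  have [vs|/ltW sv] := leP v s; first by rewrite path_le_run_sup// v0.
  apply/orP; right; rewrite -lerBlDl.
  have /(path_le_run_sup cX') : 0 <= v - s <= u by rewrite subr_ge0 sv lerBlDl.
  by rewrite {1}/X' subrKC.
rewrite ge_max le_run_sup//= -lerBrDl.
apply/(run_sup_leP cX') => // v /andP[v0 vu].
by rewrite /X' lerD2r path_le_run_sup// addr_ge0// lerD2l.
Qed.

Section left_values.
Context {R : realType} {T : Type} (X : R -> T -> R) (w : T).
Hypothesis cX : cadlag_path (X^~ w).
Implicit Types s t u c e : R.

Lemma left_valueP t e : 0 < t -> 0 < e ->
  exists2 eta, 0 < eta <= t & forall s, t - eta < s -> s < t ->
    `|X s w - left_value X t w| < e.
Proof. by move=> t0 e0; rewrite /left_value t0; exact: cadlag_left. Qed.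

Lemma left_value_cvg t (u : nat -> R) : 0 < t -> (forall n, u n < t) ->
  u n @[n --> \oo] --> t -> X (u n) w @[n --> \oo] --> left_value X t w.
Proof.
move=> t0 ut ucvg; apply/cvgrPdist_lt => e e0.
have [eta /andP[eta0 _] Xe] := left_valueP t0 e0.
have /cvgrPdist_lt/(_ _ eta0) := ucvg.
apply: filterS => n; rewrite gtr0_norm ?subr_gt0// ltrBlDr -ltrBlDl => un.
by rewrite distrC Xe.
Qed.

Lemma left_value_le t c : 0 < t -> (forall s, 0 <= s < t -> X s w <= c) ->
  left_value X t w <= c.
Proof.
move=> t0 Xc; rewrite leNgt; apply/negP => cl.
have [eta /andP[eta0 etat] Xe] := left_valueP t0 (etrans (subr_gt0 _ _) cl).
have := Xe (t - eta / 2).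
rewrite ltrD2l ltrN2 ltr_pdivrMr// mulr_natr mulr2n ltrDl eta0 => /(_ erefl).
rewrite gtrBl divr_gt0// => /(_ erefl); rewrite ltr_norml => /andP[+ _].
rewrite opprB ltrBrDr subrK ltNge Xc// gtrBl divr_gt0// andbT subr_ge0.
by rewrite ler_pdivrMr// mulr_natr mulr2n (le_trans etat)// lerDl (le_trans _ etat)// ltW.
Qed.

Lemma left_value_le_run_sup_left t : 0 < t -> left_value X t w <= run_sup_left X t w.
Proof.
move=> t0; apply: left_value_le => // s st.
exact: ((run_sup_left_leP cX _ t0).1 (lexx _)).
Qed.

End left_values.

Section passage_times.
Context {R : realType} {T : Type} (X : R -> T -> R) (w : T) (c : R).
Hypotheses (cX : cadlag_path (X^~ w)) (X0c : X 0 w < c).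
Implicit Types s t u e : R.
Local Notation T_c := (passage_time X c w).

Lemma passage_time_le t : 0 < t -> c < X t w -> (T_c <= t%:E)%E.
Proof. by move=> t0 ct; apply: ereal_inf_lbound; exists t. Qed.

Lemma passage_time_ge0 : (0 <= T_c)%E.
Proof.
apply: le_ereal_inf_tmp => _ [t [t0 _] <-].
by rewrite lee_fin ltW.
Qed.

Lemma before_passage t : 0 <= t -> (t%:E < T_c)%E -> X t w <= c.
Proof.
rewrite le_eqVlt => /predU1P[<- _|t0 tT]; first exact: ltW.
by rewrite leNgt; apply/negP => /(passage_time_le t0); rewrite leNgt tT.
Qed.

Lemma after_passage tau e : T_c = tau%:E -> 0 < e ->
  exists2 t, tau <= t < tau + e & 0 < t /\ c < X t w.
Proof.
move=> Ttau e0.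
have : (T_c < (tau + e)%:E)%E by rewrite Ttau lte_fin ltrDl.
move/ereal_inf_lt => [_ [t [t0 ct] <-]]; rewrite lte_fin => te.
exists t => //; rewrite te andbT -lee_fin -Ttau; exact: passage_time_le.
Qed.

Lemma passage_time_gt0 : (0 < T_c)%E.
Proof.
have [eta eta0 Xe] := cadlag_right cX (lexx 0) (etrans (subr_gt0 _ _) X0c).
apply: (@lt_le_trans _ _ eta%:E); first by rewrite lte_fin.
apply: le_ereal_inf_tmp => _ [t [t0 ct] <-].
rewrite lee_fin leNgt; apply/negP => te.
have := Xe t (ltW t0); rewrite add0r => /(_ te).
rewrite ltr_norml => /andP[_]; rewrite ltrBlDr subrK.
by rewrite ltNge ltW.
Qed.

(** There are times with [X > c] at or arbitrarily shortly after [tau], so right continuity leaves a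
    weak inequality. *)
Lemma at_passage tau : T_c = tau%:E -> c <= X tau w.
Proof.
move=> Ttau; have tau0 : 0 <= tau by rewrite -lee_fin -Ttau passage_time_ge0.
rewrite leNgt; apply/negP => Xc.
have [eta eta0 Xe] := cadlag_right cX tau0 (etrans (subr_gt0 _ _) Xc).
have [t /andP[taut te] [t0 ct]] := after_passage Ttau eta0.
have := Xe t taut te; rewrite ltr_norml => /andP[_]; rewrite ltrBlDr subrK.
by rewrite ltNge ltW.
Qed.

Lemma run_sup_left_passage tau : T_c = tau%:E -> run_sup_left X tau w <= c.
Proof.
move=> Ttau; have tau0 : 0 < tau by rewrite -lte_fin -Ttau passage_time_gt0.
apply/run_sup_left_leP => // s /andP[s0 st].
by apply: before_passage => //; rewrite Ttau lte_fin.
Qed.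

Lemma left_value_passage tau : T_c = tau%:E -> left_value X tau w <= c.
Proof.
move=> Ttau; have tau0 : 0 < tau by rewrite -lte_fin -Ttau passage_time_gt0.
exact: le_trans (left_value_le_run_sup_left cX tau0) (run_sup_left_passage Ttau).
Qed.

End passage_times.

(** * Measurability in time and sample point *)

Section joint_measurability.
Context {d : measure_display} {T : measurableType d} {R : realType}.
Implicit Types (t c : R) (w : T).

Lemma measurable_truncn : measurable_fun [set: R] (@Num.truncn R).
Proof.
move=> _ Y _; rewrite setTI (_ : _ @^-1` Y = \bigcup_(k in Y) (Num.truncn @^-1` [set k])); last first.
  by apply/seteqP; split=> [t Yt|t [k Yk /= tk]]; [exists (Num.truncn t)|rewrite /= tk].
apply: bigcup_measurable => k _.
have [k0|k0] := eqVneq k 0%N.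
  rewrite (_ : _ @^-1` _ = `]-oo, 1[%classic); first exact: measurable_itv.
  rewrite k0; apply/seteqP; split=> t /=; rewrite in_itv/=.
    by move=> /truncn0Pn; rewrite -ltNge.
  by move=> t1; apply/truncn0Pn; rewrite -ltNge.
rewrite (_ : _ @^-1` _ = `[k%:R, k.+1%:R[%classic); first exact: measurable_itv.
apply/seteqP; split=> t /=; rewrite in_itv/=; last exact: truncn_def.
move=> tk; have t0 : 0 <= t.
  by rewrite leNgt; apply/negP => t0; move: k0; rewrite -tk (truncn0Pn _ _) ?eqxx// -ltNge (lt_trans t0).
by rewrite -tk truncn_itv.
Qed.

Lemma measurable_fun_nat_index d' (T' : measurableType d')
    (N : T -> nat) (g : nat -> T -> T') :
  measurable_fun setT N -> (forall k, measurable_fun setT (g k)) ->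
  measurable_fun setT (fun p => g (N p) p).
Proof.
move=> mN mg _ Y mY; rewrite setTI.
rewrite (_ : _ @^-1` Y = \bigcup_k (N @^-1` [set k] `&` g k @^-1` Y)); last first.
  by apply/seteqP; split=> [p Yp|p [k _ [/= <-]]//]; exists (N p).
apply: bigcupT_measurable => k; apply: measurableI.
  by rewrite -[_ @^-1` _]setTI; exact: mN.
by rewrite -[_ @^-1` _]setTI; exact: mg.
Qed.

End joint_measurability.

Section measurable_paths.
Context {d : measure_display} {T : measurableType d} {R : realType}.
Variable X : R -> T -> R.
Hypotheses (cX : forall w, cadlag_path (X^~ w)) (mX : forall t, measurable_fun setT (X t)).
Implicit Types (t c : R) (w : T).

Lemma measurable_max0 : measurable_fun [set: R] (Num.max ^~ 0 : R -> R).
Proof. by apply: measurable_maxr => //; exact: measurable_cst. Qed.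

(** Rounding time up to a grid of mesh [1 / (n + 1)] approaches it strictly from the right, where
    the path is continuous. [Num.max p.1 0] is there because nothing is known of the paths at
    negative times. *)
Lemma measurable_process : measurable_fun setT (fun p : R * T => X (Num.max p.1 0) p.2).
Proof.
pose h n (p : R * T) := X ((Num.truncn (Num.max p.1 0 * n.+1%:R)).+1%:R / n.+1%:R) p.2.
apply: (@measurable_fun_cvg _ _ _ setT h) => [n|[t w] _ /=].
  apply: (@measurable_fun_nat_index _ _ _ _ (fun p : R * T => Num.truncn (Num.max p.1 0 * n.+1%:R)) (fun k p => X (k.+1%:R / n.+1%:R) p.2)).
    apply: (measurableT_comp measurable_truncn).
    apply: measurable_funM; last exact: measurable_cst.
    exact: (measurableT_comp measurable_max0).
  by move=> k; apply: (measurableT_comp (mX _)).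
have t0 : 0 <= Num.max t 0 by rewrite le_max lexx orbT.
rewrite /h/=; move: (Num.max t 0) t0 => {}t t0.
apply/cvgrPdist_lt => e e0.
have [eta eta0 Xe] := cadlag_right (cX w) t0 e0.
have [n _ n2] := near_infty_natSinv_lt (PosNum eta0).
exists n => // m /n2/= m2; rewrite distrC /h/=.
have tm0 : 0 <= t * m.+1%:R by rewrite mulr_ge0.
apply: Xe.
  by rewrite ler_pdivlMr// ltW// truncnS_gt.
rewrite ltr_pdivrMr// -natr1.
have /andP[+ _] := truncn_itv tm0.
rewrite -(lerD2r 1) => /le_lt_trans; apply.
by rewrite mulrDl ltrD2l -ltr_pdivrMr// div1r.
Qed.

Lemma measurable_process_scale q : 0 <= q ->
  measurable_fun setT (fun p : R * T => X (Num.max p.1 0 * q) p.2).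
Proof.
move=> q0.
have -> : (fun p : R * T => X (Num.max p.1 0 * q) p.2) =
    (fun p : R * T => X (Num.max p.1 0) p.2) \o (fun p => (Num.max p.1 0 * q, p.2)).
  by apply/funext => p /=; congr (X _ _); rewrite [RHS]max_l// mulr_ge0// le_max lexx orbT.
apply: (measurableT_comp measurable_process).
apply: measurable_fun_pair => //.
apply: measurable_funM; last exact: measurable_cst.
exact: (measurableT_comp measurable_max0).
Qed.

Lemma measurable_run_sup :
  measurable_fun setT (fun p : R * T => run_sup X (Num.max p.1 0) p.2).
Proof.
move=> mD; apply: (measurability _ (RGenOInfty.measurableE R)) => //.
move=> _ [_ [c ->] <-]; rewrite setTI.
pose F n k : set (R * T) := if (k <= 2 ^ n)%N then
  (fun p : R * T => X (Num.max p.1 0 * (k%:R / 2 ^+ n)) p.2) @^-1` `]c, +oo[ else set0.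
rewrite (_ : _ @^-1` _ = \bigcup_n \bigcup_k F n k).
  apply: bigcupT_measurable => n; apply: bigcupT_measurable => k; rewrite /F.
  case: ifPn => // _; rewrite -[_ @^-1` _]setTI; apply: measurable_process_scale => //.
apply/seteqP; split=> [[t w]|[t w] [n _ [k _]]]; rewrite /F /=; last first.
  case: ifPn => //= kn; rewrite !in_itv/= !andbT => /lt_le_trans; apply.
  apply: path_le_run_sup => //; rewrite mulr_ge0//=; last by rewrite le_max lexx orbT.
  by rewrite ler_piMr// ?le_max ?lexx ?orbT// ler_pdivrMr ?exprn_gt0// mul1r -natrX ler_nat.
rewrite in_itv/= andbT => cS; apply: contrapT => Fn.
move: cS; rewrite ltNge => /negP; apply.
apply: run_sup_dyadic => //; first by rewrite le_max lexx orbT.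
move=> n k kn; rewrite leNgt; apply/negP => cX0; apply: Fn.
by exists n => //; exists k => //; rewrite kn /= in_itv/= cX0.
Qed.

(** The times [t - t / (n + 2)] stay in [[0, t[]; left values and left suprema are limits along
    them. *)
Lemma cvg_from_left t : t - t / n.+2%:R @[n --> \oo] --> t.
Proof.
rewrite -[X in _ --> X]subr0 -(mulr0 t).
apply: cvgB; first exact: cvg_cst.
apply: cvgMr.
by have := @cvg_harmonic R; rewrite -cvg_shiftS.
Qed.

Lemma from_left_bounds t n : 0 < t -> 0 <= t - t / n.+2%:R < t.
Proof.
move=> t0; rewrite subr_ge0 gtrBl divr_gt0// andbT.
by rewrite ler_pdivrMr// ler_peMr ?ltW// ltr1n.
Qed.

Lemma measurable_left_value :
  measurable_fun setT (fun p : R * T => left_value X p.1 p.2).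
Proof.
pose h n (p : R * T) := if 0 < p.1 then X (Num.max (p.1 - p.1 / n.+2%:R) 0) p.2 else 0.
apply: (@measurable_fun_cvg _ _ _ setT h) => [n|[t w] _ /=].
  apply: measurable_fun_ifT; last exact: measurable_cst.
    by apply: measurable_fun_ltr => //; exact: measurable_cst.
  apply: (measurableT_comp (f := fun p : R * T => X (Num.max p.1 0) p.2)
    measurable_process (g := fun p : R * T => (p.1 - p.1 / n.+2%:R, p.2))).
  apply: measurable_fun_pair => //.
  by apply: measurable_funB => //; apply: measurable_funM => //; exact: measurable_cst.
rewrite /h/=; case: (boolP (0 < t)) => t0; last by rewrite /left_value (negbTE t0); exact: cvg_cst.
have hE : (fun n => X (Num.max (t - t / n.+2%:R) 0) w) = (fun n => X (t - t / n.+2%:R) w).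
  by apply/funext => n; rewrite max_l//; have /andP[] := from_left_bounds n t0.
rewrite hE; apply: left_value_cvg => //; last exact: cvg_from_left.
by move=> n; have /andP[] := from_left_bounds n t0.
Qed.

Lemma measurable_run_sup_left :
  measurable_fun setT (fun p : R * T => run_sup_left X p.1 p.2).
Proof.
pose h n (p : R * T) := if 0 < p.1 then run_sup X (Num.max (p.1 - p.1 / n.+2%:R) 0) p.2 else 0.
apply: (@measurable_fun_cvg _ _ _ setT h) => [n|[t w] _ /=].
  apply: measurable_fun_ifT; last exact: measurable_cst.
    by apply: measurable_fun_ltr => //; exact: measurable_cst.
  apply: (measurableT_comp (f := fun p : R * T => run_sup X (Num.max p.1 0) p.2)
    measurable_run_sup (g := fun p : R * T => (p.1 - p.1 / n.+2%:R, p.2))).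
  apply: measurable_fun_pair => //.
  by apply: measurable_funB => //; apply: measurable_funM => //; exact: measurable_cst.
rewrite /h/=; case: (boolP (0 < t)) => t0; last first.
  rewrite /run_sup_left set_itv_ge ?image_set0 ?sup0; first exact: cvg_cst.
  by rewrite bnd_simp.
have hE : (fun n => run_sup X (Num.max (t - t / n.+2%:R) 0) w) = (fun n => run_sup X (t - t / n.+2%:R) w).
  by apply/funext => n; rewrite max_l//; have /andP[] := from_left_bounds n t0.
rewrite hE; apply/cvgrPdist_lt => e e0.
have [s s0t Xs] : exists2 s, 0 <= s < t & run_sup_left X t w - e < X s w.
  apply: contrapT => Xs.
  suff : run_sup_left X t w <= run_sup_left X t w - e.
    by rewrite lerBrDl gerDr leNgt e0.
  apply/run_sup_left_leP => // s s0t; rewrite leNgt; apply/negP => Xs'.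
  by apply: Xs; exists s.
have /andP[s0 st] := s0t.
have /cvgrPdist_lt/(_ _ (etrans (subr_gt0 _ _) st)) := @cvg_from_left t.
apply: filterS => n.
have /andP[tn0 tnt] := from_left_bounds n t0.
rewrite gtr0_norm ?subr_gt0// ltrD2l ltrN2 => sn.
rewrite ger0_norm ?subr_ge0//; last by apply: run_sup_left_ge => //; rewrite tn0.
rewrite ltrBlDr -ltrBlDl; apply: lt_le_trans Xs _.
by apply: path_le_run_sup => //; rewrite s0 ltW.
Qed.

(** By right continuity a level exceeded before [r] is exceeded at a rational time before [r], so
    that [T_c < r] is a countable union. *)
Lemma measurable_passage_time c : (forall w, X 0 w < c) ->
  measurable_fun setT (passage_time X c).
Proof.
move=> X0 mD; apply: (measurability _ (ErealGenInftyO.measurableE R)) => //.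
move=> _ [_ [r ->] <-]; rewrite setTI.
pose F (q : rat) : set T := if 0 < (ratr q : R) < r then X (ratr q) @^-1` `]c, +oo[ else set0.
rewrite (_ : _ @^-1` _ = \bigcup_q F q).
  apply: bigcupT_measurable_rat => q; rewrite /F; case: ifPn => // _.
  by rewrite -[_ @^-1` _]setTI; exact: mX.
apply/seteqP; split=> [w|w [q _]]; rewrite /F /= in_itv/=; last first.
  case: ifPn => // /andP[q0 qr]; rewrite /= in_itv/= andbT => cXq.
  by apply: le_lt_trans (passage_time_le q0 cXq) _; rewrite lte_fin.
move=> /ereal_inf_lt [_ [t [t0 ct] <-]]; rewrite lte_fin => tr.
have [eta eta0 Xe] := cadlag_right (cX w) (ltW t0) (etrans (subr_gt0 _ _) ct).
have : t < Num.min r (t + eta) by rewrite lt_min tr ltrDl.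
move=> /rat_in_itvoo[q]; rewrite in_itv/= lt_min => /and3P[tq qr qe].
exists q => //; rewrite (lt_trans t0 tq) qr /= in_itv/= andbT.
have := Xe _ (ltW tq) qe.
by rewrite ltr_norml => /andP[+ _]; rewrite opprB ltrBrDr subrK.
Qed.

Lemma measurable_pre_passage c : (forall w, X 0 w < c) ->
  measurable_fun setT (pre_passage X c).
Proof.
move=> X0; apply: (measurableT_comp (f := fun p : R * T => left_value X p.1 p.2)
  measurable_left_value (g := fun w => (fine (passage_time X c w), w))).
apply: measurable_fun_pair => //.
exact: (measurableT_comp (fine_measurable _) (measurable_passage_time X0)).
Qed.

Lemma measurable_pre_passage_sup c : (forall w, X 0 w < c) ->
  measurable_fun setT (pre_passage_sup X c).
Proof.
move=> X0; apply: (measurableT_comp (f := fun p : R * T => run_sup_left X p.1 p.2)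
  measurable_run_sup_left (g := fun w => (fine (passage_time X c w), w))).
apply: measurable_fun_pair => //.
exact: (measurableT_comp (fine_measurable _) (measurable_passage_time X0)).
Qed.

Lemma measurable_passage_jump c : (forall w, X 0 w < c) ->
  measurable_fun setT (passage_jump X c).
Proof.
move=> X0; apply: measurable_funB; last exact: measurable_pre_passage.
have -> : (fun w => X (fine (passage_time X c w)) w) =
  (fun p : R * T => X (Num.max p.1 0) p.2) \o (fun w => (fine (passage_time X c w), w)).
  apply/funext => w /=; congr (X _ _); rewrite max_l// fine_ge0//.
  exact: passage_time_ge0.
apply: (measurableT_comp measurable_process).
apply: measurable_fun_pair => //.
exact: (measurableT_comp (fine_measurable _) (measurable_passage_time X0)).
Qed.

End measurable_paths.

(** * Uniqueness of measures *)

Section measure_uniqueness.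
Context {R : realType}.
Local Open Scope ereal_scope.

(** The pushforward bundled with its measure structure, which is why the measurability proof is an
    argument. *)
Definition law {d1 d2} {T1 : measurableType d1} {T2 : measurableType d2}
  (m : {measure set T1 -> \bar R}) (f : T1 -> T2)
  (mf : measurable_fun setT f) : {measure set T2 -> \bar R} :=
  measure_function_pushforward__canonical__measure_function_Measure m mf.

Lemma lawE {d1 d2} {T1 : measurableType d1} {T2 : measurableType d2}
  (m : {measure set T1 -> \bar R}) (f : T1 -> T2)
  (mf : measurable_fun setT f) A : law m mf A = m (f @^-1` A).
Proof. by []. Qed.

Lemma finite_measure_unique {d} {T : measurableType d}
    (G : set (set T)) (g : (set T)^nat) (m1 m2 : {measure set T -> \bar R}) :
  measurable = <<s G >> -> setI_closed G ->
  (forall i, G (g i)) -> \bigcup_k g k = setT ->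
  m1 setT < +oo -> (forall A, G A -> m1 A = m2 A) ->
  forall A, measurable A -> m1 A = m2 A.
Proof.
move=> mG GI Gg gT m1oo m12; apply: (measure_unique G g) => // k.
apply: le_lt_trans m1oo; apply: le_measure; rewrite ?inE//.
by rewrite mG; apply: sub_sigma_algebra.
Qed.

Lemma measurable_rays : measurable = <<s [set A : set R | exists c, A = `]-oo, c]%classic] >>.
Proof.
apply/seteqP; split.
  rewrite [X in X `<=` _](RGenOInfty.measurableE R); apply: smallest_sub.
    exact: smallest_sigma_algebra.
  move=> _ [c ->]; rewrite -setCitvl; apply: sigma_algebraC.
  by apply: sub_sigma_algebra; exists c.
apply: smallest_sub; first exact: sigma_algebra_measurable.
by move=> _ [c ->]; exact: measurable_itv.
Qed.

Lemma measure_eq_rays (m1 m2 : {measure set R -> \bar R}) :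
  m1 setT < +oo -> (forall c, m1 `]-oo, c]%classic = m2 `]-oo, c]%classic) ->
  forall A, measurable A -> m1 A = m2 A.
Proof.
move=> m1oo m12; apply: (@finite_measure_unique _ _
  [set A : set R | exists c, A = `]-oo, c]%classic] (fun n => `]-oo, n%:R]%classic)) => //.
- exact: measurable_rays.
- move=> _ _ [a ->] [b ->]; exists (Num.min a b).
  by apply/seteqP; split=> x /=; rewrite !in_itv/= le_min => /andP.
- by move=> n; exists n%:R.
- apply/seteqP; split=> // x _; exists (Num.truncn x).+1 => //=.
  by rewrite in_itv/= ltW// truncnS_gt.
- by move=> _ [c ->].
Qed.

Lemma measure_eq_rect {d1 d2} {T1 : measurableType d1} {T2 : measurableType d2}
    (m1 m2 : {measure set (T1 * T2) -> \bar R}) :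
  m1 setT < +oo ->
  (forall A B, measurable A -> measurable B -> m1 (A `*` B) = m2 (A `*` B)) ->
  forall A, measurable A -> m1 A = m2 A.
Proof.
move=> m1oo m12; apply: (@finite_measure_unique _ _
  [set A `*` B | A in measurable & B in measurable] (fun n => setT)) => //.
- exact: measurable_prod_measurableType.
- move=> _ _ [A mA [B mB <-]] [A' mA' [B' mB' <-]].
  exists (A `&` A'); first exact: measurableI.
  by exists (B `&` B'); [exact: measurableI|rewrite setXI].
- by move=> _; exists setT => //; exists setT => //; rewrite setXTT.
- by rewrite bigcup_const.
- by move=> _ [A mA [B mB <-]]; exact: m12.
Qed.

(** For fixed [A] both sides are finite measures of the second factor, and these are determined by
    rays. *)
Lemma measure_eq_rect_rays {d1} {T1 : measurableType d1}
    (m1 m2 : {measure set (T1 * R) -> \bar R}) :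
  m1 setT < +oo ->
  (forall A c, measurable A -> m1 (A `*` `]-oo, c]%classic) = m2 (A `*` `]-oo, c]%classic)) ->
  forall A, measurable A -> m1 A = m2 A.
Proof.
move=> m1oo m12; apply: measure_eq_rect => // A B mA mB.
have mAT : measurable (A `*` [set: R]) by exact: measurableX.
have E (m : {measure set (T1 * R) -> \bar R}) C :
    law (mrestr m mAT) measurable_snd C = m (A `*` C).
  rewrite lawE /mrestr; congr (m _); apply/seteqP; split=> -[x y] /=; tauto.
rewrite -!E; apply: measure_eq_rays mB.
  rewrite E; apply: le_lt_trans m1oo; apply: le_measure; rewrite ?inE//.
by move=> c; rewrite !E; exact: m12.
Qed.

Definition rectangle {T : Type} n (B : 'I_n -> set T) : set (n.-tuple T) :=
  [set x | forall i, B i (tnth x i)].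

Lemma measure_eq_tuple {d} {T : measurableType d} n
    (m1 m2 : {measure set (n.-tuple T) -> \bar R}) :
  m1 setT < +oo ->
  (forall B, (forall i, measurable (B i)) -> m1 (rectangle B) = m2 (rectangle B)) ->
  forall A, measurable A -> m1 A = m2 A.
Proof.
move=> m1oo m12.
pose G := [set A | exists2 B : 'I_n -> set T, (forall i, measurable (B i)) & A = rectangle B].
apply: (@finite_measure_unique _ _ G (fun n => setT)) => //.
- apply/seteqP; split.
    apply: smallest_sub; first exact: smallest_sigma_algebra.
    rewrite -bigcup_seq => A /= [i _ [B mB <-]].
    apply: sub_sigma_algebra; exists (fun j => if j == i then B else setT).
      by move=> j; case: ifP.
    apply/seteqP; split=> x /=.
      by move=> [_ Bx] j; case: eqP => // ->.
    by move=> /(_ i); rewrite eqxx.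
  apply: smallest_sub; first exact: sigma_algebra_measurable.
  move=> _ [B mB ->].
  have -> : rectangle B = \bigcap_(i in [set: 'I_n]) (tnth (T:=T) (n:=n) ^~ i) @^-1` B i.
    by apply/seteqP; split=> x //= Bx i; [move=> _|]; exact: Bx.
  apply: fin_bigcap_measurable => // i _.
  by rewrite -[_ @^-1` _]setTI; exact: measurable_tnth.
- move=> _ _ [A mA ->] [B mB ->]; exists (fun i => A i `&` B i).
    by move=> i; exact: measurableI.
  apply/seteqP; split=> x /=; first by move=> [Ax Bx] i.
  by move=> ABx; split=> i; have [] := ABx i.
- move=> _; exists (fun=> setT) => //; by apply/seteqP; split.
- by rewrite bigcup_const.
- by move=> _ [B mB ->]; exact: m12.
Qed.

End measure_uniqueness.

(** * Independent blocks of a Lévy process *)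

Lemma measurable_rectangle {d} {T : measurableType d} n (B : 'I_n -> set T) :
  (forall i, measurable (B i)) -> measurable (rectangle B).
Proof.
move=> mB.
have -> : rectangle B = \bigcap_(i in [set: 'I_n]) (tnth (T:=T) (n:=n) ^~ i) @^-1` B i.
  by apply/seteqP; split=> x //= Bx i; [move=> _|]; exact: Bx.
apply: fin_bigcap_measurable => // i _.
by rewrite -[_ @^-1` _]setTI; exact: measurable_tnth.
Qed.

Section independence_extension.
Context {d : measure_display} {T : measurableType d} {R : realType}.
Variable P : probability T R.

(** Generating classes, recorded only through the two properties that the extension of independence
    uses. *)
Definition determining {d'} {S : measurableType d'} (G : set (set S)) :=
  G `<=` measurable /\
  forall m1 m2 : {measure set S -> \bar R}, (m1 setT < +oo)%E ->
    (forall B, G B -> m1 B = m2 B) -> forall A, measurable A -> m1 A = m2 A.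

(** With [F] fixed, both sides are finite measures of [A]: the law of [I] restricted to [F], and the
    law of [I] multiplied by [P F]. *)
Let independent_event {d'} {S : measurableType d'} (G : set (set S)) (I : T -> S) (F : set T) :
  determining G -> measurable_fun setT I -> measurable F ->
  (forall B, G B -> P (I @^-1` B `&` F) = (P (I @^-1` B) * P F)%E) ->
  forall A, measurable A -> P (I @^-1` A `&` F) = (P (I @^-1` A) * P F)%E.
Proof.
move=> [_ dG] mI mF IF A mA.
have PF : P F \is a fin_num by exact: fin_num_measure.
pose p : {nonneg R} := NngNum (fine_ge0 (measure_ge0 P F)).
have scE B : mscale p (law P mI) B = (P (I @^-1` B) * P F)%E.
  by rewrite /mscale/= fineK// muleC.
rewrite -scE -[LHS](lawE (mrestr P mF) mI).
apply: dG mA => [|B GB].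
  apply: (@le_lt_trans _ _ 1%E); last exact: ltry.
  by apply: probability_le1; rewrite preimage_setT setTI.
by rewrite [RHS](scE B) -IF.
Qed.

Lemma independent_extension {d1 d2} {S1 : measurableType d1} {S2 : measurableType d2}
    (G1 : set (set S1)) (G2 : set (set S2)) (I : T -> S1) (J : T -> S2) :
  determining G1 -> determining G2 ->
  measurable_fun setT I -> measurable_fun setT J ->
  (forall B B', G1 B -> G2 B' ->
    P (I @^-1` B `&` J @^-1` B') = (P (I @^-1` B) * P (J @^-1` B'))%E) ->
  forall A A', measurable A -> measurable A' ->
    P (I @^-1` A `&` J @^-1` A') = (P (I @^-1` A) * P (J @^-1` A'))%E.
Proof.
move=> dG1 dG2 mI mJ IJ A A' mA mA'.
apply: (independent_event dG1) mA => //.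
  by rewrite -[_ @^-1` _]setTI; exact: mJ.
move=> B GB; rewrite setIC muleC; apply: (independent_event dG2) mA' => //.
  by rewrite -[_ @^-1` _]setTI; apply: mI => //; exact: dG1.1.
by move=> B' GB'; rewrite setIC muleC; exact: IJ.
Qed.

End independence_extension.

Section determining_classes.
Context {R : realType}.

Lemma determining_rectangles {d} {T : measurableType d} n :
  determining (R := R) [set A | exists2 B : 'I_n -> set T, (forall i, measurable (B i)) & A = rectangle B].
Proof.
split=> [_ [B mB ->]|m1 m2 m1oo m12]; first exact: measurable_rectangle.
by apply: measure_eq_tuple => // B mB; apply: m12; exists B.
Qed.

Lemma determining_rect_rays {d} {T : measurableType d} :
  determining (R := R) [set A : set (T * R) | exists2 B, measurable B & exists c, A = B `*` `]-oo, c]].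
Proof.
split=> [_ [B mB [c ->]]|m1 m2 m1oo m12]; first by apply: measurableX => //; exact: measurable_itv.
by apply: measure_eq_rect_rays => // B c mB; apply: m12; exists B => //; exists c.
Qed.

End determining_classes.

Section levy_blocks.
Context {d : measure_display} {T : measurableType d} {R : realType}.
Variables (P : probability T R) (X : R -> {RV P >-> R}).
Hypothesis levyX : levy_process X.
Implicit Types (a s t u c : R) (w : T) (B : set R).

Let X0 w : X 0 w = 0. Proof. by case: levyX. Qed.
Let cX w : cadlag_path (fun t => X t w). Proof. by case: levyX. Qed.
Let mX t : measurable_fun setT (X t). Proof. exact: measurable_funPT. Qed.

Definition increment_path a : R -> T -> R := fun v w => X (a + v) w - X a w.

Lemma increment_path_cadlag a w : 0 <= a -> cadlag_path ((increment_path a)^~ w).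
Proof. by move=> a0; exact: (cadlag_shift (cX w) a0). Qed.

Lemma increment_path_measurable a t : measurable_fun setT (increment_path a t).
Proof. by apply: measurable_funB; exact: mX. Qed.

Lemma increment_path0 : increment_path 0 = (fun t => X t : T -> R).
Proof. by apply/funext => t; apply/funext => w; rewrite /increment_path add0r X0 subr0. Qed.

(** All that is needed of a stretch of path: its increment and its supremum relative to its starting
    value. Both are determined by increments along dyadic grids. *)
Definition block a s w : R * R := (increment_path a s w, run_sup (increment_path a) s w).

Lemma measurable_block a s : 0 <= a -> 0 <= s -> measurable_fun setT (block a s).
Proof.
move=> a0 s0; apply: measurable_fun_pair; first exact: increment_path_measurable.
have := measurable_run_sup (fun w => increment_path_cadlag w a0) (increment_path_measurable a).
move=> mS; rewrite (_ : run_sup _ s =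
  (fun p : R * T => run_sup (increment_path a) (Num.max p.1 0) p.2) \o pair s).
  exact: (measurableT_comp mS (pair1_measurable s)).
by apply/funext => w /=; rewrite max_l.
Qed.

Definition increments N a s w : N.-tuple R :=
  [tuple X (a + s * (i.+1%:R / N%:R)) w - X (a + s * (i%:R / N%:R)) w | i < N].

Lemma measurable_increments N a s : measurable_fun setT (@increments N a s).
Proof.
apply/measurable_fun_tnthP => i.
rewrite (_ : _ \o _ = fun w => X (a + s * (i.+1%:R / N%:R)) w - X (a + s * (i%:R / N%:R)) w).
  by apply: measurable_funB; exact: mX.
by apply/funext => w /=; rewrite tnth_mktuple.
Qed.

(** A single time sequence, with [N] steps of length [s / N] followed by [N] steps of length
    [u / N], brings both blocks under one use of [mutually_independent]; stationarity evaluates the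
    factors. *)
Lemma increments_two_blocks N a s u (B B' : 'I_N -> set R) : (0 < N)%N ->
  0 <= a -> 0 <= s -> 0 <= u ->
  (forall i, measurable (B i)) -> (forall i, measurable (B' i)) ->
  P (@increments N a s @^-1` rectangle B `&` @increments N (a + s) u @^-1` rectangle B') =
  ((\prod_(i < N) P (X (s / N%:R) @^-1` B i)) *
   \prod_(i < N) P (X (u / N%:R) @^-1` B' i))%E.
Proof.
move=> N0 a0 s0 u0 mB mB'.
have N0' : 0 < N%:R :> R by rewrite ltr0n.
have [_ _ /(_ (N + N)%N) indep stat] := levyX.
(* The second formula continues beyond index [2 N], so that the sequence is monotone on all of
   [nat], as [levy_process] asks. *)
pose t i : R := a + if (i <= N)%N then s * (i%:R / N%:R) else s + u * ((i - N)%:R / N%:R).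
have tN i : t (N + i)%N = a + s + u * (i%:R / N%:R).
  rewrite /t; case: ifPn; last by rewrite addKn addrA.
  rewrite -{2}[N]addn0 leq_add2l leqn0 => /eqP->.
  by rewrite addn0 divff ?gt_eqF// mul0r mulr0 addr0 mulr1.
have t0 : 0 <= t 0%N by rewrite /t leq0n mul0r mulr0 addr0.
have tmono : {homo t : i j / (i <= j)%N >-> i <= j}.
  apply: homo_leq => // [x y z xy|i]; first exact: le_trans xy.
  rewrite /t lerD2l; case: (ltngtP i N) => iN.
  - by rewrite ler_wpM2l// ler_pM2r ?invr_gt0// ler_nat.
  - rewrite lerD2l ler_wpM2l// ler_pM2r ?invr_gt0// ler_nat.
    by rewrite leq_sub2r.
  - rewrite iN divff ?gt_eqF// mulr1 lerDl mulr_ge0//.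
pose C (i : 'I_(N + N)) := match fintype.split i with inl j => B j | inr j => B' j end.
have Cl i : C (lshift N i) = B i by rewrite /C (unsplitK (inl i)).
have Cr i : C (rshift N i) = B' i by rewrite /C (unsplitK (inr i)).
have mC i : measurable (C i) by rewrite /C; case: fintype.split.
have := indep t t0 tmono C mC.
set A := (X in P X = _).
have -> : @increments N a s @^-1` rectangle B `&`
    @increments N (a + s) u @^-1` rectangle B' = A.
  apply/seteqP; split=> w /=.
    move=> [Bw B'w] i _; rewrite /= /C; case: splitP => j ij.
      have := Bw j; rewrite /increments tnth_mktuple.
      by rewrite /t ij ltn_ord ltnW.
    have := B'w j; rewrite /increments tnth_mktuple.
    by rewrite ij -addnS !tN.
  move=> Cw; split=> i.
      have := Cw (lshift N i) Logic.I; rewrite Cl /=.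
      by rewrite /increments tnth_mktuple /t ltn_ord ltnW.
    have := Cw (rshift N i) Logic.I; rewrite Cr /=.
    by rewrite /increments tnth_mktuple -addnS !tN.
move=> ->; rewrite big_split_ord/=; congr (_ * _)%E; apply: eq_bigr => i _.
  rewrite Cl /= /t ltn_ord ltnW//.
  rewrite -(stat (a + s * (i%:R / N%:R)) (s / N%:R) (B i))//; last 2 first.
  - by rewrite addr_ge0// mulr_ge0// divr_ge0.
  - by rewrite divr_ge0.
  congr (P _); apply/seteqP; split=> w /=;
    (have <- : a + s * (i%:R / N%:R) + s / N%:R = a + s * (i.+1%:R / N%:R));
    rewrite // -natr1 -addrA; congr (_ + _); field; exact: lt0r_neq0.
rewrite Cr /= -addnS !tN.
rewrite -(stat (a + s + u * (i%:R / N%:R)) (u / N%:R) (B' i))//; last 2 first.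
- by rewrite !addr_ge0// mulr_ge0// divr_ge0.
- by rewrite divr_ge0.
congr (P _); apply/seteqP; split=> w /=;
  (have <- : a + s + u * (i%:R / N%:R) + u / N%:R = a + s + u * (i.+1%:R / N%:R));
  rewrite // -natr1 -addrA; congr (_ + _); field; exact: lt0r_neq0.
Qed.

Lemma increments_rectangle N a s (B : 'I_N -> set R) : (0 < N)%N ->
  0 <= a -> 0 <= s -> (forall i, measurable (B i)) ->
  P (@increments N a s @^-1` rectangle B) = (\prod_(i < N) P (X (s / N%:R) @^-1` B i))%E.
Proof.
move=> N0 a0 s0 mB.
(* A second block of duration 0 without constraints contributes factors 1. *)
have := @increments_two_blocks N a s 0 B (fun=> setT) N0 a0 s0 (lexx _) mB (fun=> measurableT).
rewrite [X in _ = (_ * X)%E]big1 ?mule1; last first.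
  by move=> i _; rewrite preimage_setT probability_setT.
by rewrite (_ : rectangle (fun=> setT) = setT) ?preimage_setT ?setIT//; apply/seteqP; split.
Qed.

Lemma increments_stationary N a s (A : set (N.-tuple R)) : (0 < N)%N ->
  0 <= a -> 0 <= s -> measurable A ->
  P (@increments N a s @^-1` A) = P (@increments N 0 s @^-1` A).
Proof.
move=> N0 a0 s0; have m a' := @measurable_increments N a' s.
rewrite -[LHS](lawE P (m a)) -[RHS](lawE P (m 0)).
apply: measure_eq_tuple => [|B mB].
  by rewrite lawE; apply: le_lt_trans (probability_le1 _ _) (ltry _); rewrite preimage_setT.
exact: etrans (increments_rectangle N0 a0 s0 mB)
  (esym (increments_rectangle N0 (lexx 0) s0 mB)).
Qed.

Lemma increments_indep N s u (A A' : set (N.-tuple R)) : (0 < N)%N ->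
  0 <= s -> 0 <= u -> measurable A -> measurable A' ->
  P (@increments N 0 s @^-1` A `&` @increments N s u @^-1` A') =
  (P (@increments N 0 s @^-1` A) * P (@increments N 0 u @^-1` A'))%E.
Proof.
move=> N0 s0 u0 mA mA'.
rewrite -(@increments_stationary N s u A')//.
apply: (independent_extension (determining_rectangles N) (determining_rectangles N)) => //;
  try exact: measurable_increments.
move=> _ _ [B mB ->] [B' mB' ->]; have := @increments_two_blocks N 0 s u B B' N0 (lexx _) s0 u0 mB mB'.
by rewrite add0r => ->; rewrite !increments_rectangle.
Qed.

End levy_blocks.

Section probability_laws.
Context {d : measure_display} {T : measurableType d} {R : realType}.
Variable P : probability T R.

Definition mfun_of {d'} {S : measurableType d'} (f : T -> S)
  (mf : measurable_fun setT f) : {mfun T >-> S} :=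
  HB.pack_for {mfun T >-> S} f (isMeasurableFun.Build _ _ _ _ f mf).

Definition plaw {d'} {S : measurableType d'} (f : T -> S)
  (mf : measurable_fun setT f) : probability S R := distribution P (mfun_of mf).

Lemma ge0_integral_plaw {d'} {S : measurableType d'} (f : T -> S)
  (mf : measurable_fun setT f) (g : S -> \bar R) :
  measurable_fun setT g -> (forall y, (0 <= g y)%E) ->
  (\int[plaw mf]_y g y = \int[P]_w g (f w))%E.
Proof. by move=> mg g0; rewrite ge0_integral_distribution. Qed.

End probability_laws.

Section block_laws.
Context {d : measure_display} {T : measurableType d} {R : realType}.
Variables (P : probability T R) (X : R -> {RV P >-> R}).
Hypothesis levyX : levy_process X.
Implicit Types (a s t u c : R) (w : T) (B : set R).

Definition psum n (x : n.-tuple R) k := \sum_(0 <= i < k) nth 0 x i.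

Lemma measurable_psum n k : measurable_fun setT (fun x : n.-tuple R => psum x k).
Proof.
apply: measurable_sum => i _.
have [ni|ni] := ltnP i n; last first.
  rewrite (_ : (fun _ => _) = cst 0); first exact: measurable_cst.
  by apply/funext => x; rewrite nth_default// size_tuple.
rewrite (_ : (fun _ => _) = fun x : n.-tuple R => tnth x (Ordinal ni)).
  exact: measurable_tnth.
by apply/funext => x; rewrite (tnth_nth 0).
Qed.

Lemma psum_increments n a s w k : (0 < n)%N -> (k <= n)%N ->
  psum (increments X n a s w) k = increment_path X a (s * (k%:R / n%:R)) w.
Proof.
move=> n0 kn; rewrite /psum (telescope_sumr_eq (fun i => X (a + s * (i%:R / n%:R)) w)) //.
  by rewrite mul0r mulr0 addr0.
move=> i /andP[_ ik]; have ni := leq_trans ik kn.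
by rewrite -[i]/(nat_of_ord (Ordinal ni)) nth_mktuple.
Qed.

Definition gridset n B c : set ((2 ^ n).-tuple R) :=
  [set x | B (psum x (2 ^ n)) /\ forall k, (k <= 2 ^ n)%N -> psum x k <= c].

Lemma measurable_gridset n B c : measurable B -> measurable (@gridset n B c).
Proof.
move=> mB.
have -> : @gridset n B c = (psum (n:=2 ^ n) ^~ (2 ^ n)%N) @^-1` B `&`
    \bigcap_(k in `I_(2 ^ n).+1) (psum (n:=2 ^ n) ^~ k) @^-1` `]-oo, c].
  apply/seteqP; split=> x /= [Bx xc]; split=> // k kn.
apply: measurableI.
  by rewrite -[_ @^-1` _]setTI; exact: measurable_psum.
apply: bigcap_measurable; first by exists 0%N.
by move=> k _; rewrite -[_ @^-1` _]setTI; exact: measurable_psum.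
Qed.

(** The passage from finitely many increments to the supremum: the grid events are nested, so that
    their probabilities converge, and stationarity and independence pass to the limit. *)
Lemma block_grid a s B c : 0 <= a -> 0 <= s ->
  block X a s @^-1` (B `*` `]-oo, c]) =
  \bigcap_n (increments X (2 ^ n) a s @^-1` @gridset n B c).
Proof.
move=> a0 s0; have cXa w := increment_path_cadlag levyX w a0.
have p2 n : (0 < 2 ^ n)%N by rewrite expn_gt0.
apply/seteqP; split=> w.
  rewrite /block/= in_itv/= => -[Bw Sc] n _; split.
    by rewrite psum_increments// divff ?mulr1// pnatr_eq0 -lt0n.
  move=> k kn; rewrite psum_increments//.
  apply: le_trans Sc; apply: path_le_run_sup => //.
  by rewrite mulr_ge0//= ler_piMr// ler_pdivrMr ?ltr0n// mul1r ler_nat.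
move=> Hw; split => /=.
  have [+ _] := Hw 0%N I.
  by rewrite psum_increments// expn0 divff ?mulr1.
rewrite in_itv/=; apply: run_sup_dyadic => // n k kn.
by have [_ /(_ k kn)] := Hw n I; rewrite psum_increments// natrX.
Qed.

Lemma grid_nonincreasing a s B c : 0 <= a -> 0 <= s ->
  nonincreasing_seq (fun n => increments X (2 ^ n) a s @^-1` @gridset n B c).
Proof.
move=> a0 s0; have p2 n : (0 < 2 ^ n)%N by rewrite expn_gt0.
apply/nonincreasing_seqP => n; apply/subsetPset => w [Bw cw]; split.
  move: Bw; rewrite !psum_increments//.
  by rewrite !divff// ?pnatr_eq0 -?lt0n.
(* The point [k / 2^n] has index [2 k] in the next grid. *)
move=> k kn; have := cw k.*2; rewrite !psum_increments//; last first.
  by rewrite expnS mul2n leq_double.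
rewrite expnS mul2n leq_double => /(_ kn).
by rewrite -!muln2 !natrM -mulf_div divff// mulr1.
Qed.

Lemma block_cvg a s B c : 0 <= a -> 0 <= s -> measurable B ->
  P (increments X (2 ^ n) a s @^-1` @gridset n B c) @[n --> \oo] -->
  P (block X a s @^-1` (B `*` `]-oo, c])).
Proof.
move=> a0 s0 mB; rewrite block_grid//; apply: nonincreasing_cvg_mu.
- rewrite ltey_eq fin_num_measure// -[_ @^-1` _]setTI.
  by apply: measurable_increments => //; exact: measurable_gridset.
- move=> n; rewrite -[_ @^-1` _]setTI; apply: measurable_increments => //.
  exact: measurable_gridset.
- apply: bigcapT_measurable => n; rewrite -[_ @^-1` _]setTI.
  by apply: measurable_increments => //; exact: measurable_gridset.
- exact: grid_nonincreasing.
Qed.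

(** The joint law of [X_s] and its running supremum, not of the supremum alone. *)
Definition sup_law s (s0 : 0 <= s) : probability (R * R)%type R :=
  plaw P (measurable_block levyX (lexx 0) s0).

Lemma block_stationary_rect a s B c : 0 <= a -> 0 <= s -> measurable B ->
  P (block X a s @^-1` (B `*` `]-oo, c])) = P (block X 0 s @^-1` (B `*` `]-oo, c])).
Proof.
move=> a0 s0 mB; have p2 n : (0 < 2 ^ n)%N by rewrite expn_gt0.
have := @block_cvg a s B c a0 s0 mB; have := @block_cvg 0 s B c (lexx 0) s0 mB.
under [X in X @ \oo --> _ -> _ -> _]funext => n.
  rewrite -(increments_stationary levyX (p2 n) a0 s0 (measurable_gridset _ mB)).
  over.
move=> h1 h2; exact: (cvg_unique _ h2 h1).
Qed.

Lemma block_indep_rect s u B c B' c' : 0 <= s -> 0 <= u ->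
  measurable B -> measurable B' ->
  (P (block X 0 s @^-1` (B `*` `]-oo, c]) `&` block X s u @^-1` (B' `*` `]-oo, c'])) =
   P (block X 0 s @^-1` (B `*` `]-oo, c])) * P (block X 0 u @^-1` (B' `*` `]-oo, c'])))%E.
Proof.
move=> s0 u0 mB mB'; have p2 n : (0 < 2 ^ n)%N by rewrite expn_gt0.
have mI a t n A : measurable A -> measurable (increments X (2 ^ n) a t @^-1` A).
  by move=> mA; rewrite -[_ @^-1` _]setTI; exact: measurable_increments.
have h1 : P (increments X (2 ^ n) 0 s @^-1` @gridset n B c `&`
    increments X (2 ^ n) s u @^-1` @gridset n B' c') @[n --> \oo] -->
    P (block X 0 s @^-1` (B `*` `]-oo, c]) `&` block X s u @^-1` (B' `*` `]-oo, c'])).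
  rewrite !block_grid// -bigcapI.
  apply: nonincreasing_cvg_mu.
  - by rewrite ltey_eq fin_num_measure//; apply: measurableI; apply: mI; exact: measurable_gridset.
  - by move=> n; apply: measurableI; apply: mI; exact: measurable_gridset.
  - by apply: bigcapT_measurable => n; apply: measurableI; apply: mI; exact: measurable_gridset.
  - move=> m n mn; apply/subsetPset; apply: setISS; apply/subsetPset; exact: grid_nonincreasing mn.
have h2 := cvgeM _ (@block_cvg 0 s B c (lexx 0) s0 mB) (@block_cvg 0 u B' c' (lexx 0) u0 mB').
have E : (fun n => P (increments X (2 ^ n) 0 s @^-1` @gridset n B c `&`
    increments X (2 ^ n) s u @^-1` @gridset n B' c')) =
    (fun n => P (increments X (2 ^ n) 0 s @^-1` @gridset n B c) *
      P (increments X (2 ^ n) 0 u @^-1` @gridset n B' c'))%E.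
  by apply/funext => n; rewrite (increments_indep levyX)//; exact: measurable_gridset.
rewrite E in h1.
have mb a t C e : 0 <= a -> 0 <= t -> measurable C -> measurable (block X a t @^-1` (C `*` `]-oo, e])).
  move=> a0 t0 mC; rewrite -[_ @^-1` _]setTI; apply: measurable_block => //.
  by apply: measurableX => //; exact: measurable_itv.
have h3 := h2 _ (mule_def_fin (fin_num_measure P _ (mb 0 s B c (lexx _) s0 mB))
  (fin_num_measure P _ (mb 0 u B' c' (lexx _) u0 mB'))).
exact: (cvg_unique _ h1 (h3 _)).
Qed.

Lemma block_stationary a s (A : set (R * R)) (a0 : 0 <= a) (s0 : 0 <= s) : measurable A ->
  P (block X a s @^-1` A) = sup_law s0 A.
Proof.
move=> mA; rewrite -(lawE P (measurable_block levyX a0 s0)).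
apply: measure_eq_rect_rays mA => [|B c mB].
  apply: (@le_lt_trans _ _ 1%E); last exact: ltry.
  by apply: probability_le1; rewrite preimage_setT.
exact: block_stationary_rect.
Qed.

(** The Markov property at the fixed time [s]: past and future blocks have a product law, whose
    second factor does not depend on [s]. *)
Lemma block_independent s u (A : set ((R * R) * (R * R))) (s0 : 0 <= s) (u0 : 0 <= u) :
  measurable A ->
  P [set w | A (block X 0 s w, block X s u w)] = (sup_law s0 \x sup_law u0)%E A.
Proof.
move=> mA.
have mb : measurable_fun setT (fun w => (block X 0 s w, block X s u w)).
  by apply: measurable_fun_pair; exact: measurable_block.
rewrite -[LHS](lawE P mb); apply/esym; apply: product_measure_unique mA => /= A1 A2 mA1 mA2.
transitivity (P (block X 0 s @^-1` A1) * P (block X s u @^-1` A2))%E; last first.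
  by congr (_ * _)%E; exact: block_stationary.
apply: (independent_extension determining_rect_rays determining_rect_rays _ _ _ mA1 mA2).
- exact: measurable_block.
- exact: measurable_block.
move=> _ _ [B mB [c ->]] [B' mB' [c' ->]].
rewrite block_indep_rect//; congr (_ * _)%E; apply/esym.
exact: block_stationary_rect.
Qed.

End block_laws.

(** * Scaling and absence of atoms *)

Section null_sets.
Context {R : realType}.
Local Open Scope ereal_scope.

Lemma measure_le {d} {T : measurableType d} (m : {measure set T -> \bar R}) A B :
  measurable A -> measurable B -> A `<=` B -> m A <= m B.
Proof. by move=> mA mB AB; apply: le_measure; rewrite ?inE. Qed.

Lemma measure_null_sub {d} {T : measurableType d} (m : {measure set T -> \bar R}) A B :
  measurable A -> measurable B -> A `<=` B -> m B = 0 -> m A = 0.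
Proof.
move=> mA mB AB B0; apply/eqP; rewrite eq_le measure_ge0 andbT -B0.
exact: measure_le.
Qed.

Lemma measure_bigcup_null {d} {T : measurableType d} (m : {measure set T -> \bar R})
    (F : (set T)^nat) :
  (forall k, measurable (F k)) -> (forall k, m (F k) = 0) -> m (\bigcup_k F k) = 0.
Proof.
move=> mF F0; apply/negligibleP; first exact: bigcupT_measurable.
by apply: negligible_bigcup => k; apply/negligibleP => //; exact: F0.
Qed.

Lemma measureU_null {d} {T : measurableType d} (m : {measure set T -> \bar R}) A B :
  measurable A -> measurable B -> m A = 0 -> m B = 0 -> m (A `|` B) = 0.
Proof.
move=> mA mB A0 B0; apply/negligibleP; first exact: measurableU.
by apply: negligibleU; apply/negligibleP.
Qed.

Lemma measurable_preim {d1 d2} {T1 : measurableType d1} {T2 : measurableType d2} (f : T1 -> T2) A :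
  measurable_fun setT f -> measurable A -> measurable (f @^-1` A).
Proof. by move=> mf mA; rewrite -[_ @^-1` _]setTI; exact: mf. Qed.

Lemma product_swap {d1 d2} {T1 : measurableType d1} {T2 : measurableType d2}
    (m1 : probability T1 R) (m2 : probability T2 R) A : measurable A ->
  (m1 \x m2) A = (m2 \x m1) ((fun z => (z.2, z.1)) @^-1` A).
Proof.
move=> mA; rewrite -(lawE (m2 \x m1) (measurable_swap (T1 := T2) (T2 := T1))).
apply: product_measure_unique mA => A1 A2 mA1 mA2; rewrite lawE.
rewrite (_ : _ @^-1` _ = A2 `*` A1).
  by rewrite -[RHS]muleC; exact: product_measure1E.
by apply/seteqP; split=> -[x y] /= [].
Qed.

Lemma product_null {d1 d2} {T1 : measurableType d1} {T2 : measurableType d2}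
    (m1 : probability T1 R) (m2 : probability T2 R) A : measurable A ->
  (forall x, m2 (xsection A x) = 0) -> (m1 \x m2) A = 0.
Proof. by move=> mA A0; rewrite /product_measure1/= integral0_eq// => x _; exact: A0. Qed.

(** Fubini makes almost every section of each [A n] null. The exceptional sets are countably many,
    so that the charged set [B] has a point that serves all [n] at once. *)
Lemma product_null_sections {d1 d2} {T1 : measurableType d1} {T2 : measurableType d2}
    (m1 : probability T1 R) (m2 : nat -> probability T2 R) (A : nat -> set (T1 * T2)) B :
  (forall n, measurable (A n)) -> (forall n, (m1 \x m2 n) (A n) = 0) ->
  measurable B -> 0 < m1 B -> exists2 x, B x & forall n, m2 n (xsection (A n) x) = 0.
Proof.
move=> mA A0 mB B0.
have ms n : measurable_fun setT (fun x => m2 n (xsection (A n) x)).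
  exact: measurable_fun_xsection.
have N0 : \forall x \ae m1, forall n, m2 n (xsection (A n) x) = 0.
  apply: ae_foralln => n.
  have /(ae_eq_integral_abs m1 measurableT (ms n)).1 :
      \int[m1]_(x in setT) `|m2 n (xsection (A n) x)| = 0.
    by rewrite -(A0 n) /product_measure1; apply: eq_integral => x _; rewrite gee0_abs.
  by apply: filterS => x /(_ Logic.I).
case: N0 => N [mN N0 subN].
apply: contrapT => noB; have BN : B `<=` N.
  move=> x Bx; apply: subN => /= x0; apply: noB; by exists x.
by move: B0; rewrite lt_neqAle => /andP[/eqP + _]; apply; apply/esym; exact: measure_null_sub BN N0.
Qed.

End null_sets.

Section stable_scaling.
Context {d : measure_display} {T : measurableType d} {R : realType}.
Variables (P : probability T R) (alpha : R) (X : R -> {RV P >-> R}).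
Hypothesis alpha12 : 1 < alpha < 2.
Hypothesis stableX : stable_process alpha X.
Hypothesis laplaceX : forall t q : R, 0 < t -> 0 <= q ->
  ('E_P[fun w => expR (- q * X t w)] = (expR (t * q `^ alpha))%:E)%E.
Implicit Types (a s t u c : R) (w : T) (B : set R).

Let levyX : levy_process X. Proof. by case: stableX. Qed.
Let mX t : measurable_fun setT (X t). Proof. exact: measurable_funPT. Qed.
Let alpha0 : 0 < alpha. Proof. by case/andP: alpha12 => /(lt_trans _)->. Qed.

Lemma laplace_integral t q : 0 < t -> 0 <= q ->
  (\int[P]_w (expR (- q * X t w))%:E = (expR (t * q `^ alpha))%:E)%E.
Proof.
move=> t0 q0; rewrite -laplaceX//.
have mf : measurable_fun setT (fun w => expR (- q * X t w)).
  by apply: (measurableT_comp (@measurable_expR R)); apply: measurable_funM.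
by rewrite (expectation_def (mfun_of mf)).
Qed.

Lemma powR_alphaK a : 0 < a -> (a `^ alpha^-1) `^ alpha = a.
Proof. by move=> a0; rewrite -powRrM mulVf ?lt0r_neq0// powRr1// ltW. Qed.

(** The drift [b] allowed by [stable_process] is identified by Laplace transforms at [q = 1] of the
    two laws at time 1: [exp a = exp (- b) * exp a]. *)
Lemma strict_scaling a : 0 < a ->
  same_law P (fun t => X (a * t)) (fun t w => a `^ alpha^-1 * X t w).
Proof.
move=> a0; have [_ /(_ a a0)[b ab]] := stableX.
suff b0 : b = 0.
  move=> n t B t0 mB; rewrite ab//; congr (P _); apply/seteqP; split=> w /= Bw i;
  by have := Bw i; rewrite b0 mul0r addr0.
have mY : measurable_fun setT (fun w => a `^ alpha^-1 * X 1 w + b).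
  by apply: measurable_funD => //; exact: measurable_funM.
have eqlaw A : measurable A -> plaw P (mX a) A = plaw P mY A.
  move=> mA; have := ab 1%N (fun=> 1) (fun=> A) (fun=> ler01) (fun=> mA).
  move=> abA.
  change (P (X a @^-1` A) = P ((fun w => a `^ alpha^-1 * X 1 w + b) @^-1` A)).
  transitivity (P [set w | 'I_1 -> A (X (a * 1) w)]).
    by rewrite mulr1; congr (P _); apply/seteqP; split=> w /=; [move=> ? _|move=> Aw; exact: (Aw ord0)].
  rewrite abA; congr (P _); apply/seteqP; split=> w /=.
    by move=> /(_ ord0); rewrite mulr1.
  by rewrite mulr1.
have me : measurable_fun setT (fun y : R => (expR (- y))%:E).
  apply/measurable_EFinP; apply: (measurableT_comp (@measurable_expR R)).
  exact: oppr_measurable.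
have e0 (y : R) : (0 <= (expR (- y))%:E)%E by rewrite lee_fin expR_ge0.
have E1 := ge0_integral_plaw P (mX a) me e0.
have E2 := ge0_integral_plaw P mY me e0.
have : (\int[plaw P (mX a)]_y (expR (- y))%:E = \int[plaw P mY]_y (expR (- y))%:E)%E.
  by apply: eq_measure_integral => A mA _; exact: eqlaw.
rewrite E1 E2.
under eq_integral do rewrite -mulN1r.
rewrite laplace_integral//.
under eq_integral => w _.
  rewrite opprD expRD mulrC -mulNr EFinM; over.
have mE : measurable_fun setT (fun w => (expR (- a `^ alpha^-1 * X 1 w))%:E).
  apply/measurable_EFinP; apply: (measurableT_comp (@measurable_expR R)).
  exact: measurable_funM.
have E0 w : setT w -> (0 <= (expR (- a `^ alpha^-1 * X 1 w))%:E)%E.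
  by rewrite lee_fin expR_ge0.
rewrite (ge0_integralZl P measurableT mE E0); last by rewrite lee_fin expR_ge0.
rewrite laplace_integral ?powR_ge0// powR_alphaK// powR1 mulr1 mul1r.
rewrite -EFinM -expRD => -[] /expR_inj /eqP.
by rewrite -subr_eq subrr eq_sym oppr_eq0 => /eqP.
Qed.

Lemma grid_eventE a t B c n : 0 <= t ->
  increments X (2 ^ n) 0 t @^-1` gridset (n:=n) B c =
  [set w | B (X t w) /\ forall k, (k <= 2 ^ n)%N -> X (t * (k%:R / (2 ^ n)%:R)) w <= c].
Proof.
move=> t0; have p2 : (0 < 2 ^ n)%N by rewrite expn_gt0.
apply/seteqP; split=> w [Bw cw]; split.
- by move: Bw; rewrite psum_increments// divff ?mulr1 ?pnatr_eq0 -?lt0n// (increment_path0 levyX).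
- by move=> k kn; have := cw k kn; rewrite psum_increments// (increment_path0 levyX).
- by rewrite psum_increments// divff ?mulr1 ?pnatr_eq0 -?lt0n// (increment_path0 levyX).
- by move=> k kn; rewrite psum_increments// (increment_path0 levyX); exact: cw.
Qed.

(** [same_law] speaks of finitely many times only; equality holds on every dyadic grid and passes to
    the limit. *)
Lemma block_scaling a t (A : set (R * R)) : 0 < a -> 0 <= t -> measurable A ->
  P (block X 0 (a * t) @^-1` A) =
  P [set w | A (a `^ alpha^-1 * (block X 0 t w).1, a `^ alpha^-1 * (block X 0 t w).2)].
Proof.
move=> a0 t0 mA; set s := a `^ alpha^-1.
have s0 : 0 < s by exact: powR_gt0.
have at0 : 0 <= a * t by rewrite mulr_ge0// ltW.
have mb u (u0 : 0 <= u) := measurable_block levyX (lexx 0) u0.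
have ms : measurable_fun setT (fun w => (s * (block X 0 t w).1, s * (block X 0 t w).2)).
  have [m1 m2] := (measurable_fun_pairP (block X 0 t)).1 (mb t t0).
  by apply: measurable_fun_pair; apply: measurable_funM => //; exact: measurable_cst.
rewrite -(lawE P (mb _ at0)) -[RHS](lawE P ms).
apply: measure_eq_rect_rays mA => [|B c mB].
  apply: (@le_lt_trans _ _ 1%E); last exact: ltry.
  by apply: probability_le1; rewrite preimage_setT.
rewrite !lawE.
have mB' : measurable ( *%R s @^-1` B) by apply: measurable_preim => //; exact: mulrl_measurable.
have h1 := @block_cvg _ _ _ P X levyX 0 (a * t) B c (lexx _) at0 mB.
have h2 := @block_cvg _ _ _ P X levyX 0 t ( *%R s @^-1` B) (c / s) (lexx _) t0 mB'.
rewrite [in RHS](_ : _ @^-1` (B `*` _) = block X 0 t @^-1` (( *%R s @^-1` B) `*` `]-oo, c / s]%classic)); last first.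
  apply/seteqP; split=> w [/= Bw].
    by rewrite !in_itv/= => cw; split=> //=; rewrite ler_pdivlMr// mulrC.
  by rewrite !in_itv/= => cw; split=> //=; rewrite mulrC -ler_pdivlMr.
suff E n : P (increments X (2 ^ n) 0 (a * t) @^-1` gridset (n:=n) B c) =
    P (increments X (2 ^ n) 0 t @^-1` gridset (n:=n) ( *%R s @^-1` B) (c / s)).
  by rewrite (funext E) in h1; exact: (cvg_unique _ h1 h2).
rewrite !grid_eventE//.
pose tt (i : 'I_(2 ^ n).+1) := t * (i%:R / (2 ^ n)%:R).
pose C (i : 'I_(2 ^ n).+1) := if i == ord_max then B `&` `]-oo, c]%classic else `]-oo, c]%classic.
have tt0 i : 0 <= tt i by rewrite mulr_ge0.
have mC i : measurable (C i).
  by rewrite /C; case: ifP => _ //; apply: measurableI => //; exact: measurable_itv.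
have := strict_scaling a0 tt0 mC.
have tmax : tt ord_max = t by rewrite /tt /= divff ?mulr1// pnatr_eq0 -lt0n expn_gt0.
have H (Y : R -> T -> R) : [set w | forall i, C i (Y (tt i) w)] =
    [set w | B (Y t w) /\ forall k, (k <= 2 ^ n)%N -> Y (t * (k%:R / (2 ^ n)%:R)) w <= c].
  apply/seteqP; split=> w /= Hw.
    split; first by have := Hw ord_max; rewrite /C eqxx tmax => -[].
    move=> k kn; have := Hw (Ordinal (kn : (k < (2 ^ n).+1)%N)); rewrite /C /tt /=.
    by case: ifP => _ => [[_]|] /=; rewrite in_itv.
  case: Hw => Bw cw i; rewrite /C; case: ifPn => [/eqP ->|_] /=.
    split; first by rewrite tmax.
    by rewrite in_itv/=; exact: cw.
  by rewrite in_itv/=; apply: cw; rewrite -ltnS.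
rewrite (H (fun t => X (a * t))) (H (fun t w => s * X t w)) => E.
transitivity (P [set w | B (X (a * t) w) /\ forall k, (k <= 2 ^ n)%N -> X (a * (t * (k%:R / (2 ^ n)%:R))) w <= c]).
  congr (P _); apply/seteqP; split=> w /= [Bw cw]; split=> // k kn.
    by rewrite mulrA; exact: cw.
  by rewrite -mulrA; exact: cw.
rewrite E; congr (P _); apply/seteqP; split=> w /= [Bw cw]; split=> // k kn.
  by rewrite ler_pdivlMr// mulrC; exact: cw.
by rewrite mulrC -ler_pdivlMr//; exact: cw.
Qed.

End stable_scaling.

(** The unions of the [E m] over [m >= n] decrease to the empty set, hence [P (E n)] tends to 0. A
    fixed probability can thus be shown to vanish by splitting off ever shorter time intervals. *)
Lemma evanescent_null {d} {T : measurableType d} {R : realType} (P : probability T R)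
    (E : (set T)^nat) (p : \bar R) :
  (forall n, measurable (E n)) -> (forall w, \forall n \near \oo, ~ E n w) ->
  (\forall n \near \oo, (p <= P (E n))%E) -> (p <= 0)%E.
Proof.
move=> mE E0 pE.
pose F n := \bigcup_(m in [set m | (n <= m)%N]) E m.
have mF n : measurable (F n) by exact: bigcup_measurable.
have FT : \bigcap_n F n = set0.
  rewrite -subset0 => w Fw; have [n _ En] := E0 w.
  have [m nm Em] := Fw n Logic.I; exact: (En m nm).
have cvgF : P (F n) @[n --> \oo] --> 0%E.
  rewrite -(measure0 P) -FT; apply: nonincreasing_cvg_mu => //.
  - by rewrite ltey_eq fin_num_measure.
  - exact: bigcapT_measurable.
  - move=> m n mn; apply/subsetPset => w [k nk Ek]; exists k => //.
    exact: leq_trans mn nk.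
rewrite -(cvg_lim (@ereal_hausdorff R) cvgF).
apply: lime_ge; first by apply/cvg_ex; exists 0%E.
apply: filterS pE => n /le_trans; apply; apply: measure_le => //.
by move=> w Ew; exists n => /=.
Qed.

Lemma measureU_le {d} {T : measurableType d} {R : realType} (m : {measure set T -> \bar R}) A B :
  measurable A -> measurable B -> m B = 0%E -> (m (A `|` B) <= m A)%E.
Proof.
move=> mA mB B0; have le : (m A + m B <= m A)%E by rewrite B0 adde0.
exact: le_trans (measureU2 _ mA mB) le.
Qed.

Lemma measureD_null {d} {T : measurableType d} {R : realType} (m : {measure set T -> \bar R}) A B :
  measurable A -> measurable B -> B `<=` A -> (m A < +oo)%E -> m A = m B ->
  m (A `\` B) = 0%E.
Proof.
move=> mA mB BA Aoo AB; rewrite measureD// setIC (setIidl BA).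
have mBf : m B \is a fin_num by rewrite -AB ge0_fin_numE.
have le : (m A - m B = 0)%E by rewrite AB subee.
exact: le.
Qed.

Section no_atoms.
Context {d : measure_display} {T : measurableType d} {R : realType}.
Variables (P : probability T R) (alpha : R) (X : R -> {RV P >-> R}) (h : R -> R -> R -> R).
Hypothesis alpha12 : 1 < alpha < 2.
Hypothesis stableX : stable_process alpha X.
Hypothesis laplaceX : forall t q : R, 0 < t -> 0 <= q ->
  ('E_P[fun w => expR (- q * X t w)] = (expR (t * q `^ alpha))%:E)%E.
Hypothesis hX : is_killed_density X h.
Implicit Types (a s t u c : R) (w : T) (B : set R).

Let levyX : levy_process X. Proof. by case: stableX. Qed.
Let X0 w : X 0 w = 0. Proof. by case: levyX. Qed.
Let cX w : cadlag_path (fun t => X t w). Proof. by case: levyX. Qed.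
Let mX t : measurable_fun setT (X t). Proof. exact: measurable_funPT. Qed.
Let alpha0 : 0 < alpha. Proof. by case/andP: alpha12 => /(lt_trans _)->. Qed.

Let S t w : R := run_sup X t w.

Lemma block0E t w : block X 0 t w = (X t w, S t w).
Proof. by rewrite /block (increment_path0 levyX). Qed.

Lemma measurable_S t : 0 <= t -> measurable_fun setT (S t).
Proof.
move=> t0; have [_ m2] := (measurable_fun_pairP (block X 0 t)).1 (measurable_block levyX (lexx 0) t0).
by rewrite (_ : S t = snd \o block X 0 t)//; apply/funext => w /=; rewrite (increment_path0 levyX).
Qed.

Lemma measurable_killed_density c t : 0 < c -> 0 < t ->
  measurable_fun `]-oo, c[ (fun x => (h c x t)%:E).
Proof.
move=> c0 t0; apply/measurable_EFinP.
apply: (@open_continuous_measurable_fun _ `]-oo, c[%classic (fun x => h c x t)).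
  exact: interval_open.
move=> x; rewrite inE/= in_itv/= => xc.
by have [_ + _ _] := hX; exact.
Qed.

(** Each path is bounded on [[0, t]], hence seen by the killed density at some integer level;
    countably many null sets remain. *)
Lemma process_dominated t (A : set R) : 0 < t -> measurable A ->
  lebesgue_measure A = 0%E -> P (X t @^-1` A) = 0%E.
Proof.
move=> t0 mA A0.
have mXA := measurable_preim (mX t) mA.
pose F n := X t @^-1` (A `&` `]-oo, n.+1%:R[) `&` S t @^-1` `]-oo, n.+1%:R].
have mF n : measurable (F n).
  apply: measurableI; apply: measurable_preim => //; last exact: measurable_S (ltW t0).
  exact: measurableI.
apply: (@measure_null_sub _ _ _ P _ (\bigcup_n F n)) => //.
- exact: bigcupT_measurable.
- move=> w Aw; pose n := Num.truncn (Num.max (X t w) (S t w)).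
  have : Num.max (X t w) (S t w) < n.+1%:R by exact: truncnS_gt.
  rewrite gt_max => /andP[Xn Sn].
  by exists n => //; rewrite /F /= !in_itv/= Xn (ltW Sn).
apply: measure_bigcup_null => // n.
have [_ _ /(_ n.+1%:R t (A `&` `]-oo, n.+1%:R[)) hP _] := hX.
have mAn : measurable (A `&` `]-oo, n.+1%:R[%classic) by exact: measurableI.
transitivity (P [set w | (A `&` `]-oo, n.+1%:R[%classic) (X t w) /\ run_sup X t w <= n.+1%:R]).
  by congr (P _); apply/seteqP; split=> w /= [Aw]; rewrite ?in_itv/= => Sw.
rewrite hP//.
apply: null_set_integral => //.
  by apply: measurable_funS (measurable_killed_density _ t0) => // x [].
by apply: (measure_null_sub _ _ _ A0) => //; exact: subIsetl.
Qed.

Lemma process_no_atom t x : 0 < t -> P (X t @^-1` [set x]) = 0%E.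
Proof. by move=> t0; apply: process_dominated => //; rewrite lebesgue_measure_set1. Qed.

Lemma run_sup_block_split s u w : 0 <= s -> 0 <= u ->
  S (s + u) w = Num.max (S s w) (X s w + (block X s u w).2).
Proof. by move=> s0 u0; rewrite /S (run_sup_split (cX w) s0 u0). Qed.

Lemma process_block_split s u w : X (s + u) w = X s w + (block X s u w).1.
Proof. by rewrite /block/= /increment_path subrKC. Qed.

Lemma near_inv_lt (e : R) : 0 < e -> \forall n \near \oo, n.+1%:R^-1 < e.
Proof. by move=> e0; exact: (near_infty_natSinv_lt (PosNum e0)). Qed.

Lemma small_time w (e : R) : 0 < e ->
  \forall n \near \oo, S n.+1%:R^-1 w < e /\ `|X n.+1%:R^-1 w| < e.
Proof.
move=> e0; have e2 : 0 < e / 2 by rewrite divr_gt0.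
have [eta eta0 Xe] := cadlag_right (cX w) (lexx 0) e2.
have := near_inv_lt eta0; apply: filterS => n neta.
have Xs s : 0 <= s <= n.+1%:R^-1 -> `|X s w| < e / 2.
  move=> /andP[s0 sn]; have := Xe s s0; rewrite add0r X0 subr0; apply.
  exact: le_lt_trans neta.
split; last first.
  apply: lt_trans (Xs _ _) _; first by rewrite lexx invr_ge0 ler0n.
  by rewrite ltr_pdivrMr// ltr_pMr// ltr1n.
apply: (@le_lt_trans _ _ (e / 2)); last by rewrite ltr_pdivrMr// ltr_pMr// ltr1n.
apply/(run_sup_leP (cX w)) => [|s /Xs]; first by rewrite invr_ge0.
by move=> /ltW; exact: le_trans (ler_norm _).
Qed.

Lemma product_law_null s u (A : set ((R * R) * (R * R))) (F : set T)
    (s0 : 0 <= s) (u0 : 0 <= u) : measurable A -> measurable F ->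
  (forall w, F w -> A (block X 0 s w, block X s u w)) ->
  (sup_law levyX s0 \x sup_law levyX u0)%E A = 0%E -> P F = 0%E.
Proof.
move=> mA mF FA; rewrite -(block_independent levyX s0 u0 mA).
apply: measure_null_sub => //.
have mb : measurable_fun setT (fun w => (block X 0 s w, block X s u w)).
  by apply: measurable_fun_pair; exact: measurable_block.
exact: (measurable_preim mb mA).
Qed.

(** Split at a short time [u]. Either the supremum [c] is attained by time [u], an event whose
    probability tends to 0 with [u], or [c = X_u + S'] with [S'] independent of [X_u], which is null
    since [X_u] has no atom. *)
Lemma run_sup_no_atom t c : 0 < t -> 0 < c -> P (S t @^-1` [set c]) = 0%E.
Proof.
move=> t0 c0; apply/eqP; rewrite eq_le measure_ge0 andbT.
pose E n := S n.+1%:R^-1 @^-1` `[c, +oo[.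
have i0 n : 0 < n.+1%:R^-1 :> R by rewrite invr_gt0.
have mE n : measurable (E n).
  by apply: measurable_preim => //; apply: measurable_S; exact: ltW.
have mSt := measurable_preim (measurable_S (ltW t0)) (measurable_set1 c).
apply: (@evanescent_null _ _ _ P E) => //.
  move=> w; have := small_time w c0; apply: filterS => n [Sc _].
  by rewrite /E /= in_itv/= andbT leNgt Sc.
have := near_inv_lt t0; apply: filterS => n nt.
set u : R := n.+1%:R^-1; rewrite -/u in nt.
have u0 : 0 < u by exact: i0.
have tu0 : 0 < t - u by rewrite subr_gt0.
pose A : set ((R * R) * (R * R)) := [set z | z.1.1 + z.2.2 = c].
have mA : measurable A.
  rewrite (_ : A = (fun z : (R * R) * (R * R) => z.1.1 + z.2.2) @^-1` [set c])//.
  apply: measurable_preim => //; apply: measurable_funD.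
    exact: (measurableT_comp measurable_fst).
  exact: (measurableT_comp measurable_snd).
pose F := [set w | X u w + (block X u (t - u) w).2 = c].
have mF : measurable F.
  rewrite (_ : F = (fun w => X u w + (block X u (t - u) w).2) @^-1` [set c])//.
  apply: measurable_preim => //; apply: measurable_funD => //.
  by have [] := (measurable_fun_pairP (block X u (t - u))).1 (measurable_block levyX (ltW u0) (ltW tu0)).
have F0 : P F = 0%E.
  apply: (@product_law_null u (t - u) A F (ltW u0) (ltW tu0)) => //.
    by move=> w; rewrite /F /A/= (increment_path0 levyX).
  rewrite product_swap//; apply: product_null.
    apply: measurable_preim mA; exact: measurable_swap.
  move=> [x' s'].
  have -> : xsection ((fun z : (R * R) * (R * R) => (z.2, z.1)) @^-1` A) (x', s') = fst @^-1` [set c - s'].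
    apply/seteqP; split=> -[x s]; rewrite /xsection /A/= inE/=.
      by move=> <-; rewrite addrK.
    by move=> ->; rewrite subrK.
  transitivity (P (block X 0 u @^-1` (fst @^-1` [set c - s']))) => //.
  rewrite -(process_no_atom (c - s') u0); congr (P _).
  by apply/seteqP; split=> w /=; rewrite (increment_path0 levyX).
apply: (@le_trans _ _ (P (E n `|` F))).
  apply: measure_le => //; first exact: measurableU.
  move=> w /= Stc; have := run_sup_block_split w (ltW u0) (ltW tu0).
  rewrite subrKC Stc; rewrite /E /F/= in_itv/= andbT -/u.
  by case: (leP (S u w)) => _ ->; [right|left].
exact: measureU_le.
Qed.

Let D t w : R := S t w - X t w.

Lemma measurable_D t : 0 <= t -> measurable_fun setT (D t).
Proof. by move=> t0; apply: measurable_funB => //; exact: measurable_S. Qed.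

Lemma drawdown_block_split s u w : 0 <= s -> 0 <= u ->
  D (s + u) w = Num.max (D s w - (block X s u w).1) ((block X s u w).2 - (block X s u w).1).
Proof.
move=> s0 u0; rewrite /D run_sup_block_split// process_block_split.
rewrite /Num.max; case: ifPn => h1; case: ifPn => h2; move: h1 h2; lra.
Qed.

(** As for the supremum, with the short interval at the end: its increment has no atom and is
    independent of the drawdown before it. *)
Lemma drawdown_no_atom t a : 0 < t -> 0 < a -> P (D t @^-1` [set a]) = 0%E.
Proof.
move=> t0 a0; apply/eqP; rewrite eq_le measure_ge0 andbT.
pose E n := D n.+1%:R^-1 @^-1` `[a, +oo[.
have i0 n : 0 < n.+1%:R^-1 :> R by rewrite invr_gt0.
have mE n : measurable (E n).
  by apply: measurable_preim => //; apply: measurable_D; exact: ltW.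
have mDt := measurable_preim (measurable_D (ltW t0)) (measurable_set1 a).
apply: (@evanescent_null _ _ _ P E) => //.
  have a2 : 0 < a / 2 by rewrite divr_gt0.
  move=> w; have := small_time w a2; apply: filterS => n [Sc].
  rewrite ltr_norml => /andP[Xc _].
  rewrite /E /= in_itv/= andbT => /le_lt_trans; move=> /(_ _ (ltrB Sc Xc)).
  by rewrite opprK -mulr2n -[X in _ < X]mulr_natr divfK ?ltxx// pnatr_eq0.
have := near_inv_lt t0; apply: filterS => n nt.
set v : R := n.+1%:R^-1; rewrite -/v in nt.
have v0 : 0 < v by exact: i0.
have tv0 : 0 < t - v by rewrite subr_gt0.
pose A : set ((R * R) * (R * R)) := [set z | z.1.2 - z.1.1 - z.2.1 = a].
have mA : measurable A.
  rewrite (_ : A = (fun z : (R * R) * (R * R) => z.1.2 - z.1.1 - z.2.1) @^-1` [set a])//.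
  apply: measurable_preim => //; apply: measurable_funB; [apply: measurable_funB|].
  - exact: (measurableT_comp measurable_snd).
  - exact: (measurableT_comp measurable_fst).
  - exact: (measurableT_comp measurable_fst).
have [mb1 mb2] := (measurable_fun_pairP (block X (t - v) v)).1 (measurable_block levyX (ltW tv0) (ltW v0)).
pose F := [set w | D (t - v) w - (block X (t - v) v w).1 = a].
have mF : measurable F.
  rewrite (_ : F = (fun w => D (t - v) w - (block X (t - v) v w).1) @^-1` [set a])//.
  by apply: measurable_preim => //; apply: measurable_funB => //; apply: measurable_D; exact: ltW.
have F0 : P F = 0%E.
  apply: (@product_law_null (t - v) v A F (ltW tv0) (ltW v0)) => //.
    by move=> w; rewrite /F /A/= (increment_path0 levyX).
  apply: product_null => // -[x s].
  have -> : xsection A (x, s) = fst @^-1` [set s - x - a].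
    apply/seteqP; split=> -[x' s']; rewrite /xsection /A/= inE/=.
      by move=> <-; rewrite opprB addrC subrK.
    by move=> ->; rewrite opprB addrC subrK.
  transitivity (P (block X 0 v @^-1` (fst @^-1` [set s - x - a]))) => //.
  rewrite -(process_no_atom (s - x - a) v0); congr (P _).
  by apply/seteqP; split=> w /=; rewrite (increment_path0 levyX).
pose G := [set w | a <= (block X (t - v) v w).2 - (block X (t - v) v w).1].
pose B : set (R * R) := (fun z => z.2 - z.1) @^-1` `[a, +oo[.
have mB : measurable B by apply: measurable_preim => //; exact: measurable_funB.
have GE : G = block X (t - v) v @^-1` B by apply/seteqP; split=> w; rewrite /G /B /= in_itv/= andbT.
have mG : measurable G by rewrite GE; apply: measurable_preim mB; exact: measurable_block (ltW tv0) (ltW v0).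
have PG : P G = P (E n).
  rewrite GE (block_stationary levyX (ltW tv0) (ltW v0) mB).
  transitivity (P (block X 0 v @^-1` B)) => //; congr (P _).
  by apply/seteqP; split=> w; rewrite /B /E /= (increment_path0 levyX).
apply: (@le_trans _ _ (P (F `|` G))).
  apply: measure_le => //; first exact: measurableU.
  move=> w /= Dta; have := drawdown_block_split w (ltW tv0) (ltW v0).
  rewrite subrK Dta; rewrite /F /G/=.
  by case: (leP (D (t - v) w - _)) => _ ->; [right|left].
rewrite -PG setUC; exact: measureU_le.
Qed.

Let s1 t : R := t `^ alpha^-1.

Lemma run_sup_scaling t (B : set R) : 0 < t -> measurable B ->
  P (S t @^-1` B) = P [set w | B (s1 t * S 1 w)].
Proof.
move=> t0 mB.
have mA : measurable (snd @^-1` B : set (R * R)) by exact: measurable_preim.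
have := block_scaling alpha12 stableX laplaceX t0 ler01 mA.
rewrite mulr1 => E; transitivity (P (block X 0 t @^-1` (snd @^-1` B))).
  by congr (P _); apply/seteqP; split=> w /=; rewrite (increment_path0 levyX).
by rewrite E; congr (P _); apply/seteqP; split=> w /=; rewrite (increment_path0 levyX).
Qed.

Lemma drawdown_scaling t (B : set R) : 0 < t -> measurable B ->
  P (D t @^-1` B) = P [set w | B (s1 t * D 1 w)].
Proof.
move=> t0 mB.
have mA : measurable ((fun z => z.2 - z.1) @^-1` B : set (R * R)).
  by apply: measurable_preim => //; exact: measurable_funB.
have := block_scaling alpha12 stableX laplaceX t0 ler01 mA.
rewrite mulr1 => E; transitivity (P (block X 0 t @^-1` ((fun z => z.2 - z.1) @^-1` B))).
  by congr (P _); apply/seteqP; split=> w /=; rewrite (increment_path0 levyX).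
by rewrite E; congr (P _); apply/seteqP; split=> w /=; rewrite (increment_path0 levyX) -mulrBr.
Qed.

(** The factors [s1 (n + 1)] are unbounded, so that a positive value of [V] is eventually scaled
    beyond any bound [y]. *)
Lemma scale_blow_up (V : T -> R) y : measurable_fun setT V ->
  (forall n, P [set w | y < s1 n.+1%:R * V w] = 0%E) -> P [set w | 0 < V w] = 0%E.
Proof.
move=> mV V0.
have mG (v : R) : measurable [set w | y < v * V w].
  rewrite (_ : [set _ | _] = (fun w => v * V w) @^-1` `]y, +oo[%classic); last first.
    by apply/seteqP; split=> w; rewrite /= in_itv/= andbT.
  by apply: measurable_preim => //; exact: measurable_funM.
apply: (@measure_null_sub _ _ _ P _ (\bigcup_n [set w | y < s1 n.+1%:R * V w])).
- rewrite (_ : [set _ | _] = V @^-1` `]0, +oo[%classic); last first.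
    by apply/seteqP; split=> w; rewrite /= in_itv/= andbT.
  exact: measurable_preim.
- exact: bigcupT_measurable.
- move=> w /= Vw.
  pose r := `|y| / V w; have r0 : 0 <= r by rewrite divr_ge0// ltW.
  exists (Num.truncn (r `^ alpha)) => //=; rewrite /s1.
  have lt1 : r `^ alpha < (Num.truncn (r `^ alpha)).+1%:R by exact: truncnS_gt.
  apply: (le_lt_trans (ler_norm y)); rewrite -ltr_pdivrMr// -/r.
  have {1}-> : r = (r `^ alpha) `^ alpha^-1.
    by rewrite -powRrM mulfV ?lt0r_neq0// powRr1.
  by apply: gt0_ltr_powR => //; rewrite ?invr_gt0// nnegrE ?powR_ge0.
- exact: measure_bigcup_null.
Qed.

(** If [X_1 <= 0] almost surely, then [exp (q^alpha) = E exp (- q X_1) >= 1 + q e P (X_1 <= - e)].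
    As [alpha > 1] the left side is [1 + o(q)], so [X_1] would be 0 almost surely, against the
    absence of atoms. *)
Lemma process_pos_charged : P [set w | 0 < X 1 w] <> 0%E.
Proof.
move=> X0'; have /andP[a1 a2] := alpha12.
have mle v : measurable (X 1 @^-1` `]-oo, v]) by exact: measurable_preim.
have le0 (e : R) : 0 < e -> P (X 1 @^-1` `]-oo, - e]) = 0%E.
  move=> e0; set E := X 1 @^-1` _.
  have mE : measurable E by exact: mle.
  have PE : P E \is a fin_num by exact: (fin_num_measure P _ (mle _)).
  apply/eqP; rewrite eq_le measure_ge0 andbT -(fineK PE) lee_fin leNgt; apply/negP => p0.
  set p := fine (P E) in p0.
  (* [q] below is chosen with [q^alpha = q * dl]. Then [1 + q e p <= exp (q dl) <= 1 + 2 q dl] gives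
     [p e <= 2 dl <= p e / 2], a contradiction. *)
  pose dl : R := Num.min (1 / 2) (p * e / 4).
  have dl0 : 0 < dl by rewrite lt_min divr_gt0//= divr_gt0// mulr_gt0.
  pose q := dl `^ (alpha - 1)^-1.
  have q0 : 0 < q by exact: powR_gt0.
  have qE : q `^ alpha = q * dl.
    rewrite -[alpha in LHS](subrK 1) powRD; last by rewrite lt0r_neq0// implybT.
    rewrite powRr1 ?ltW// mulrC; congr (_ * _).
    by rewrite -powRrM mulVf ?subr_eq0 ?gt_eqF// powRr1// ltW.
  have dl1 : dl <= 1 / 2 by rewrite ge_min lexx.
  have dl2 : dl <= p * e / 4 by rewrite ge_min lexx orbT.
  have q1 : q <= 1.
    have -> : 1 = 1 `^ (alpha - 1)^-1 :> R by rewrite powR1.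
    apply: ge0_ler_powR.
    - by rewrite invr_ge0 subr_ge0 ltW.
    - by rewrite nnegrE ltW.
    - by rewrite nnegrE ler01.
    - lra.
  have : ((1 + q * e * p)%:E <= (expR (q * dl))%:E)%E.
    rewrite -qE -[q `^ alpha]mul1r -(laplace_integral laplaceX ltr01 (ltW q0)).
    have mone : measurable_fun setT (fun w => (1 + q * e * \1_E w)%:E).
      apply/measurable_EFinP; apply: measurable_funD; first exact: measurable_cst.
      by apply: measurable_funM; [exact: measurable_cst|exact: measurable_indic].
    apply: (@le_trans _ _ (\int[P]_w (1 + q * e * \1_E w)%:E)%E).
      under eq_integral do rewrite EFinD.
      rewrite ge0_integralD//=; last 2 first.
      - by move=> w _; rewrite lee_fin mulr_ge0// mulr_ge0// ltW.
      - apply/measurable_EFinP; apply: measurable_funM; first exact: measurable_cst.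
        exact: measurable_indic.
      rewrite integral_cst//= probability_setT mule1.
      under eq_integral do rewrite EFinM.
      rewrite ge0_integralZl//=; last 2 first.
      - by apply/measurable_EFinP; exact: measurable_indic.
      - by rewrite lee_fin mulr_ge0// ltW.
      have -> : (\int[P]_x (\1_E x)%:E = p%:E)%E.
        by rewrite integral_indic// setIT /p fineK.
      by rewrite -EFinM -EFinD.
    apply: ae_ge0_le_integral => //.
    - by move=> w _; rewrite lee_fin addr_ge0// mulr_ge0// mulr_ge0// ltW.
    - by apply/measurable_EFinP; apply: (measurableT_comp (@measurable_expR R)); exact: measurable_funM.
    exists [set w | 0 < X 1 w]; split => //.
      rewrite (_ : [set _ | _] = X 1 @^-1` `]0, +oo[%classic); last first.
        by apply/seteqP; split=> w; rewrite /= in_itv/= andbT.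
      exact: measurable_preim.
    move=> w; apply: contra_notP => /negP; rewrite -leNgt => Xw _; rewrite lee_fin.
    have := expR_ge1Dx (- q * X 1 w); apply: le_trans; rewrite lerD2l.
    rewrite indicE; case: (boolP (w \in E)) => [|_].
      rewrite inE /E/= in_itv/= mulr1 => Xe.
      by rewrite mulNr -mulrN ler_pM2l// lerNr.
    by rewrite mulr0 mulNr -mulrN mulr_ge0 ?oppr_ge0// ltW.
  rewrite lee_fin => le1.
  have qd : q * dl <= 1 / 2 by apply: le_trans dl1; rewrite ler_piMl// ltW.
  have qd0 : 0 < q * dl by exact: mulr_gt0.
  have : expR (q * dl) <= 1 + 2 * (q * dl).
    have := expR_ge1Dx (- (q * dl)); rewrite expRN => hh.
    have e0' := expR_gt0 (q * dl).
    have : (1 - q * dl) * expR (q * dl) <= 1 by rewrite -ler_pdivlMr// div1r.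
    nra.
  move=> le2; have := le_trans le1 le2; rewrite lerD2l.
  move=> le3; have : q * (e * p) <= q * (2 * dl) by lra.
  rewrite ler_pM2l// => le4; have pe0 : 0 < p * e by exact: mulr_gt0.
  suff : p * e < p * e by rewrite ltxx.
  lra.
have neg0 : P (\bigcup_n (X 1 @^-1` `]-oo, - n.+1%:R^-1])) = 0%E.
  by apply: measure_bigcup_null => // n; apply: le0; rewrite invr_gt0.
have X10 := process_no_atom 0 (@ltr01 R).
have : P setT = 0%E.
  apply: (@measure_null_sub _ _ _ P _ ((\bigcup_n (X 1 @^-1` `]-oo, - n.+1%:R^-1])) `|`
     (X 1 @^-1` [set 0] `|` [set w | 0 < X 1 w]))) => //.
  - apply: measurableU; first exact: bigcupT_measurable.
    apply: measurableU; first exact: measurable_preim.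
    rewrite (_ : [set _ | _] = X 1 @^-1` `]0, +oo[%classic); last first.
      by apply/seteqP; split=> w; rewrite /= in_itv/= andbT.
    exact: measurable_preim.
  - move=> w _; case: (ltgtP (X 1 w) 0) => Xw; [left|by right; right|by right; left].
    have := near_inv_lt (etrans (oppr_gt0 _) Xw) => -[n _ /(_ n (leqnn n))/= nX].
    by exists n => //=; rewrite in_itv/= lerNr ltW.
  - apply: measureU_null => //.
    + exact: bigcupT_measurable.
    + apply: measurableU; first exact: measurable_preim.
      rewrite (_ : [set _ | _] = X 1 @^-1` `]0, +oo[%classic); last first.
        by apply/seteqP; split=> w; rewrite /= in_itv/= andbT.
      exact: measurable_preim.
    + apply: measureU_null => //.
      rewrite (_ : [set _ | _] = X 1 @^-1` `]0, +oo[%classic); last first.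
        by apply/seteqP; split=> w; rewrite /= in_itv/= andbT.
      exact: measurable_preim.
by rewrite probability_setT => /eqP; rewrite onee_eq0.
Qed.

(** [X_1 >= 0] almost surely would give [E exp (- X_1) <= 1], whereas this expectation is
    [exp 1]. *)
Lemma process_neg_charged : P [set w | X 1 w < 0] <> 0%E.
Proof.
move=> X0'.
have := laplace_integral laplaceX ltr01 (@ler01 R).
rewrite powR1 mulr1 => E.
have : (\int[P]_w (expR (- 1 * X 1 w))%:E <= \int[P]_w (cst 1 w))%E.
  apply: ae_ge0_le_integral => //.
    by apply/measurable_EFinP; apply: (measurableT_comp (@measurable_expR R)); exact: measurable_funM.
  exists [set w | X 1 w < 0]; split => //.
    rewrite (_ : [set _ | _] = X 1 @^-1` `]-oo, 0[%classic); last first.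
      by apply/seteqP; split=> w; rewrite /= in_itv/=.
    exact: measurable_preim.
  move=> w; apply: contra_notP => /negP; rewrite -leNgt => Xw _; rewrite lee_fin.
  by rewrite mulN1r -[leRHS]expR0 ler_expR oppr_le0.
rewrite E integral_cst//= mul1e probability_setT lee_fin leNgt.
by rewrite -[X in X < _]expR0 ltr_expR ltr01.
Qed.

Let mSB t (B : set R) : 0 <= t -> measurable B -> measurable (S t @^-1` B).
Proof. by move=> t0 mB; apply: measurable_preim => //; exact: measurable_S. Qed.

(** By scaling [P (S_t <= 0)] is constant in [t], so that on [S_1 <= 0] almost surely
    [X_1 + S'_n <= 0] for every [n >= 1], where [S'] is the supremum after time 1. Were this event
    charged, Fubini would fix a value [x] of [X_1] with [S_n <= - x] almost surely for all [n];
    scaling then gives [S_1 <= 0], hence [X_1 <= 0], almost surely. *)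
Lemma run_sup_pos t : 0 < t -> P [set w | S t w <= 0] = 0%E.
Proof.
have rayE u : [set w | S u w <= 0] = S u @^-1` `]-oo, 0].
  by apply/seteqP; split=> w; rewrite /= in_itv/=.
have mS0 u : 0 <= u -> measurable [set w | S u w <= 0].
  by move=> u0; rewrite rayE; exact: mSB.
have const u : 0 < u -> P [set w | S u w <= 0] = P [set w | S 1 w <= 0].
  move=> u0; rewrite [X in P X]rayE run_sup_scaling//; congr (P _).
  apply/seteqP; split=> w /=; rewrite in_itv/= pmulr_rle0 ?powR_gt0//.
move=> t0; rewrite const//; apply: contrapT => /eqP p0.
have {}p0 : (0 < P [set w | (S 1 w <= 0)%R])%E by rewrite lt0e p0 measure_ge0.
have n0 n : 0 <= n.+1%:R :> R by [].
have n0' n : 0 < n.+1%:R :> R by [].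
pose m1 := sup_law levyX (@ler01 R).
pose m2 n := sup_law levyX (n0 n).
pose A (n : nat) : set ((R * R) * (R * R)) := [set z | z.1.2 <= 0 /\ 0 < z.1.1 + z.2.2].
have mA n : measurable (A n).
  rewrite (_ : A n = ((fun z => z.1.2) @^-1` `]-oo, 0] `&` (fun z => z.1.1 + z.2.2) @^-1` `]0, +oo[%classic)); last first.
    by apply/seteqP; split=> z; rewrite /A/= !in_itv/= andbT.
  apply: measurableI; apply: measurable_preim => //.
    exact: (measurableT_comp measurable_snd).
  apply: measurable_funD; first exact: (measurableT_comp measurable_fst).
  exact: (measurableT_comp measurable_snd).
have A0 n : (m1 \x m2 n)%E (A n) = 0%E.
  rewrite -(block_independent levyX (@ler01 R) (n0 n) (mA n)).
  set F := [set w | _].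
  have FE : F = [set w | S 1 w <= 0] `\` [set w | S (1 + n.+1%:R) w <= 0].
    apply/seteqP; split=> w; rewrite /F /A/= (increment_path0 levyX) run_sup_block_split// ge_max.
      by move=> [S0 pos]; split=> // /andP[_ /(lt_le_trans pos)]; rewrite ltxx.
    by move=> [S0]; rewrite S0/= => /negP; rewrite -ltNge.
  have n1 : 0 < 1 + n.+1%:R :> R by rewrite addr_gt0.
  have sub : [set w | S (1 + n.+1%:R) w <= 0] `<=` [set w | S 1 w <= 0].
    by move=> w /=; rewrite run_sup_block_split// ge_max => /andP[].
  rewrite FE; apply: measureD_null => //; [exact: mS0|exact: mS0 (ltW _)| |exact: (esym (const _ n1))].
  by rewrite ltey_eq fin_num_measure//; exact: mS0.
have mB : measurable (snd @^-1` `]-oo, 0] : set (R * R)) by exact: measurable_preim.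
have B0 : (0 < m1 (snd @^-1` `]-oo, 0%R]))%E.
  rewrite (_ : m1 _ = P [set w | S 1 w <= 0])//.
  transitivity (P (block X 0 1 @^-1` (snd @^-1` `]-oo, 0]))) => //; congr (P _).
  by apply/seteqP; split=> w /=; rewrite (increment_path0 levyX) in_itv.
have [[x s]/= Bs sec] := product_null_sections mA A0 mB B0.
apply: process_pos_charged.
have m0 (V : T -> R) : measurable_fun setT V -> measurable [set w | 0 < V w].
  move=> mV; rewrite (_ : [set _ | _] = V @^-1` `]0, +oo[%classic); last first.
    by apply/seteqP; split=> w; rewrite /= in_itv/= andbT.
  exact: measurable_preim.
have mS1 := measurable_S (@ler01 R).
apply: (@measure_null_sub _ _ _ P _ [set w | 0 < S 1 w]); [exact: m0|exact: m0| |].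
  move=> w /= /lt_le_trans; apply; apply: path_le_run_sup => //.
  by rewrite ler01 lexx.
apply: (scale_blow_up (y := - x) mS1) => n.
have := @run_sup_scaling n.+1%:R `]- x, +oo[%classic (n0' n) (measurable_itv _).
rewrite (_ : [set w | `]- x, +oo[%classic _] = [set w | - x < s1 n.+1%:R * S 1 w]); last first.
  by apply/seteqP; split=> w; rewrite /= in_itv/= andbT.
move=> <-; rewrite -(sec n).
transitivity (P (block X 0 n.+1%:R @^-1` (xsection (A n) (x, s)))) => //; congr (P _).
apply/seteqP; split=> w; rewrite /xsection /A /= inE/= (increment_path0 levyX) in_itv/= andbT.
  by rewrite -[- x]add0r ltrBlDl => ?; split=> //; move: Bs; rewrite in_itv.
by move=> [_]; rewrite -[- x]add0r ltrBlDl.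
Qed.

(** The argument for the supremum with the order of the blocks reversed: the unit block comes last
    and the long blocks precede it. The contradiction is now with [process_neg_charged]. *)
Lemma drawdown_pos t : 0 < t -> P [set w | D t w <= 0] = 0%E.
Proof.
have rayE u : [set w | D u w <= 0] = D u @^-1` `]-oo, 0].
  by apply/seteqP; split=> w; rewrite /= in_itv/=.
have mD0 u : 0 <= u -> measurable [set w | D u w <= 0].
  by move=> u0; rewrite rayE; apply: measurable_preim => //; exact: measurable_D.
have const u : 0 < u -> P [set w | D u w <= 0] = P [set w | D 1 w <= 0].
  move=> u0; rewrite [X in P X]rayE drawdown_scaling//; congr (P _).
  by apply/seteqP; split=> w /=; rewrite in_itv/= pmulr_rle0 ?powR_gt0.
move=> t0; rewrite const//; apply: contrapT => /eqP p0.
have {}p0 : (0 < P [set w | (D 1 w <= 0)%R])%E by rewrite lt0e p0 measure_ge0.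
have n0 n : 0 <= n.+1%:R :> R by [].
have n0' n : 0 < n.+1%:R :> R by [].
pose m1 := sup_law levyX (@ler01 R).
pose m2 n := sup_law levyX (n0 n).
(* first coordinate: the last unit of time; second coordinate: the n + 1 units before it *)
pose A (n : nat) : set ((R * R) * (R * R)) :=
  [set z | z.1.2 - z.1.1 <= 0 /\ z.1.1 < z.2.2 - z.2.1].
have m11 : measurable_fun setT (fun z : (R * R) * (R * R) => z.1.1) by exact: (measurableT_comp measurable_fst).
have m12 : measurable_fun setT (fun z : (R * R) * (R * R) => z.1.2) by exact: (measurableT_comp measurable_snd).
have m21 : measurable_fun setT (fun z : (R * R) * (R * R) => z.2.1) by exact: (measurableT_comp measurable_fst).
have m22 : measurable_fun setT (fun z : (R * R) * (R * R) => z.2.2) by exact: (measurableT_comp measurable_snd).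
have mA n : measurable (A n).
  rewrite (_ : A n = ((fun z => z.1.2 - z.1.1) @^-1` `]-oo, 0] `&` (fun z => z.2.2 - z.2.1 - z.1.1) @^-1` `]0, +oo[%classic)); last first.
    by apply/seteqP; split=> z; rewrite /A/= !in_itv/= andbT subr_gt0.
  apply: measurableI; apply: measurable_preim => //; first exact: measurable_funB.
  by apply: measurable_funB => //; exact: measurable_funB.
have A0 n : (m1 \x m2 n)%E (A n) = 0%E.
  rewrite product_swap//.
  have msA : measurable ((fun z : (R * R) * (R * R) => (z.2, z.1)) @^-1` A n).
    by apply: measurable_preim (mA n); exact: measurable_swap.
  rewrite -(block_independent levyX (n0 n) (@ler01 R) msA).
  set F := [set w | _].
  pose G := [set w | (block X n.+1%:R 1 w).2 - (block X n.+1%:R 1 w).1 <= 0].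
  have mB : measurable ((fun z => z.2 - z.1) @^-1` `]-oo, 0] : set (R * R)).
    by apply: measurable_preim => //; exact: measurable_funB.
  have GE : G = block X n.+1%:R 1 @^-1` ((fun z => z.2 - z.1) @^-1` `]-oo, 0]).
    by apply/seteqP; split=> w; rewrite /G/= in_itv.
  have mG : measurable G.
    by rewrite GE; apply: measurable_preim mB; exact: measurable_block.
  have PG : P G = P [set w | D 1 w <= 0].
    rewrite GE (block_stationary levyX (n0 n) (@ler01 R) mB).
    transitivity (P (block X 0 1 @^-1` ((fun z => z.2 - z.1) @^-1` `]-oo, 0]))) => //; congr (P _).
    by apply/seteqP; split=> w; rewrite /= (increment_path0 levyX) in_itv.
  have n1 : 0 < n.+1%:R + 1 :> R by rewrite addr_gt0.
  have splitD w := drawdown_block_split w (n0 n) (@ler01 R).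
  have FE : F = G `\` [set w | D (n.+1%:R + 1) w <= 0].
    apply/seteqP; split=> w; rewrite /F /A /G/= (increment_path0 levyX) splitD ge_max.
      by move=> [G0 pos]; split=> // /andP[+ _]; rewrite subr_le0 => /(lt_le_trans pos); rewrite ltxx.
    by move=> [G0]; rewrite G0 andbT => /negP; rewrite -ltNge subr_gt0.
  have sub : [set w | D (n.+1%:R + 1) w <= 0] `<=` G.
    by move=> w /=; rewrite splitD ge_max => /andP[].
  rewrite FE; apply: measureD_null => //; [exact: mD0 (ltW _)| |exact: (etrans PG (esym (const _ n1)))].
  by rewrite ltey_eq fin_num_measure.
have mB : measurable ((fun z => z.2 - z.1) @^-1` `]-oo, 0] : set (R * R)).
  by apply: measurable_preim => //; exact: measurable_funB.
have B0 : (0 < m1 ((fun z : R * R => (z.2 - z.1)%R) @^-1` `]-oo, 0%R]))%E.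
  rewrite (_ : m1 _ = P [set w | D 1 w <= 0])//.
  transitivity (P (block X 0 1 @^-1` ((fun z => z.2 - z.1) @^-1` `]-oo, 0]))) => //; congr (P _).
  by apply/seteqP; split=> w /=; rewrite (increment_path0 levyX) in_itv.
have [[x s]/= Bs sec] := product_null_sections mA A0 mB B0.
have D1 : P [set w | 0 < D 1 w] = 0%E.
  apply: (scale_blow_up (y := x) (measurable_D (@ler01 R))) => n.
  have := @drawdown_scaling n.+1%:R `]x, +oo[%classic (n0' n) (measurable_itv _).
  rewrite (_ : [set w | `]x, +oo[%classic _] = [set w | x < s1 n.+1%:R * D 1 w]); last first.
    by apply/seteqP; split=> w; rewrite /= in_itv/= andbT.
  move=> <-; rewrite -(sec n).
  transitivity (P (block X 0 n.+1%:R @^-1` (xsection (A n) (x, s)))) => //; congr (P _).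
  apply/seteqP; split=> w; rewrite /xsection /A /= inE/= (increment_path0 levyX) in_itv/= andbT.
    by move=> ?; split=> //; move: Bs; rewrite in_itv.
  by case.
apply: process_neg_charged.
apply: (measure_null_sub _ _ _ D1).
- rewrite (_ : [set _ | _] = X 1 @^-1` `]-oo, 0[%classic); last first.
    by apply/seteqP; split=> w; rewrite /= in_itv/=.
  exact: measurable_preim.
- rewrite (_ : [set _ | _] = D 1 @^-1` `]0, +oo[%classic); last first.
    by apply/seteqP; split=> w; rewrite /= in_itv/= andbT.
  by apply: measurable_preim => //; exact: measurable_D.
move=> w /= X10; rewrite /D subr_gt0; apply: (lt_le_trans X10).
rewrite -[X in X <= _](X0 w); apply: path_le_run_sup => //.
by rewrite lexx ler01.
Qed.

End no_atoms.

(** * Windows around the passage time *)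

Section passage_windows.
Context {R : realType} {T : Type} (X : R -> T -> R) (w : T).
Hypotheses (cX : cadlag_path (X^~ w)) (X0 : X 0 w = 0).
Implicit Types a b z c L d t tau : R.

(* Shortly before a jump across level 1, [t] is in a window of length [d] during
   a time of about [d]; if there is no such jump, the windows disappear with [d]. *)
Definition window a b1 b2 z c L d t : Prop :=
  [/\ 0 <= t <= a, run_sup X t w <= c, b1 < X t w < b2,
      z < X (t + d) w - X t w & L < X (t + d) w].

Let X01 : X 0 w < 1. Proof. by rewrite X0. Qed.

(** As [d] tends to 0 the two ends of the window see [X_{tau-}] and [X_tau], so that strict
    conditions on these limits are inherited. Since [X_tau] may be exactly 1, the right end is only
    known to exceed levels [L < 1]. *)
Lemma window_before_passage a b1 b2 z c L tau :
  passage_time X 1 w = tau%:E -> tau < a -> b1 < left_value X tau w < b2 ->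
  z < jump X tau w -> run_sup_left X tau w < c -> L < 1 ->
  exists2 eta, 0 < eta & forall d t, 0 < d < eta -> tau - d < t < tau ->
    window a b1 b2 z c L d t.
Proof.
move=> Ttau taua /andP[b1l lb2] zj Sc L1.
have tau0 : 0 < tau by rewrite -lte_fin -Ttau passage_time_gt0.
have X1 := at_passage cX Ttau.
pose l := left_value X tau w.
have zj' : z < X tau w - l by [].
(* The increment over the window is a difference of two approximated values, whence half of the
   margin over [z]. *)
pose e := Num.min (Num.min (l - b1) (b2 - l)) (Num.min ((X tau w - l - z) / 2) (X tau w - L)).
have e0 : 0 < e by rewrite !lt_min !subr_gt0 b1l lb2 divr_gt0 ?subr_gt0//= (lt_le_trans L1).
have [e1 e2 e3 e4] : [/\ e <= l - b1, e <= b2 - l, e <= (X tau w - l - z) / 2 & e <= X tau w - L].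
  by split; rewrite /e !ge_min lexx ?orbT.
have [eta1 /andP[eta10 eta1t] Xl] := left_valueP cX tau0 e0.
have [eta2 eta20 Xr] := cadlag_right cX (ltW tau0) e0.
exists (Num.min eta1 eta2); first by rewrite lt_min eta10.
move=> d t /andP[d0]; rewrite lt_min => /andP[d1 d2] /andP[dt ttau].
have t0 : 0 <= t by lra.
have := Xl t; have -> : tau - eta1 < t by lra.
move=> /(_ erefl ttau); rewrite -/l ltr_norml => /andP[h1 h2].
have := Xr (t + d); have -> : tau <= t + d by lra.
have -> : t + d < tau + eta2 by lra.
move=> /(_ erefl erefl); rewrite ltr_norml => /andP[h3 h4].
split.
- by apply/andP; split => //; lra.
- by apply/ltW; apply: le_lt_trans Sc; apply: run_sup_left_ge => //; rewrite t0.
- by apply/andP; split; lra.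
- by lra.
- by lra.
Qed.

Lemma window_passage t d : 0 <= t -> 0 < d -> run_sup X t w <= 1 -> 1 < X (t + d) w ->
  exists2 tau, passage_time X 1 w = tau%:E & t <= tau <= t + d.
Proof.
move=> t0 d0 S1 X1.
have td0 : 0 < t + d by rewrite ltr_wpDl.
have le1 := passage_time_le td0 X1.
have ge1 : (t%:E <= passage_time X 1 w)%E.
  apply: le_ereal_inf_tmp => _ [s [s0 X1s] <-]; rewrite lee_fin leNgt; apply/negP => st.
  have : X s w <= 1 by apply: ((run_sup_leP cX 1 t0).1 S1); rewrite !ltW.
  by rewrite leNgt X1s.
move: le1 ge1; case: passage_time => // tau.
by rewrite !lee_fin => h1 h2; exists tau => //; rewrite h2.
Qed.

Definition passed_within a b1 b2 z c : Prop := exists tau,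
  [/\ passage_time X 1 w = tau%:E, tau <= a, b1 <= left_value X tau w <= b2,
      z <= jump X tau w & run_sup_left X tau w <= c].

(** With [L = 1] every window contains the passage time, and its data converge to those at the
    passage. A weak condition that fails there fails with a margin, hence for all short windows. *)
Lemma no_window a b1 b2 z c : 0 < z -> c <= 1 -> ~ passed_within a b1 b2 z c ->
  exists2 eta, 0 < eta & forall d t, 0 < d < eta -> ~ window a b1 b2 z c 1 d t.
Proof.
move=> z0 c1 npass.
have [Too|/eqP Tfin] := eqVneq (passage_time X 1 w) +oo%E.
  exists 1 => // d t /andP[d0 _] [/andP[t0 _] Sc _ _ X1].
  have [tau] := window_passage t0 d0 (le_trans Sc c1) X1.
  by rewrite Too.
have [tau Ttau] : exists tau, passage_time X 1 w = tau%:E.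
  have := passage_time_ge0 X w 1; move: Tfin; case: passage_time => // r _ _; by exists r.
have tau0 : 0 < tau by rewrite -lte_fin -Ttau passage_time_gt0.
have inw d t : 0 < d -> window a b1 b2 z c 1 d t -> tau - d <= t <= tau.
  move=> d0 [/andP[t0 _] Sc _ _ X1].
  have [tau'] := window_passage t0 d0 (le_trans Sc c1) X1.
  rewrite Ttau => -[<-] /andP[h1 h2]; apply/andP; split => //; lra.
have [taua|taua] := leP tau a; last first.
  exists (tau - a); first by rewrite subr_gt0.
  move=> d t /andP[d0 da] W; have /andP[h1 h2] := inw d t d0 W.
  case: W => /andP[_ ta] _ _ _ _; lra.
pose l := left_value X tau w.
have closer e : 0 < e -> exists2 eta, 0 < eta & forall d t, 0 < d < eta ->
    window a b1 b2 z c 1 d t -> `|X t w - l| < e /\ `|X (t + d) w - X tau w| < e.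
  move=> e0.
  have [eta1 /andP[eta10 eta1t] Xl] := left_valueP cX tau0 e0.
  have [eta2 eta20 Xr] := cadlag_right cX (ltW tau0) e0.
  have [eta3 eta30 Xz] := cadlag_right cX (ltW tau0) z0.
  exists (Num.min eta1 (Num.min eta2 eta3)); first by rewrite !lt_min eta10 eta20.
  move=> d t /andP[d0]; rewrite !lt_min => /and3P[d1 d2 d3] W.
  have /andP[h1 h2] := inw d t d0 W.
  (* A window starting at [tau] is excluded by right continuity: its increment would be smaller than
     [z]. *)
  have ttau : t < tau.
    rewrite lt_neqAle h2 andbT; apply/eqP => ttau; case: W => _ _ _ + _.
    have := Xz (t + d); have -> : tau <= t + d by lra.
    have -> : t + d < tau + eta3 by lra.
    move=> /(_ erefl erefl); rewrite ltr_norml ttau => /andP[_ /ltW]; rewrite leNgt => /negP.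
    by [].
  split; first by apply: Xl => //; lra.
  by apply: Xr; lra.
have [b1l|lb1] := leP b1 l; last first.
  have [eta eta0 He] := closer _ (etrans (subr_gt0 _ _) lb1).
  exists eta => // d t dd W; have [] := He d t dd W.
  case: W => _ _ /andP[h1 h2] _ _; rewrite ltr_norml => /andP[h3 h4] _; lra.
have [lb2|b2l] := leP l b2; last first.
  have [eta eta0 He] := closer _ (etrans (subr_gt0 _ _) b2l).
  exists eta => // d t dd W; have [] := He d t dd W.
  case: W => _ _ /andP[h1 h2] _ _; rewrite ltr_norml => /andP[h3 h4] _; lra.
have [zj|jz] := leP z (jump X tau w); last first.
  have jz' : X tau w - l < z by [].
  have e0 : 0 < (z - (X tau w - l)) / 2 by rewrite divr_gt0// subr_gt0.
  have [eta eta0 He] := closer _ e0.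
  exists eta => // d t dd W; have [] := He d t dd W.
  case: W => _ _ _ h1 _; rewrite !ltr_norml => /andP[h3 h4] /andP[h5 h6]; lra.
have [Sc|cS] := leP (run_sup_left X tau w) c.
  by exfalso; apply: npass; exists tau; split => //; rewrite -/l b1l.
have [s s0tau cXs] : exists2 s, 0 <= s < tau & c < X s w.
  apply: contrapT => noS; move: cS; rewrite ltNge => /negP; apply.
  apply/run_sup_left_leP => // s s0tau; rewrite leNgt; apply/negP => cXs.
  by apply: noS; exists s.
have /andP[s0 stau] := s0tau.
(* Windows shorter than [tau - s] start after [s], where the path was already above [c]. *)
exists (tau - s); first by rewrite subr_gt0.
move=> d t /andP[d0 da] W; have /andP[h1 h2] := inw d t d0 W.
case: W => /andP[t0 ta] Sc _ _ _.
have : X s w <= c by apply: ((run_sup_leP cX c t0).1 Sc); apply/andP; split => //; lra.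
by rewrite leNgt cXs.
Qed.

End passage_windows.

Section lebesgue_on_reals.
Context {R : realType}.

(* The library's Lebesgue measure lives on the type [measurableTypeR R], whose
   display differs from that of [R]. *)
Definition leb : set R -> \bar R := lebesgue_measure.

HB.instance Definition _ := isMeasure.Build _ R R leb
  (measure0 (@lebesgue_measure R)) (measure_ge0 (@lebesgue_measure R))
  (@measure_semi_sigma_additive _ _ _ (@lebesgue_measure R)).

Let leb_sigma_finite : sigma_finite setT leb.
Proof. exact: sigma_finiteT (@lebesgue_measure R). Qed.

HB.instance Definition _ := Measure_isSigmaFinite.Build _ R R leb leb_sigma_finite.

Lemma ge0_integral_leb (D : set R) (f : R -> \bar R) :
  measurable D -> measurable_fun D f -> {in D, forall x, (0 <= f x)%E} ->
  (\int[leb]_(x in D) f x = \int[lebesgue_measure]_(x in D) f x)%E.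
Proof.
have mid : measurable_fun (setT : set (measurableTypeR R)) (idfun : measurableTypeR R -> R).
  by move=> _ Y mY; rewrite setTI.
by move=> mD mf f0; exact: (ge0_integral_pushforward mid).
Qed.

End lebesgue_on_reals.

(** * Expected durations of windows and passage probabilities *)

Section windows_in_space_time.
Context {d : measure_display} {T : measurableType d} {R : realType}.
Variables (P : probability T R) (X : R -> {RV P >-> R}).
Hypothesis levyX : levy_process X.
Implicit Types (a c t z l : R) (w : T) (p : R * T).

Let X0 w : X 0 w = 0. Proof. by case: levyX. Qed.
Let X01 w : X 0 w < 1. Proof. by rewrite X0. Qed.
Let cX w : cadlag_path (fun t => X t w). Proof. by case: levyX. Qed.
Let mX t : measurable_fun setT (X t). Proof. exact: measurable_funPT. Qed.

Definition space_time : {measure set (R * T) -> \bar R} := (@leb R \x P)%E.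

Lemma space_time_fubini (A : set (R * T)) : measurable A ->
  space_time A = (\int[P]_w leb (ysection A w))%E.
Proof.
move=> mA; transitivity ((@leb R \x^ P)%E A) => //.
apply: product_measure_unique mA => A1 A2 mA1 mA2.
exact: product_measure2E.
Qed.

Definition position p : R := X (Num.max p.1 0) p.2.
Definition position_sup p : R := run_sup X (Num.max p.1 0) p.2.

Lemma measurable_position : measurable_fun setT position.
Proof. exact: (measurable_process cX mX). Qed.

Lemma measurable_position_sup : measurable_fun setT position_sup.
Proof. exact: (measurable_run_sup cX mX). Qed.

Lemma measurable_position_shift e : 0 <= e ->
  measurable_fun setT (fun p => X (Num.max p.1 0 + e) p.2).
Proof.
move=> e0; have -> : (fun p => X (Num.max p.1 0 + e) p.2) =
    position \o (fun p => (Num.max p.1 0 + e, p.2)).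
  apply/funext => p /=; rewrite /position/=; congr (X _ _).
  by rewrite [RHS]max_l// addr_ge0// le_max lexx orbT.
apply: (measurableT_comp measurable_position); apply: measurable_fun_pair => //.
apply: measurable_funD; last exact: measurable_cst.
by apply: (measurableT_comp (measurable_max0 (R := R))).
Qed.

Definition start_region a b1 b2 c : set (R * T) :=
  [set p | [/\ 0 <= p.1 <= a, position_sup p <= c & b1 < position p < b2]].

Definition window_region a b1 b2 z c L e : set (R * T) :=
  [set p | [/\ start_region a b1 b2 c p, z < X (Num.max p.1 0 + e) p.2 - position p
             & L < X (Num.max p.1 0 + e) p.2]].

Lemma window_regionE a b1 b2 z c L e t w :
  window_region a b1 b2 z c L e (t, w) <-> window X w a b1 b2 z c L e t.
Proof.
rewrite /window_region /start_region /window /position_sup /position/=; split.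
  by move=> [[/andP[t0 ta]]]; rewrite max_l// => ? ? ? ?; split => //; rewrite t0.
by move=> [/andP[t0 ta]]; rewrite max_l// => ? ? ? ?; split => //; split => //; rewrite t0.
Qed.

Lemma measurable_start_region a b1 b2 c : measurable (start_region a b1 b2 c).
Proof.
rewrite (_ : start_region a b1 b2 c = fst @^-1` `[0, a] `&`
  (position_sup @^-1` `]-oo, c] `&` position @^-1` `]b1, b2[)); last first.
  by apply/seteqP; split=> p; rewrite /start_region/= !in_itv/=; [move=> []|move=> [? []]].
apply: measurableI; first exact: measurable_preim.
apply: measurableI; apply: measurable_preim => //.
  exact: measurable_position_sup.
exact: measurable_position.
Qed.

Lemma measurable_window_region a b1 b2 z c L e : 0 <= e ->
  measurable (window_region a b1 b2 z c L e).
Proof.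
move=> e0; have ms := measurable_position_shift e0.
rewrite (_ : window_region a b1 b2 z c L e = start_region a b1 b2 c `&`
  ((fun p => X (Num.max p.1 0 + e) p.2 - position p) @^-1` `]z, +oo[ `&`
  (fun p => X (Num.max p.1 0 + e) p.2) @^-1` `]L, +oo[)); last first.
  by apply/seteqP; split=> p; rewrite /window_region/= !in_itv/= !andbT; [move=> []|move=> [? []]].
apply: measurableI; first exact: measurable_start_region.
apply: measurableI; apply: measurable_preim => //.
by apply: measurable_funB => //; exact: measurable_position.
Qed.

Definition tail e z : \bar R := P [set w | z < X e w].

Lemma measurable_gt e z : measurable [set w | z < X e w].
Proof.
rewrite (_ : [set _ | _] = X e @^-1` `]z, +oo[%classic); last first.
  by apply/seteqP; split=> w; rewrite /= in_itv/= andbT.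
exact: measurable_preim.
Qed.

Lemma tail_fin_num e z : tail e z \is a fin_num.
Proof. exact: (fin_num_measure P _ (measurable_gt e z)). Qed.

Lemma tail_ge0 e z : (0 <= tail e z)%E. Proof. exact: measure_ge0. Qed.

Lemma tail_le e z z' : z <= z' -> (tail e z' <= tail e z)%E.
Proof.
move=> zz'; apply: measure_le; [exact: measurable_gt|exact: measurable_gt|].
by move=> w /=; exact: le_lt_trans.
Qed.

Lemma measurable_tail e : measurable_fun setT (tail e).
Proof.
pose A : set (R * T) := [set p | p.1 < X e p.2].
have mA : measurable A.
  rewrite (_ : A = (fun p => X e p.2 - p.1) @^-1` `]0, +oo[%classic); last first.
    by apply/seteqP; split=> w; rewrite /A /= in_itv/= andbT subr_gt0.
  by apply: measurable_preim => //; apply: measurable_funB => //; exact: (measurableT_comp (mX e)).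
rewrite (_ : tail e = P \o xsection A); first exact: measurable_fun_xsection.
apply/funext => z; rewrite /tail/=; congr (P _).
by apply/seteqP; split=> w; rewrite /xsection /A/= inE.
Qed.

(** The probability, given the path up to time [t], that [t] starts a window: from position [x] the
    two last conditions ask the next increment to exceed [Num.max z (L - x)]. *)
Definition window_rate a b1 b2 z c L e p : \bar R :=
  ((\1_(start_region a b1 b2 c) p)%:E * tail e (Num.max z (L - position p))%R)%E.

Lemma measurable_window_rate a b1 b2 z c L e :
  measurable_fun setT (window_rate a b1 b2 z c L e).
Proof.
apply: emeasurable_funM.
  by apply/measurable_EFinP; apply: measurable_indic; exact: measurable_start_region.
apply: (measurableT_comp (measurable_tail e)).
apply: measurable_maxr; first exact: measurable_cst.
by apply: measurable_funB; [exact: measurable_cst|exact: measurable_position].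
Qed.

(** The Markov property at each fixed time, followed by Fubini over time. *)
Lemma window_region_measure a b1 b2 z c L e : 0 < e ->
  space_time (window_region a b1 b2 z c L e) =
  (\int[space_time]_p window_rate a b1 b2 z c L e p)%E.
Proof.
move=> e0; have mW := measurable_window_region a b1 b2 z c L (ltW e0).
rewrite fubini_tonelli1; last 2 first.
- exact: measurable_window_rate.
- by move=> p; rewrite mule_ge0// lee_fin.
rewrite /space_time/= /product_measure1; apply: eq_integral => t _ /=.
rewrite /fubini_F/=.
have [/andP[t0 ta]|nt] := boolP (0 <= t <= a); last first.
  rewrite (_ : xsection _ t = set0) ?measure0; last first.
    rewrite -subset0 => w; rewrite /xsection/= inE => -[[+ _ _] _ _].
    by rewrite (negbTE nt).
  rewrite integral0_eq// => w _; rewrite /window_rate indicE memNset ?mul0e//.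
  by move=> [/=]; rewrite (negbTE nt).
pose A : set ((R * R) * (R * R)) :=
  [set q | [/\ q.1.2 <= c, b1 < q.1.1 < b2, z < q.2.1 & L < q.1.1 + q.2.1]].
have m11 : measurable_fun setT (fun q : (R * R) * (R * R) => q.1.1) by exact: (measurableT_comp measurable_fst).
have m12 : measurable_fun setT (fun q : (R * R) * (R * R) => q.1.2) by exact: (measurableT_comp measurable_snd).
have m21 : measurable_fun setT (fun q : (R * R) * (R * R) => q.2.1) by exact: (measurableT_comp measurable_fst).
have mA : measurable A.
  rewrite (_ : A = (fun q => q.1.2) @^-1` `]-oo, c] `&` ((fun q => q.1.1) @^-1` `]b1, b2[ `&`
     ((fun q => q.2.1) @^-1` `]z, +oo[ `&` (fun q => q.1.1 + q.2.1) @^-1` `]L, +oo[))); last first.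
    by apply/seteqP; split=> q; rewrite /A/= !in_itv/= !andbT; [move=> []|move=> [? [? []]]].
  apply: measurableI; first exact: measurable_preim.
  apply: measurableI; first exact: measurable_preim.
  apply: measurableI; first exact: measurable_preim.
  by apply: measurable_preim => //; exact: measurable_funD.
transitivity (P [set w | A (block X 0 t w, block X t e w)]).
  congr (P _); apply/seteqP; split=> w; rewrite /xsection/= inE /window_region /start_region /A /=
    (increment_path0 levyX) /position_sup /position/= max_l// /increment_path subrKC.
    by move=> [[? ? ?] ? ?].
  by move=> [? ? ? ?]; split => //; split => //; rewrite t0.
rewrite (block_independent levyX t0 (ltW e0) mA) /= /product_measure1.
transitivity (\int[sup_law levyX t0]_q
   ((\1_[set q : R * R | q.2 <= c /\ b1 < q.1 < b2] q)%:E * tail e (Num.max z (L - q.1))%R))%E.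
  apply: eq_integral => -[x s] _ /=.
  rewrite indicE; case: (boolP (_ \in _)) => [|nq].
    rewrite inE/= => -[sc xb]; rewrite mul1e.
    transitivity (P (block X 0 e @^-1` (xsection A (x, s)))) => //; congr (P _).
    apply/seteqP; split=> w; rewrite /xsection /A/= inE/= (increment_path0 levyX) gt_max ltrBlDl.
      by move=> [_ _ -> ->].
    by move=> /andP[].
  rewrite mul0e (_ : xsection A (x, s) = set0) ?measure0//.
  rewrite -subset0 => q; rewrite /xsection /A/= inE/= => -[sc xb _ _].
  by move/negP: nq; apply; rewrite inE.
rewrite ge0_integral_plaw; last 2 first.
- apply: emeasurable_funM.
    apply/measurable_EFinP; apply: measurable_indic.
    rewrite (_ : [set _ | _] = snd @^-1` `]-oo, c] `&` fst @^-1` `]b1, b2[); last first.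
      by apply/seteqP; split=> q; rewrite /= !in_itv.
    by apply: measurableI; exact: measurable_preim.
  apply: (measurableT_comp (measurable_tail e)).
  by apply: measurable_maxr; [exact: measurable_cst|apply: measurable_funB; [exact: measurable_cst|exact: measurable_fst]].
- by move=> q; rewrite mule_ge0// lee_fin.
apply: eq_integral => w _.
have -> : block X 0 t w = (X t w, run_sup X t w) by rewrite /block (increment_path0 levyX).
rewrite /window_rate /position/= (max_l t0).
congr (_%:E * _)%E; rewrite !indicE; congr (_%:R); congr nat_of_bool.
apply/idP/idP; rewrite !inE /start_region/= /position_sup /position/= max_l//.
  by move=> [? ?]; split => //; rewrite t0.
by move=> [_ ? ?].
Qed.

Definition passage_open a b1 b2 z c : set T :=
  [set w | [/\ (passage_time X 1 w < a%:E)%E, b1 < pre_passage X 1 w < b2,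
     z < passage_jump X 1 w & pre_passage_sup X 1 w < c]].

Definition passage_closed a b1 b2 z c : set T :=
  [set w | [/\ (passage_time X 1 w <= a%:E)%E, b1 <= pre_passage X 1 w <= b2,
     z <= passage_jump X 1 w & pre_passage_sup X 1 w <= c]].

Lemma finite_passage w a : (passage_time X 1 w <= a%:E)%E ->
  exists2 tau, passage_time X 1 w = tau%:E & tau <= a.
Proof.
have := passage_time_ge0 (fun t => X t) w 1.
by case: passage_time => // r _ ra; exists r; rewrite -?lee_fin.
Qed.

Let mU : measurable_fun setT (pre_passage X 1). Proof. exact: measurable_pre_passage. Qed.
Let mD : measurable_fun setT (passage_jump X 1). Proof. exact: measurable_passage_jump. Qed.
Let mSL : measurable_fun setT (pre_passage_sup X 1). Proof. exact: measurable_pre_passage_sup. Qed.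
Let mtau : measurable_fun setT (passage_time X 1). Proof. exact: measurable_passage_time. Qed.

Lemma measurable_passage_open a b1 b2 z c : measurable (passage_open a b1 b2 z c).
Proof.
rewrite (_ : passage_open a b1 b2 z c = passage_time X 1 @^-1` `]-oo, a%:E[ `&`
  (pre_passage X 1 @^-1` `]b1, b2[ `&` (passage_jump X 1 @^-1` `]z, +oo[ `&`
   pre_passage_sup X 1 @^-1` `]-oo, c[))); last first.
  apply/seteqP; split=> w; rewrite /passage_open/= !in_itv/= !andbT; [by move=> []|by move=> [? [? []]]].
apply: measurableI; first by apply: measurable_preim => //; exact: emeasurable_itv.
apply: measurableI; first exact: measurable_preim.
by apply: measurableI; exact: measurable_preim.
Qed.

Lemma measurable_passage_closed a b1 b2 z c : measurable (passage_closed a b1 b2 z c).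
Proof.
rewrite (_ : passage_closed a b1 b2 z c = passage_time X 1 @^-1` `]-oo, a%:E] `&`
  (pre_passage X 1 @^-1` `[b1, b2] `&` (passage_jump X 1 @^-1` `[z, +oo[ `&`
   pre_passage_sup X 1 @^-1` `]-oo, c]))); last first.
  apply/seteqP; split=> w; rewrite /passage_closed/= !in_itv/= !andbT; [by move=> []|by move=> [? [? []]]].
apply: measurableI; first by apply: measurable_preim => //; exact: emeasurable_itv.
apply: measurableI; first exact: measurable_preim.
by apply: measurableI; exact: measurable_preim.
Qed.

Variable dn : nat -> R.
Hypotheses (dn0 : forall n, 0 < dn n) (dnc : dn n @[n --> \oo] --> 0).

Let dn_lt e : 0 < e -> \forall n \near \oo, 0 < dn n < e.
Proof.
move=> e0; have /cvgrPdist_lt/(_ _ e0) := dnc; apply: filterS => n.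
by rewrite sub0r normrN gtr0_norm// dn0 => ->.
Qed.

(** On the event, the duration of the windows is at least [dn n] for all large [n]; by Chebyshev's
    inequality this has probability at most [l]. *)
Lemma passage_open_le a b1 b2 z c L l : L < 1 ->
  (forall n, (space_time (window_region a b1 b2 z c L (dn n)) <= (dn n * l)%:E)%E) ->
  (P (passage_open a b1 b2 z c) <= l%:E)%E.
Proof.
move=> L1 Wl.
have mW n := measurable_window_region a b1 b2 z c L (ltW (dn0 n)).
pose f n w := leb (ysection (window_region a b1 b2 z c L (dn n)) w).
have mf n : measurable_fun setT (f n) by exact: measurable_fun_ysection.
pose E n : set T := \bigcap_(m in [set m | (n <= m)%N]) [set w | ((dn m)%:E <= f m w)%E].
have mE1 m : measurable [set w | ((dn m)%:E <= f m w)%E].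
  by have := emeasurable_fun_c_infty measurableT (mf m) (dn m)%:E; rewrite setTI.
have mE n : measurable (E n) by apply: bigcap_measurable => //; exists n => /=.
have El n : (P (E n) <= l%:E)%E.
  rewrite -(@lee_pmul2l _ (dn n)%:E) ?lte_fin// -EFinM.
  apply: le_trans (Wl n); rewrite space_time_fubini// -[leLHS]integral_cst//.
  apply: (@le_trans _ _ (\int[P]_(w in E n) f n w)%E).
    apply: ge0_le_integral => //.
    - by move=> w _; rewrite lee_fin ltW.
    - exact: measurable_funTS.
    - by move=> w /(_ n) /=; apply.
  by apply: ge0_subset_integral.
have Emono : nondecreasing_seq E.
  move=> m n mn; apply/subsetPset => w Ew k nk; apply: Ew; exact: leq_trans mn nk.
have mUE : measurable (\bigcup_n E n) by exact: bigcupT_measurable.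
have cvgE := nondecreasing_cvg_mu (mu := P) mE mUE Emono.
have UEl : (P (\bigcup_n E n) <= l%:E)%E.
  rewrite -(cvg_lim (@ereal_hausdorff R) cvgE); apply: lime_le.
    by apply/cvg_ex; exists (P (\bigcup_n E n)).
  by near=> n; exact: El.
apply: le_trans UEl; apply: measure_le => //; first exact: measurable_passage_open.
move=> w [Ta bU zD Sc].
have [tau Ttau taua] := finite_passage (ltW Ta).
have taua' : tau < a by rewrite -lte_fin -Ttau.
move: bU zD Sc; rewrite /pre_passage /passage_jump /pre_passage_sup Ttau/= => bU zD Sc.
have [eta eta0 W] := window_before_passage (cX w) (X0 w) Ttau taua' bU zD Sc L1.
have [n _ Hn] := dn_lt eta0.
exists n => // m nm /=.
have sub : `]tau - dn m, tau[ `<=` ysection (window_region a b1 b2 z c L (dn m)) w.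
  move=> t; rewrite /= in_itv/= => tt; rewrite /ysection/= inE.
  by apply/window_regionE; apply: W => //; exact: Hn.
apply: (@le_trans _ _ (leb `]tau - dn m, tau[%classic)).
  rewrite /leb lebesgue_measure_itv/= lte_fin gtrBl dn0 -EFinD lee_fin.
  by rewrite opprB addrCA subrr addr0.
apply: measure_le => //; exact: measurable_ysection.
Unshelve. all: by end_near. Qed.

(** With [L = 1] and [c <= 1] all windows start in [[tau - dn n, tau]]. Their duration is therefore
    at most [dn n], and windows exist with probability at least [l]. By [no_window], a path that has
    windows for infinitely many [n] satisfies the closed conditions. *)
Lemma passage_closed_ge a b1 b2 z c l : 0 < z -> c <= 1 ->
  (forall n, ((dn n * l)%:E <= space_time (window_region a b1 b2 z c 1%R (dn n)))%E) ->
  (l%:E <= P (passage_closed a b1 b2 z c))%E.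
Proof.
move=> z0 c1 Wl.
have mW n := measurable_window_region a b1 b2 z c 1 (ltW (dn0 n)).
pose f n w := leb (ysection (window_region a b1 b2 z c 1%R (dn n)) w).
have mf n : measurable_fun setT (f n) by exact: measurable_fun_ysection.
pose G n : set T := [set w | (0 < f n w)%E].
have mG n : measurable (G n).
  by have := emeasurable_fun_o_infty measurableT (mf n) 0%E; rewrite setTI.
have fle n w : (f n w <= (dn n)%:E)%E.
  have [e0|nonempty] := eqVneq (ysection (window_region a b1 b2 z c 1%R (dn n)) w) set0.
    by rewrite /f e0 measure0 lee_fin ltW.
  have inw t : ysection (window_region a b1 b2 z c 1%R (dn n)) w t -> exists2 tau,
      passage_time X 1 w = tau%:E & t <= tau <= t + dn n.
    rewrite /ysection/= inE => /window_regionE [/andP[t0 _] Sc _ _ X1].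
    exact: (window_passage (cX w) t0 (dn0 n) (le_trans Sc c1) X1).
  move/set0P : nonempty => [t0 /inw[tau Ttau _]].
  apply: (@le_trans _ _ (leb `[tau - dn n, tau]%classic)).
    apply: measure_le => //; first exact: measurable_ysection.
    move=> t /inw[tau']; rewrite Ttau => -[<-] /andP[h1 h2].
    by rewrite /= in_itv/= h1 andbT lerBlDr.
  rewrite /leb lebesgue_measure_itv/= lte_fin gtrBl dn0 -EFinD lee_fin.
  by rewrite opprB addrCA subrr addr0.
have lG n : (l%:E <= P (G n))%E.
  rewrite -(@lee_pmul2l _ (dn n)%:E) ?lte_fin// -EFinM.
  apply: (le_trans (Wl n)); rewrite space_time_fubini// -integral_cst//.
  rewrite [leRHS]integral_mkcond/=.
  apply: ge0_le_integral => //.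
  - exact: mf.
  - by apply/(measurable_restrictT _ (mG n)).1; exact: measurable_cst.
  move=> w _; rewrite /patch; case: ifPn => [_|]; first exact: fle.
  by rewrite notin_setE /G /= => /negP; rewrite -leNgt.
pose F n := \bigcup_(m in [set m | (n <= m)%N]) G m.
have mF n : measurable (F n) by exact: bigcup_measurable.
have lF n : (l%:E <= P (F n))%E.
  by apply: (le_trans (lG n)); apply: measure_le => // w Gw; exists n => /=.
have cvgF : P (F n) @[n --> \oo] --> P (\bigcap_n F n).
  apply: nonincreasing_cvg_mu => //.
  - by rewrite ltey_eq fin_num_measure.
  - exact: bigcapT_measurable.
  - move=> m n mn; apply/subsetPset => w [k nk Gk]; exists k => //; exact: leq_trans mn nk.
have lIF : (l%:E <= P (\bigcap_n F n))%E.
  rewrite -(cvg_lim (@ereal_hausdorff R) cvgF); apply: lime_ge.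
    by apply/cvg_ex; exists (P (\bigcap_n F n)).
  by near=> n; exact: lF.
apply: (le_trans lIF); apply: measure_le; first exact: bigcapT_measurable.
  exact: measurable_passage_closed.
move=> w Fw; apply: contrapT => nC.
have [eta eta0 W] : exists2 eta, 0 < eta & forall e t, 0 < e < eta -> ~ window X w a b1 b2 z c 1 e t.
  apply: no_window => //; apply: contra_not nC => -[tau [Ttau taua bU zD Sc]].
  by rewrite /passage_closed /pre_passage /passage_jump /pre_passage_sup /= Ttau.
have [n _ Hn] := dn_lt eta0.
have [m nm] := Fw n Logic.I.
rewrite /G /f/= (_ : ysection _ w = set0) ?measure0 ?ltxx//.
rewrite -subset0 => t; rewrite /ysection/= inE => /window_regionE.
by apply: W; exact: Hn.
Unshelve. all: by end_near. Qed.

End windows_in_space_time.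

(** * Small-time asymptotics of the tails *)

Section tail_asymptotics.
Context {d : measure_display} {T : measurableType d} {R : realType}.
Variables (P : probability T R) (alpha : R) (X : R -> {RV P >-> R}) (h : R -> R -> R -> R).
Hypothesis alpha12 : 1 < alpha < 2.
Hypothesis stableX : stable_process alpha X.
Hypothesis laplaceX : forall t q : R, 0 < t -> 0 <= q ->
  ('E_P[fun w => expR (- q * X t w)] = (expR (t * q `^ alpha))%:E)%E.
Hypothesis hX : is_killed_density X h.
Implicit Types (a s t u c z : R) (w : T) (B : set R).

Let levyX : levy_process X. Proof. by case: stableX. Qed.
Let X0 w : X 0 w = 0. Proof. by case: levyX. Qed.
Let cX w : cadlag_path (fun t => X t w). Proof. by case: levyX. Qed.
Let alpha0 : 0 < alpha. Proof. by case/andP: alpha12 => /(lt_trans _)->. Qed.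

Lemma tail_scaling e z (r : R) : 0 < r -> 0 <= e -> tail X (r `^ alpha * e) (r * z) = tail X e z.
Proof.
move=> r0 e0; have ra0 : 0 < r `^ alpha by exact: powR_gt0.
have m : measurable `]r * z, +oo[%classic by exact: measurable_itv.
have := strict_scaling alpha12 stableX laplaceX ra0 (n := 1) (t := fun=> e)
  (B := fun=> `]r * z, +oo[%classic) (fun=> e0) (fun=> m).
have rK : (r `^ alpha) `^ alpha^-1 = r.
  by rewrite -powRrM mulfV ?lt0r_neq0// powRr1// ltW.
rewrite rK => E; rewrite /tail.
transitivity (P [set w | 'I_1 -> `]r * z, +oo[%classic (X (r `^ alpha * e) w)]).
  congr (P _); apply/seteqP; split=> w /=; first by rewrite in_itv/= andbT.
  by move=> /(_ ord0); rewrite in_itv/= andbT.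
rewrite E; congr (P _); apply/seteqP; split=> w /=.
  by move=> /(_ ord0); rewrite in_itv/= andbT ltr_pM2l.
by move=> zX _; rewrite in_itv/= andbT ltr_pM2l.
Qed.

(** At positive times the position has no atom. The level 0 is excluded because [position] is 0 at
    all negative times, which have infinite measure. *)
Lemma space_time_level v : v != 0 -> space_time P [set p | position X p = v] = 0%E.
Proof.
move=> v0.
have mA : measurable [set p : R * T | position X p = v].
  rewrite (_ : [set p | _] = position X @^-1` [set v])//.
  by apply: measurable_preim => //; exact: measurable_position.
rewrite /space_time/= /product_measure1 integral0_eq// => t _ /=.
have [t0|t0] := ltP 0 t.
  rewrite -(process_no_atom stableX hX v t0); congr (P _).
  by apply/seteqP; split=> w; rewrite /xsection/= inE /position/= max_l ?ltW.
rewrite (_ : xsection _ _ = set0) ?measure0// -subset0 => w.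
rewrite /xsection/= inE /position/= max_r// X0 => v0'.
by move/eqP: v0; apply.
Qed.

Lemma region_le a b1 b2 c : 0 <= a -> (space_time P (start_region X a b1 b2 c) <= a%:E)%E.
Proof.
move=> a0; apply: (@le_trans _ _ (space_time P (`[0, a]%classic `*` setT))).
  apply: measure_le; [exact: measurable_start_region|exact: measurableX|].
  by move=> [t w] [/= ta _ _]; split => //=; rewrite in_itv.
have -> : space_time P (`[0, a]%classic `*` setT) = (leb `[0%R, a]%classic * P setT)%E by exact: product_measure1E.
rewrite probability_setT mule1 /leb lebesgue_measure_itv/= lte_fin; case: ifP => // _.
by rewrite -EFinD subr0.
Qed.

Lemma region_fin_num a b1 b2 c : 0 <= a ->
  space_time P (start_region X a b1 b2 c) \is a fin_num.
Proof.
move=> a0; rewrite ge0_fin_numE//; exact: le_lt_trans (region_le _ _ _ a0) (ltry _).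
Qed.

(** By right continuity every path stays close to 0 for a positive time. *)
Lemma region_pos : (0 < space_time P (start_region X 1 (-1) (1 / 2) (1 / 2))%R)%E.
Proof.
rewrite lt0e measure_ge0 andbT; apply/eqP => Q0.
set Q := start_region _ _ _ _ _ in Q0.
have mQ : measurable Q by exact: measurable_start_region.
have mf : measurable_fun setT (fun w => leb (ysection Q w)) by exact: measurable_fun_ysection.
have /(ae_eq_integral_abs P measurableT mf).1 : (\int[P]_(w in setT) `|leb (ysection Q w)| = 0)%E.
  by rewrite -Q0 space_time_fubini//; apply: eq_integral => w _; rewrite gee0_abs.
move=> [N [mN N0 subN]].
have NT : N = setT.
  rewrite -subTset => w _; apply: subN => /=; apply/not_implyP; split => //.
  have q4 : 0 < 1 / 4 :> R by rewrite divr_gt0.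
  have [eta eta0 Xe] := cadlag_right (cX w) (lexx 0) q4.
  pose m := Num.min 1 (eta / 2).
  have m0 : 0 < m by rewrite lt_min ltr01 divr_gt0.
  have m1 : m <= 1 by rewrite ge_min lexx.
  have me : m <= eta / 2 by rewrite ge_min lexx orbT.
  have Xs s : 0 <= s <= m -> `|X s w| < 1 / 4.
    move=> /andP[s0 sm]; have := Xe s s0; rewrite X0 subr0; apply; lra.
  have sub : `[0, m]%classic `<=` ysection Q w.
    move=> t; rewrite /= in_itv/= /ysection/= inE => /andP[t0 tm].
    have := Xs t; rewrite t0 tm => /(_ erefl); rewrite ltr_norml => /andP[h1 h2].
    rewrite /Q /start_region /position_sup /position/= (max_l t0); split.
    - by rewrite t0 (le_trans tm).
    - apply/(run_sup_leP (cX w)) => // s /andP[s0 st].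
      have := Xs s; rewrite s0 (le_trans st)// => /(_ erefl); rewrite ltr_norml => /andP[? ?]; lra.
    - apply/andP; split; lra.
  have : (m%:E <= leb (ysection Q w))%E.
    apply: (@le_trans _ _ (leb `[0, m]%classic)).
      by rewrite /leb lebesgue_measure_itv/= lte_fin m0 -EFinD subr0.
    by apply: measure_le => //; exact: measurable_ysection.
  by move=> + E; rewrite E lee_fin leNgt m0.
have PT : P setT = 0%E by rewrite -NT.
by move: PT; rewrite probability_setT => /eqP; rewrite onee_eq0.
Qed.

(* From a position above -2 a jump larger than 3 crosses level 1, so that the
   condition on [L] is void. *)
Lemma window_measure_high a b1 b2 z c L e : 0 < e -> -2 <= b1 -> 3 <= z -> L <= 1 ->
  space_time P (window_region X a b1 b2 z c L e) =
  (space_time P (start_region X a b1 b2 c) * tail X e z)%E.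
Proof.
move=> e0 b12 z3 L1; rewrite window_region_measure//.
have mQ := measurable_start_region levyX a b1 b2 c.
transitivity (\int[space_time P]_p (tail X e z * (\1_(start_region X a b1 b2 c) p)%:E))%E.
  apply: eq_integral => p _; rewrite /window_rate muleC indicE.
  case: (boolP (p \in _)) => [|_]; last by rewrite !mule0.
  rewrite inE => -[_ _ /andP[bp _]].
  by rewrite max_l//; lra.
rewrite ge0_integralZl//; last first.
  by apply/measurable_EFinP; exact: measurable_indic.
by rewrite integral_indic// setIT muleC.
Qed.

Definition tail_rate e : R := fine (tail X e 3) / e.

Lemma tail_rateE e : 0 < e -> tail X e 3 = (e * tail_rate e)%:E.
Proof.
by move=> e0; rewrite /tail_rate mulrCA divff ?lt0r_neq0// mulr1 fineK// tail_fin_num.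
Qed.

Lemma tail_rate_ge0 e : 0 < e -> 0 <= tail_rate e.
Proof. by move=> e0; rewrite divr_ge0 ?fine_ge0// ltW. Qed.

Let Q1 := start_region X 1 (-1) (1 / 2) (1 / 2).
Let kappa : R := fine (space_time P Q1).

Let kappaE : space_time P Q1 = kappa%:E.
Proof. by rewrite fineK// region_fin_num. Qed.

Let kappa0 : 0 < kappa.
Proof. by rewrite -lte_fin -kappaE; exact: region_pos. Qed.

(** Lets the enlarged regions needed for open conditions shrink back to [Q1]: the boundary positions
    [-1] and [1 / 2] are not charged. *)
Lemma region_cvg : space_time P (start_region X (1 + n.+1%:R^-1) (- 1 - n.+1%:R^-1)
    (1 / 2 + n.+1%:R^-1) (1 / 2 + n.+1%:R^-1)) @[n --> \oo] --> kappa%:E.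
Proof.
pose Q (n : nat) := start_region X (1 + n.+1%:R^-1) (- 1 - n.+1%:R^-1)
    (1 / 2 + n.+1%:R^-1) (1 / 2 + n.+1%:R^-1).
rewrite -[X in X @ _ --> _]/(fun n => space_time P (Q n)).
have mQ n : measurable (Q n) by exact: measurable_start_region.
pose v1 : set (R * T) := [set p | position X p = - 1].
pose v2 : set (R * T) := [set p | position X p = 1 / 2].
have mlev v : measurable [set p : R * T | position X p = v].
  rewrite (_ : [set p | _] = position X @^-1` [set v])//.
  by apply: measurable_preim => //; exact: measurable_position.
have mQ1 : measurable Q1 by exact: measurable_start_region.
have i0 n : 0 < n.+1%:R^-1 :> R by rewrite invr_gt0.
have -> : kappa%:E = space_time P (\bigcap_n Q n).
  apply/eqP; rewrite -kappaE eq_le; apply/andP; split.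
    apply: measure_le => //; first exact: bigcapT_measurable.
    move=> p [/andP[t0 t1] Sc /andP[x1 x2]] n _; have := i0 n; split.
    - by rewrite t0 (le_trans t1)// lerDl ltW.
    - by rewrite (le_trans Sc)// lerDl ltW.
    - by rewrite (lt_trans _ x1) ?(lt_trans x2)//= ?ltrDl// gtrBl.
  apply: (@le_trans _ _ (space_time P (Q1 `|` (v1 `|` v2)))).
    apply: measure_le; first exact: bigcapT_measurable.
      by apply: measurableU => //; apply: measurableU; exact: mlev.
    move=> p Qp.
    have near_le (x y : R) : (forall n, x <= y + n.+1%:R^-1) -> x <= y.
      move=> xy; apply/ler_addgt0Pr => e e0; have [n _ /(_ n (leqnn n))/= ne] := near_inv_lt e0.
      by apply: le_trans (xy n) _; rewrite lerD2l ltW.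
    have t0 : 0 <= p.1 by have [/andP[]] := Qp 0%N I.
    have t1 : p.1 <= 1 by apply: near_le => n; have [/andP[]] := Qp n I.
    have Sc : position_sup X p <= 1 / 2 by apply: near_le => n; have [] := Qp n I.
    have x2 : position X p <= 1 / 2 by apply: near_le => n; have [_ _ /andP[_ /ltW]] := Qp n I.
    have x1 : - position X p <= 1 by apply: near_le => n; have [_ _ /andP[/ltW + _]] := Qp n I; rewrite lerNl opprD.
    have [e1|n1] := eqVneq (position X p) (- 1); first by right; left.
    have [e2|n2] := eqVneq (position X p) (1 / 2); first by right; right.
    left; split => //; first by rewrite t0.
    by rewrite !lt_neqAle n2 x2 eq_sym n1/= andbT lerNl.
  apply: measureU_le => //; first by apply: measurableU; exact: mlev.
  apply: measureU_null; [exact: mlev|exact: mlev| |]; apply: space_time_level.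
  - by rewrite oppr_eq0 oner_eq0.
  - by rewrite mulf_neq0// invr_neq0.
apply: nonincreasing_cvg_mu => //.
- by apply: (le_lt_trans (region_le _ _ _ _) (ltry _)); rewrite addr_ge0.
- exact: bigcapT_measurable.
- move=> m n mn; apply/subsetPset => p [/andP[t0 t1] Sc /andP[x1 x2]].
  have : n.+1%:R^-1 <= m.+1%:R^-1 :> R by rewrite lef_pV2 ?posrE// ler_nat ltnS.
  move=> mn'; split.
  - by rewrite t0/= (le_trans t1)// lerD2l.
  - by rewrite (le_trans Sc)// lerD2l.
  - by rewrite (lt_le_trans x2) ?lerD2l// andbT (le_lt_trans _ x1)// lerD2l lerN2.
Qed.

(* A jump larger than [3 r] satisfies the closed conditions along the rescaled
   sequence [e] and the open ones along [e']; then [r] tends to 1. *)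
Lemma tail_rate_compare (e e' : nat -> R) (p p' : R) :
  (forall n, 0 < e n) -> (forall n, 0 < e' n) ->
  e n @[n --> \oo] --> 0 -> e' n @[n --> \oo] --> 0 ->
  (forall n, p' <= tail_rate (e n)) -> (forall n, tail_rate (e' n) <= p) -> p' <= p.
Proof.
move=> e0 e'0 ec e'c ep' e'p.
have p0 : 0 <= p by apply: le_trans (tail_rate_ge0 (e'0 0%N)) (e'p 0%N).
suff H r : 1 < r -> r `^ (- alpha) * p' <= p.
  apply/ler_addgt0Pr => dl dl0; have [p'0|p'0] := leP p' 0.
    by rewrite (le_trans p'0)// addr_ge0// ltW.
  (* With this value of [r] the bound becomes [p' <= p (1 + dl / (p + 1)) <= p + dl]; the
     denominator [p + 1] allows for [p = 0]. *)
  have : 1 < (1 + dl / (p + 1)) `^ alpha^-1.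
    have -> : 1 = 1 `^ alpha^-1 :> R by rewrite powR1.
    apply: gt0_ltr_powR; rewrite ?invr_gt0// ?nnegrE ?powR1//.
      by rewrite addr_ge0// divr_ge0 ?addr_ge0// ltW.
    by rewrite ltrDl divr_gt0// ltr_wpDl.
  move=> /H; rewrite powRN -powRrM mulVf ?lt0r_neq0// powRr1; last first.
    by rewrite addr_ge0// divr_ge0 ?addr_ge0// ltW.
  have q0 : 0 < 1 + dl / (p + 1) by rewrite addr_gt0// divr_gt0// ltr_wpDl.
  rewrite mulrC ler_pdivrMr// => /le_trans; apply.
  have p1 : p / (p + 1) <= 1 by rewrite ler_pdivrMr ?ltr_wpDl// mul1r lerDl.
  by rewrite mulrDr mulr1 lerD2l mulrCA ler_piMr// ltW.
move=> r1; have r0 : 0 < r by exact: lt_trans r1.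
have ra : r `^ (- alpha) = (r `^ alpha)^-1 by rewrite powRN.
have ra0 : 0 < r `^ alpha by exact: powR_gt0.
(* At time [r^alpha e] the tail beyond [3 r] is the tail beyond 3 at time [e]; dividing by the
   longer time costs the factor [r^(- alpha)]. *)
pose dn n := r `^ alpha * e n.
have dn0 n : 0 < dn n by rewrite mulr_gt0.
have dnc : dn n @[n --> \oo] --> 0.
  by rewrite -(mulr0 (r `^ alpha)); apply: cvgMr.
have z3 : 3 <= r * 3 by rewrite ler_peMl// ltW.
have upper : ((kappa * (r `^ (- alpha) * p'))%:E <= P (passage_closed X 1 (-1) (1 / 2) (r * 3) (1 / 2))%R)%E.
  apply: (@passage_closed_ge _ _ _ _ _ levyX dn) => //; [by rewrite mulr_gt0|by lra|].
  move=> n; rewrite window_measure_high//; last by lra.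
  have -> : space_time P (start_region X 1 (-1) (1 / 2) (1 / 2))%R = kappa%:E by exact: kappaE.
  have -> : tail X (dn n) (r * 3) = (e n * tail_rate (e n))%:E.
    by rewrite /dn tail_scaling// ?ltW// tail_rateE.
  rewrite -EFinM lee_fin mulrCA ler_pM2l// /dn ra.
  by rewrite mulrACA divff ?lt0r_neq0// mul1r ler_pM2l.
pose Q n := space_time P (start_region X (1 + n.+1%:R^-1) (- 1 - n.+1%:R^-1)
    (1 / 2 + n.+1%:R^-1) (1 / 2 + n.+1%:R^-1)).
have lower n : ((kappa * (r `^ (- alpha) * p'))%:E <= Q n * p%:E)%E.
  have i0 : 0 < n.+1%:R^-1 :> R by rewrite invr_gt0.
  have i1 : n.+1%:R^-1 <= 1 :> R by rewrite invf_le1// ler1n.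
  have Qfin : Q n \is a fin_num by apply: region_fin_num; rewrite addr_ge0// ltW.
  have Q0 : (0 <= Q n)%E by exact: measure_ge0.
  apply: (le_trans upper).
  rewrite -(fineK Qfin) -EFinM.
  apply: (@le_trans _ _ (P (passage_open X (1 + n.+1%:R^-1) (- 1 - n.+1%:R^-1)
    (1 / 2 + n.+1%:R^-1) 3 (1 / 2 + n.+1%:R^-1)))).
    apply: measure_le; [exact: measurable_passage_closed|exact: measurable_passage_open|].
    move=> w [T1 /andP[U1 U2] D3 S2]; split.
    - by apply: (le_lt_trans T1); rewrite lte_fin ltrDl.
    - by rewrite (lt_le_trans _ U1) ?gtrBl//= (le_lt_trans U2)// ltrDl.
    - by apply: lt_le_trans D3; rewrite ltr_pMl.
    - by rewrite (le_lt_trans S2)// ltrDl.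
  apply: (@passage_open_le _ _ _ _ _ levyX e' _ _ _ _ _ _ _ 0) => // m.
  rewrite window_measure_high//; last first.
    by have h2 (k : R) : k <= 1 -> -2 <= - 1 - k; [lra|exact: h2].
  rewrite [X in (X * _)%E](_ : _ = (fine (Q n))%:E); last by rewrite fineK.
  rewrite tail_rateE// -EFinM lee_fin mulrCA ler_pM2l//.
  by rewrite ler_wpM2l// fine_ge0.
have cvgQ : (Q n * p%:E)%E @[n --> \oo] --> (kappa%:E * p%:E)%E.
  by apply: cvgeMr => //; exact: region_cvg.
have : ((kappa * (r `^ (- alpha) * p'))%:E <= kappa%:E * p%:E)%E.
  rewrite -(cvg_lim (@ereal_hausdorff R) cvgQ); apply: lime_ge.
    by apply/cvg_ex; exists (kappa%:E * p%:E)%E.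
  by near=> n; exact: lower.
by rewrite -EFinM lee_fin ler_pM2l.
Unshelve. all: by end_near. Qed.

(** The rate times [kappa] is bounded by a passage probability, so that it cannot blow up at small
    times. *)
Lemma tail_rate_bounded (e : nat -> R) p : (forall n, 0 < e n) -> e n @[n --> \oo] --> 0 ->
  (forall n, p <= tail_rate (e n)) -> kappa * p <= 1.
Proof.
move=> e0 ec ep.
have : ((kappa * p)%:E <= P (passage_closed X 1 (-1) (1 / 2) 3 (1 / 2))%R)%E.
  apply: (@passage_closed_ge _ _ _ _ _ levyX e) => //; first by lra.
  move=> n; rewrite window_measure_high//; last by lra.
  have -> : space_time P (start_region X 1 (-1) (1 / 2) (1 / 2))%R = kappa%:E by exact: kappaE.
  by rewrite tail_rateE// -EFinM lee_fin mulrCA ler_pM2l// ler_pM2l.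
by rewrite -lee_fin => /le_trans; apply; apply: probability_le1; exact: measurable_passage_closed.
Qed.

Lemma not_near0_seq (Q : R -> Prop) :
  ~ (exists2 eta, 0 < eta & forall e, 0 < e < eta -> Q e) ->
  exists e : nat -> R, [/\ forall n, 0 < e n, e n @[n --> \oo] --> 0 & forall n, ~ Q (e n)].
Proof.
move=> nQ.
have ex n : exists e, 0 < e < n.+1%:R^-1 /\ ~ Q e.
  apply: contrapT => ne; apply: nQ; exists n.+1%:R^-1; first by rewrite invr_gt0.
  by move=> e e0; apply: contrapT => nQe; apply: ne; exists e.
have [e He] := choice ex.
exists e; split.
- by move=> n; have [/andP[]] := He n.
- apply/cvgrPdist_lt => eps eps0; have := near_inv_lt eps0; apply: filterS => n neps.
  have [/andP[h1 h2] _] := He n.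
  by rewrite sub0r normrN gtr0_norm// (lt_trans h2).
- by move=> n; have [] := He n.
Qed.

(** The limit is the infimum of the eventual upper bounds, that is, the upper limit at 0. By
    [tail_rate_compare] no sequence of times tending to 0 stays below it by a margin. *)
Lemma tail_rate_cvg : exists2 C : R, 0 <= C & forall e : nat -> R,
  (forall n, 0 < e n) -> e n @[n --> \oo] --> 0 -> tail_rate (e n) @[n --> \oo] --> C.
Proof.
pose B := [set p | exists2 eta, 0 < eta & forall e, 0 < e < eta -> tail_rate e <= p].
have B0 : B !=set0.
  exists (kappa^-1 + 1); apply: contrapT => nB.
  have [e [e0 ec eB]] := not_near0_seq nB.
  have := @tail_rate_bounded e (kappa^-1 + 1) e0 ec.
  have ge n : kappa^-1 + 1 <= tail_rate (e n) by rewrite leNgt; apply/negP => /ltW; exact: eB.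
  by move=> /(_ ge); rewrite mulrDr divff ?lt0r_neq0// mulr1 gerDl leNgt kappa0.
have lbB : lbound B 0.
  move=> p [eta eta0 Hp]; have e2 : 0 < eta / 2 by rewrite divr_gt0.
  apply: le_trans (tail_rate_ge0 e2) (Hp _ _).
  by rewrite e2 ltr_pdivrMr// ltr_pMr// ltr1n.
have hasB : has_inf B by split => //; exists 0.
exists (inf B); first exact: lb_le_inf.
move=> e e0 ec; apply/cvgrPdist_lt => eps eps0.
have near_e eta : 0 < eta -> \forall n \near \oo, 0 < e n < eta.
  move=> eta0; have /cvgrPdist_lt/(_ _ eta0) := ec; apply: filterS => n.
  by rewrite sub0r normrN gtr0_norm// e0 => ->.
have [p [eta1 eta10 Hp] pB] := inf_adherent eps0 hasB.
have [eta2 eta20 He] : exists2 eta, 0 < eta & forall e, 0 < e < eta -> inf B - eps < tail_rate e.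
  apply: contrapT => /not_near0_seq [e' [e'0 e'c He']].
  (* Since this is no eventual upper bound, some sequence of times keeps the rate above it, to be
     compared with [e']. *)
  have nB : ~ B (inf B - eps / 2).
    move=> /(inf_lbound (ex_intro _ 0 lbB)); rewrite lerBrDr gerDl leNgt.
    by rewrite divr_gt0.
  have [e2 [e20 e2c He2]] := not_near0_seq nB.
  have := @tail_rate_compare e2 e' (inf B - eps) (inf B - eps / 2) e20 e'0 e2c e'c.
  have h1 n : inf B - eps / 2 <= tail_rate (e2 n) by rewrite leNgt; apply/negP => /ltW; exact: He2.
  have h2 n : tail_rate (e' n) <= inf B - eps by rewrite leNgt; apply/negP; exact: He'.
  move=> /(_ h1 h2); lra.
have := near_e (Num.min eta1 eta2); rewrite lt_min eta10 eta20 => /(_ erefl).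
apply: filterS => n; rewrite lt_min => /and3P[en0 en1 en2].
have := Hp (e n); rewrite en0 en1 => /(_ erefl) l1.
have := He (e n); rewrite en0 en2 => /(_ erefl) l2.
rewrite ltr_norml; apply/andP; split; lra.
Qed.

End tail_asymptotics.

(** * Compensation *)

Lemma powR_seq_cvg {R : realType} (r y : R) (u : nat -> R) : 0 < y ->
  u n @[n --> \oo] --> y -> u n `^ r @[n --> \oo] --> y `^ r.
Proof.
move=> y0 uy; have : derivable (fun x => x `^ r) y 1.
  by have [] := is_derive1_powR r y0.
move=> /derivable1_diffP/differentiable_continuous yc.
exact: (continuous_cvg _ yc uy).
Qed.

Lemma inv_succ_cvg {R : realType} : (n.+1%:R^-1 : R) @[n --> \oo] --> 0.
Proof. exact: cvg_harmonic. Qed.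

Section passage_events.
Context {d : measure_display} {T : measurableType d} {R : realType}.
Variables (P : probability T R) (X : R -> {RV P >-> R}).

(** Closed in time and supremum, open in position and jump. The closed conditions are limits of
    wider open ones, the open conditions limits of narrower closed ones, so that the upper and lower
    bounds meet without any boundary being shown null. *)
Definition passage_half (a b1 b2 z c : R) : set T :=
  [set w | [/\ (passage_time X 1 w <= a%:E)%E, b1 < pre_passage X 1 w < b2,
     z < passage_jump X 1 w & pre_passage_sup X 1 w <= c]].

Hypothesis levyX : levy_process X.

Let X0 w : X 0 w = 0. Proof. by case: levyX. Qed.
Let X01 w : X 0 w < 1. Proof. by rewrite X0. Qed.
Let cX w : cadlag_path (fun t => X t w). Proof. by case: levyX. Qed.
Lemma measurable_pre_passage1 : measurable_fun setT (pre_passage X 1).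
Proof. exact: measurable_pre_passage. Qed.
Lemma measurable_passage_jump1 : measurable_fun setT (passage_jump X 1).
Proof. exact: measurable_passage_jump. Qed.
Lemma measurable_pre_passage_sup1 : measurable_fun setT (pre_passage_sup X 1).
Proof. exact: measurable_pre_passage_sup. Qed.
Lemma measurable_passage_time1 : measurable_fun setT (passage_time X 1).
Proof. exact: measurable_passage_time. Qed.

Lemma measurable_passage_half a b1 b2 z c : measurable (passage_half a b1 b2 z c).
Proof.
rewrite (_ : passage_half a b1 b2 z c = passage_time X 1 @^-1` `]-oo, a%:E] `&`
  (pre_passage X 1 @^-1` `]b1, b2[ `&` (passage_jump X 1 @^-1` `]z, +oo[ `&`
   pre_passage_sup X 1 @^-1` `]-oo, c]))); last first.
  by apply/seteqP; split=> w; rewrite /passage_half/= !in_itv/= !andbT; [move=> []|move=> [? [? []]]].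
apply: measurableI.
  by apply: measurable_preim; [exact: measurable_passage_time1|exact: emeasurable_itv].
apply: measurableI; first by apply: measurable_preim => //; exact: measurable_pre_passage1.
apply: measurableI; apply: measurable_preim => //.
  exact: measurable_passage_jump1.
exact: measurable_pre_passage_sup1.
Qed.

End passage_events.

Section compensation.
Context {d : measure_display} {T : measurableType d} {R : realType}.
Variables (P : probability T R) (alpha : R) (X : R -> {RV P >-> R}) (h : R -> R -> R -> R).
Hypothesis alpha12 : 1 < alpha < 2.
Hypothesis stableX : stable_process alpha X.
Hypothesis laplaceX : forall t q : R, 0 < t -> 0 <= q ->
  ('E_P[fun w => expR (- q * X t w)] = (expR (t * q `^ alpha))%:E)%E.
Hypothesis hX : is_killed_density X h.
Implicit Types (a s t u c z : R) (w : T) (B : set R) (p : R * T).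

Let levyX : levy_process X. Proof. by case: stableX. Qed.
Let alpha0 : 0 < alpha. Proof. by case/andP: alpha12 => /(lt_trans _)->. Qed.

Local Notation M := (space_time P).
Local Notation pos := (position X).
Local Notation Q := (start_region X).

(** Dominated convergence over [[0, A]] times the sample space, where [space_time] is finite. The
    regions may vary as long as the membership of each point stabilises. *)
Lemma region_dct (Qn : nat -> set (R * T)) (Q0 : set (R * T)) (un : nat -> R * T -> R)
    (u : R * T -> R) (A K : R) :
  0 <= A -> 0 <= K -> (forall n, measurable (Qn n)) -> measurable Q0 ->
  (forall n p, Qn n p -> 0 <= p.1 <= A) ->
  (forall n, measurable_fun setT (un n)) -> measurable_fun setT u ->
  (forall n p, 0 <= un n p <= K) ->
  (forall p, \forall n \near \oo, (Qn n p <-> Q0 p)) ->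
  (forall p, un n p @[n --> \oo] --> u p) ->
  (\int[M]_p (\1_(Qn n) p * un n p)%:E)%E @[n --> \oo] --> (\int[M]_p (\1_Q0 p * u p)%:E)%E.
Proof.
move=> A0 K0 mQn mQ QnA mun mu unK cQ cu.
pose S : set (R * T) := `[0, A]%classic `*` setT.
have mS : measurable S by exact: measurableX.
have MS : M S = A%:E.
  transitivity (leb `[0%R, A]%classic * P setT)%E; first exact: product_measure1E.
  rewrite probability_setT mule1 /leb lebesgue_measure_itv/= lte_fin.
  case: ltgtP A0 => // [A0 _|<- _]; by rewrite -?EFinD ?subr0.
pose f_ n p := (\1_(Qn n) p * un n p)%:E; pose f p := (\1_Q0 p * u p)%:E.
pose g p := (K * \1_S p)%:E.
have mf_ n : measurable_fun setT (f_ n).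
  by apply/measurable_EFinP; apply: measurable_funM => //; exact: measurable_indic.
have mf : measurable_fun setT f.
  by apply/measurable_EFinP; apply: measurable_funM => //; exact: measurable_indic.
have cf : {ae M, forall p, setT p -> f_ n p @[n --> \oo] --> f p}.
  apply: aeW => p _; apply: cvg_EFin; first by near=> n.
  have ev : \forall n \near \oo, \1_Q0 p * un n p = \1_(Qn n) p * un n p.
    have := cQ p; apply: filterS => n [h1 h2]; rewrite !indicE.
    by congr (_%:R * _); congr nat_of_bool; apply/idP/idP; rewrite !inE.
  apply: (cvg_trans (near_eq_cvg ev)); exact: cvgMr.
have ig : M.-integrable setT g.
  apply/integrableP; split.
    by apply/measurable_EFinP; apply: measurable_funM => //; exact: measurable_indic.
  under eq_integral => p _.
    rewrite gee0_abs; last by rewrite lee_fin mulr_ge0.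
    rewrite /g EFinM; over.
  rewrite ge0_integralZl//; last by apply/measurable_EFinP; exact: measurable_indic.
  rewrite integral_indic// setIT; rewrite [X in (_ * X)%E](_ : _ = A%:E)//.
  by rewrite -EFinM ltry.
have dom : {ae M, forall p n, setT p -> (`|f_ n p| <= g p)%E}.
  apply: aeW => p n _ /=; rewrite /f_ /g lee_fin.
  have /andP[un0 unK'] := unK n p.
  rewrite ger0_norm ?mulr_ge0// indicE; case: (boolP (p \in Qn n)) => [|_]; last by rewrite mul0r mulr_ge0.
  rewrite inE => Qp; rewrite mul1r indicE mem_set ?mulr1//.
  by split => //=; rewrite in_itv/=; exact: QnA Qp.
by have [_ _] := dominated_convergence measurableT mf_ mf cf ig dom.
Unshelve. all: by end_near. Qed.

Variable C : R.
Hypothesis C0 : 0 <= C.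
Hypothesis C_rate : forall e : nat -> R,
  (forall n, 0 < e n) -> e n @[n --> \oo] --> 0 -> tail_rate X (e n) @[n --> \oo] --> C.

Let C3 := C * 3 `^ alpha.

Let C30 : 0 <= C3. Proof. by rewrite mulr_ge0// powR_ge0. Qed.

Definition rate n z : R := fine (tail X n.+1%:R^-1 z) * n.+1%:R.

Let i0 n : 0 < n.+1%:R^-1 :> R. Proof. by rewrite invr_gt0. Qed.

Lemma rate_ge0 n z : 0 <= rate n z.
Proof. by rewrite mulr_ge0// fine_ge0// tail_ge0. Qed.

Lemma rate_le n z z' : z <= z' -> rate n z' <= rate n z.
Proof.
move=> zz'; rewrite ler_pM2r// fine_le ?tail_fin_num//; exact: tail_le.
Qed.

(** Scaling space by [z / 3] reduces the threshold [z] to 3, for which the limit is [C]. The result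
    is the tail of the Lévy measure. *)
Lemma rate_cvg z : 0 < z -> rate n z @[n --> \oo] --> C3 * z `^ (- alpha).
Proof.
move=> z0; pose r := z / 3; have r0 : 0 < r by rewrite divr_gt0.
pose e n : R := n.+1%:R^-1 * r `^ (- alpha).
have ra0 : 0 < r `^ (- alpha) by exact: powR_gt0.
have e0 n : 0 < e n by rewrite mulr_gt0.
have ec : e n @[n --> \oo] --> 0.
  by rewrite -(mul0r (r `^ (- alpha))); apply: cvgMl; exact: inv_succ_cvg.
have -> : rate ^~ z = (fun n => r `^ (- alpha) * tail_rate X (e n)).
  apply/funext => n; rewrite /rate /tail_rate.
  have -> : tail X n.+1%:R^-1 z = tail X (e n) 3.
    rewrite -(tail_scaling alpha12 stableX laplaceX 3 r0 (ltW (e0 n))) /r divfK//.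
    rewrite /e mulrCA -powRD ?subrr ?powRr0 ?mulr1//.
    by apply/implyP => _; exact: lt0r_neq0.
  rewrite /e invfM invrK [X in _ * (_ * X)]mulrC mulrCA mulrA.
  by rewrite -[RHS]mulrA mulVKf// lt0r_neq0.
have -> : C3 * z `^ (- alpha) = r `^ (- alpha) * C.
  rewrite /r powRM ?invr_ge0 ?ltW// /C3 mulrC [C * _]mulrC mulrA; congr (_ * _ * _).
  by rewrite -powR_inv1// -powRrM mulN1r opprK.
apply: cvgMr; exact: C_rate.
Qed.

Lemma rate_bounded z : 0 < z -> exists2 K, 0 <= K & forall n, rate n z <= K.
Proof.
move=> z0; have : cvgn (rate ^~ z) by apply/cvg_ex; exists (C3 * z `^ (- alpha)); exact: rate_cvg.
move=> /cvg_seq_bounded /bounded_fun_has_ubound [K HK].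
exists (Num.max K 0); first by rewrite le_max lexx orbT.
by move=> n; rewrite le_max HK//; exists n.
Qed.

(** The Lévy tail at the size that a jump from the present position has to exceed: the limit of
    [window_rate] divided by the length of the window, off the indicator. *)
Definition kern z L p : R := C3 * (Num.max z (L - pos p)) `^ (- alpha).

Let maxpos z L p : 0 < z -> 0 < Num.max z (L - pos p).
Proof. by move=> z0; rewrite lt_max z0. Qed.

Lemma powRN_le y z : 0 < z -> z <= y -> y `^ (- alpha) <= z `^ (- alpha).
Proof.
move=> z0 zy; have y0 := lt_le_trans z0 zy.
by rewrite !powRN lef_pV2 ?posrE ?powR_gt0// ge0_ler_powR// ?nnegrE ltW.
Qed.

Lemma kern_bounds z L p : 0 < z -> 0 <= kern z L p <= C3 * z `^ (- alpha).
Proof.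
move=> z0; rewrite mulr_ge0 ?powR_ge0//= ler_wpM2l// powRN_le//.
by rewrite le_max lexx.
Qed.

Lemma measurable_kern z L : measurable_fun setT (kern z L).
Proof.
apply: measurable_funM; first exact: measurable_cst.
apply: (measurableT_comp (f := fun x => x `^ (- alpha)) (measurable_powR (- alpha))).
apply: measurable_maxr; first exact: measurable_cst.
by apply: measurable_funB; [exact: measurable_cst|exact: measurable_position].
Qed.

Definition passage_density a b1 b2 z c L : \bar R :=
  (\int[M]_p (\1_(Q a b1 b2 c) p * kern z L p)%:E)%E.

Lemma passage_density_le a b1 b2 z c L : 0 <= a -> 0 < z ->
  (passage_density a b1 b2 z c L <= (C3 * z `^ (- alpha))%:E * M (Q a b1 b2 c))%E.
Proof.
move=> a0 z0; have mQ := measurable_start_region levyX a b1 b2 c.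
have K0 : 0 <= C3 * z `^ (- alpha) by rewrite mulr_ge0 ?powR_ge0.
apply: (@le_trans _ _ (\int[M]_p ((C3 * z `^ (- alpha))%:E * (\1_(Q a b1 b2 c) p)%:E))%E).
  apply: ge0_le_integral => //.
  - by move=> p _; rewrite lee_fin mulr_ge0//; have /andP[] := kern_bounds L p z0.
  - apply/measurable_EFinP; apply: measurable_funM; first exact: measurable_indic.
    exact: measurable_kern.
  - by apply: emeasurable_funM => //; apply/measurable_EFinP; exact: measurable_indic.
  - move=> p _; rewrite -EFinM lee_fin mulrC ler_wpM2r//.
    by have /andP[] := kern_bounds L p z0.
rewrite ge0_integralZl//; first by rewrite integral_indic// setIT.
by apply/measurable_EFinP; exact: measurable_indic.
Qed.

Lemma passage_density_fin a b1 b2 z c L : 0 <= a -> 0 < z ->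
  passage_density a b1 b2 z c L \is a fin_num.
Proof.
move=> a0 z0; rewrite ge0_fin_numE; last first.
  apply: integral_ge0 => p _; rewrite lee_fin mulr_ge0//.
  by have /andP[] := kern_bounds L p z0.
apply: le_lt_trans (passage_density_le _ _ _ _ a0 z0) _.
by rewrite -(fineK (region_fin_num stableX b1 b2 c a0)) -EFinM ltry.
Qed.

(** [I n] is the expected duration divided by the window length. Its integrand converges by
    [rate_cvg], with a bound on [rate n z] as dominating constant. *)
Lemma window_measure_cvg a b1 b2 z c L : 0 <= a -> 0 < z ->
  (exists2 I : nat -> \bar R, forall n,
    M (window_region X a b1 b2 z c L n.+1%:R^-1) = ((n.+1%:R^-1)%:E * I n)%E &
    I n @[n --> \oo] --> passage_density a b1 b2 z c L).
Proof.
move=> a0 z0; have mQ := measurable_start_region levyX a b1 b2 c.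
have [K K0 HK] := rate_bounded z0.
have mrate n : measurable_fun setT (fun p => rate n (Num.max z (L - pos p))).
  apply: measurable_funM; last exact: measurable_cst.
  apply: (measurableT_comp (fine_measurable measurableT)).
  apply: (measurableT_comp (measurable_tail X _)).
  apply: measurable_maxr; first exact: measurable_cst.
  by apply: measurable_funB; [exact: measurable_cst|exact: measurable_position].
exists (fun n => \int[M]_p (\1_(Q a b1 b2 c) p * rate n (Num.max z (L - pos p)))%:E)%E.
  move=> n; rewrite window_region_measure//.
  have mE : measurable_fun setT
      (fun p => (\1_(Q a b1 b2 c) p * rate n (Num.max z (L - pos p)))%:E).
    by apply/measurable_EFinP; apply: measurable_funM => //; exact: measurable_indic.
  have E0 p : setT p -> (0 <= (\1_(Q a b1 b2 c) p * rate n (Num.max z (L - pos p)))%:E)%E.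
    by move=> _; rewrite lee_fin mulr_ge0// rate_ge0.
  rewrite -(ge0_integralZl M measurableT mE E0) ?lee_fin ?ltW//.
  apply: eq_integral => p _; rewrite /window_rate -(fineK (tail_fin_num X _ _)) -!EFinM.
  congr (_%:E); rewrite [RHS]mulrCA; congr (_ * _).
  by rewrite /rate mulrCA mulVf ?mulr1// pnatr_eq0.
apply: (region_dct a0 K0 (fun=> mQ) mQ) => //.
- by move=> n p [].
- exact: measurable_kern.
- move=> n p; rewrite rate_ge0/=; apply: le_trans (HK n); apply: rate_le.
  by rewrite le_max lexx.
- by move=> p; near=> n.
- by move=> p; apply: rate_cvg; exact: maxpos.
Unshelve. all: by end_near. Qed.

Lemma passage_open_le_density a b1 b2 z c L : 0 <= a -> 0 < z -> L < 1 ->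
  (P (passage_open X a b1 b2 z c) <= passage_density a b1 b2 z c L)%E.
Proof.
move=> a0 z0 L1; have Rfin := passage_density_fin b1 b2 c L a0 z0.
have [I WI Ic] := window_measure_cvg b1 b2 c L a0 z0.
apply/lee_addgt0Pr => e e0.
move: Ic; rewrite -(fineK Rfin) => Ic.
have : (\forall n \near \oo, I n <= (fine (passage_density a b1 b2 z c L) + e)%:E)%E.
  have /fine_cvgP[Ifin /cvgrPdist_lt/(_ _ e0) Ie] := Ic.
  near=> n; have In : I n \is a fin_num by near: n.
  rewrite -(fineK In) lee_fin; have : `|fine (passage_density a b1 b2 z c L) - fine (I n)| < e by near: n.
  rewrite ltr_norml => /andP[h1 h2]; lra.
move=> [N _ HN].
apply: (@passage_open_le _ _ _ _ _ levyX (fun n => (n + N).+1%:R^-1) _ _ _ _ _ _ _ L) => //.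
  have := @inv_succ_cvg R; rewrite -(cvg_shiftn N).
  by [].
move=> n; rewrite WI EFinM lee_pmul2l ?lte_fin//.
by apply: HN => /=; rewrite leq_addl.
Unshelve. all: by end_near. Qed.

Lemma passage_closed_ge_density a b1 b2 z c : 0 <= a -> 0 < z -> c <= 1 ->
  (passage_density a b1 b2 z c 1%R <= P (passage_closed X a b1 b2 z c))%E.
Proof.
move=> a0 z0 c1; have Rfin := passage_density_fin b1 b2 c 1 a0 z0.
have [I WI Ic] := window_measure_cvg b1 b2 c 1 a0 z0.
apply/lee_addgt0Pr => e e0.
move: Ic; rewrite -(fineK Rfin) => Ic.
have : (\forall n \near \oo, (fine (passage_density a b1 b2 z c 1%R) - e)%:E <= I n)%E.
  have /fine_cvgP[Ifin /cvgrPdist_lt/(_ _ e0) Ie] := Ic.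
  near=> n; have In : I n \is a fin_num by near: n.
  rewrite -(fineK In) lee_fin; have : `|fine (passage_density a b1 b2 z c 1%R) - fine (I n)| < e by near: n.
  rewrite ltr_norml => /andP[h1 h2]; lra.
move=> [N _ HN].
rewrite -leeBlDr// -EFinB.
apply: (@passage_closed_ge _ _ _ _ _ levyX (fun n => (n + N).+1%:R^-1)) => //.
  have := @inv_succ_cvg R; rewrite -(cvg_shiftn N).
  by [].
move=> n; rewrite WI EFinM lee_pmul2l ?lte_fin//.
by apply: HN => /=; rewrite leq_addl.
Unshelve. all: by end_near. Qed.

Lemma max_cvg (u v : nat -> R) (x y : R) : u n @[n --> \oo] --> x -> v n @[n --> \oo] --> y ->
  Num.max (u n) (v n) @[n --> \oo] --> Num.max x y.
Proof.
move=> ux vy; rewrite maxr_absE.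
have -> : (fun n => Num.max (u n) (v n)) = (fun n => (u n + v n + `|u n - v n|) / 2).
  by apply/funext => n; rewrite maxr_absE.
apply: cvgMl; apply: cvgD; first exact: cvgD.
by apply: cvg_norm; exact: cvgB.
Qed.

Lemma kern_cvg z L (zn Ln : nat -> R) p : 0 < z ->
  zn n @[n --> \oo] --> z -> Ln n @[n --> \oo] --> L ->
  kern (zn n) (Ln n) p @[n --> \oo] --> kern z L p.
Proof.
move=> z0 zc Lc; apply: cvgMr; apply: powR_seq_cvg; first exact: maxpos.
by apply: max_cvg => //; apply: cvgB => //; exact: cvg_cst.
Qed.

Let add_inv_cvg a : a + n.+1%:R^-1 @[n --> \oo] --> a.
Proof. by rewrite -[X in _ --> X]addr0; apply: cvgD; [exact: cvg_cst|exact: inv_succ_cvg]. Qed.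

Let sub_inv_cvg a : a - n.+1%:R^-1 @[n --> \oo] --> a.
Proof. by rewrite -[X in _ --> X]subr0; apply: cvgB; [exact: cvg_cst|exact: inv_succ_cvg]. Qed.

Let near_add_inv a u : a < u -> \forall n \near \oo, a + n.+1%:R^-1 < u.
Proof.
rewrite -subr_gt0 => /near_inv_lt; apply: filterS => n; by rewrite ltrBrDl.
Qed.

Lemma passage_half_measure a b1 b2 z c : 0 <= a -> 0 < z -> c <= 1 ->
  P (passage_half X a b1 b2 z c) = passage_density a b1 b2 z c 1%R.
Proof.
move=> a0 z0 c1.
have mH := measurable_passage_half levyX a b1 b2 z c.
have mQ a' b b' c' := measurable_start_region levyX a' b b' c'.
have kd z' L p : z <= z' -> 0 <= kern z' L p <= C3 * z `^ (- alpha).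
  move=> zz; have /andP[-> h2] := kern_bounds L p (lt_le_trans z0 zz); rewrite (le_trans h2)//.
  by rewrite ler_wpM2l// powRN_le.
apply/eqP; rewrite eq_le; apply/andP; split.
  (* Upper bound: the closed conditions are widened and [L] tends to 1 from below. *)
  have cv : passage_density (a + n.+1%:R^-1) b1 b2 z (c + n.+1%:R^-1) (1 - n.+1%:R^-1)
      @[n --> \oo] --> passage_density a b1 b2 z c 1%R.
    apply: (@region_dct _ _ _ _ (a + 1) (C3 * z `^ (- alpha))) => //.
    - by rewrite addr_ge0.
    - by rewrite mulr_ge0// powR_ge0.
    - move=> n p [/andP[-> h2] _ _]; rewrite (le_trans h2)// lerD2l.
      by rewrite invf_le1// ler1n.
    - by move=> n; exact: measurable_kern.
    - exact: measurable_kern.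
    - by move=> n p; apply: kd.
    - move=> p; have [pa|pa] := leP p.1 a; last first.
        have := near_add_inv pa; apply: filterS => n npa; split.
          by move=> [/andP[_ +] _ _]; rewrite leNgt npa.
        by move=> [/andP[_ +] _ _]; rewrite leNgt pa.
      have [pc|pc] := leP (position_sup X p) c; last first.
        have := near_add_inv pc; apply: filterS => n npa; split.
          by move=> [_ + _]; rewrite leNgt npa.
        by move=> [_ + _]; rewrite leNgt pc.
      near=> n; split; first by move=> [/andP[p0 _] _ pb]; split => //; rewrite p0.
      move=> [/andP[p0 _] _ pb]; split => //; first by rewrite p0 (le_trans pa)// lerDl ltW.
      by rewrite (le_trans pc)// lerDl ltW.
    - move=> p; apply: kern_cvg => //; exact: cvg_cst.
  rewrite -(cvg_lim (@ereal_hausdorff R) cv); apply: lime_ge.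
    by apply/cvg_ex; exists (passage_density a b1 b2 z c 1%R).
  near=> n.
  apply: (@le_trans _ _ (P (passage_open X (a + n.+1%:R^-1) b1 b2 z (c + n.+1%:R^-1)))).
    apply: measure_le => //; first exact: measurable_passage_open.
    move=> w [Ta Ub Dz Sc]; split => //.
      by rewrite (le_lt_trans Ta)// lte_fin ltrDl.
    by rewrite (le_lt_trans Sc)// ltrDl.
  by apply: passage_open_le_density => //; rewrite ?gtrBl// addr_ge0// ltW.
(* Lower bound: the open conditions are narrowed while [L] stays 1. *)
have cv : passage_density a (b1 + n.+1%:R^-1) (b2 - n.+1%:R^-1) (z + n.+1%:R^-1) c 1%R
    @[n --> \oo] --> passage_density a b1 b2 z c 1%R.
  apply: (@region_dct _ _ _ _ a (C3 * z `^ (- alpha))) => //.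
  - by rewrite mulr_ge0// powR_ge0.
  - by move=> n p [].
  - by move=> n; exact: measurable_kern.
  - exact: measurable_kern.
  - by move=> n p; apply: kd; rewrite lerDl ltW.
  - move=> p; have [/andP[pb1 pb2]|pb] := boolP (b1 < pos p < b2); last first.
      near=> n; split; last by move=> [_ _ pb']; rewrite pb' in pb.
      move=> [? ? /andP[h1 h2]]; split => //.
      rewrite (lt_trans _ h1) ?ltrDl//=.
      by rewrite (lt_trans h2)// gtrBl.
    near=> n.
    have h1 : b1 + n.+1%:R^-1 < pos p by near: n; exact: near_add_inv.
    have h2 : pos p + n.+1%:R^-1 < b2 by near: n; exact: near_add_inv.
    split.
      by move=> [? ? _]; split => //; rewrite pb1.
    by move=> [? ? _]; split => //; rewrite h1/= ltrBrDr.
  - move=> p; apply: kern_cvg => //; exact: cvg_cst.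
rewrite -(cvg_lim (@ereal_hausdorff R) cv); apply: lime_le.
  by apply/cvg_ex; exists (passage_density a b1 b2 z c 1%R).
near=> n.
apply: (@le_trans _ _ (P (passage_closed X a (b1 + n.+1%:R^-1) (b2 - n.+1%:R^-1) (z + n.+1%:R^-1) c))).
  by apply: passage_closed_ge_density => //; rewrite addr_gt0.
apply: measure_le => //; first exact: measurable_passage_closed.
move=> w [Ta /andP[h1 h2] Dz Sc]; split => //.
  by rewrite (lt_le_trans _ h1) ?ltrDl//= (le_lt_trans h2)// gtrBl.
by rewrite (lt_le_trans _ Dz)// ltrDl.
Unshelve. all: by end_near. Qed.

(** Positions within [1 / (n + 1)] of the level give densities tending to an integral over
    [pos p = 1], a null set. The bound 2 strictly exceeds the supremum before the passage, which is
    at most 1, and [L = 0] only has to be below 1. *)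
Lemma passage_from_level_null :
  P [set w | [/\ (passage_time X 1 w < +oo)%E, pre_passage X 1 w = 1 & 0 < passage_jump X 1 w]] = 0%E.
Proof.
have mQ a' b b' c' := measurable_start_region levyX a' b b' c'.
have null a z : 0 <= a -> 0 < z -> P [set w | [/\ (passage_time X 1 w < a%:E)%E,
    pre_passage X 1 w = 1 & z < passage_jump X 1 w]] = 0%E.
  move=> a0 z0; apply/eqP; rewrite eq_le measure_ge0 andbT.
  pose Q0 : set (R * T) := [set p | [/\ 0 <= p.1 <= a, position_sup X p <= 2 & pos p = 1]].
  have mQ0 : measurable Q0.
    rewrite (_ : Q0 = Q a 0 2 2 `&` pos @^-1` [set 1]).
      by apply: measurableI => //; apply: measurable_preim => //; exact: measurable_position.
    apply/seteqP; split=> p; first by move=> [? ? p1]; split => //; split => //; rewrite p1 ltr01 ltr1n.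
    by move=> [[? ? _] ?].
  have Q00 : M Q0 = 0%E.
    apply: measure_null_sub (space_time_level stableX hX (oner_neq0 R)) => //.
      rewrite (_ : [set p | _] = pos @^-1` [set 1])//.
      by apply: measurable_preim => //; exact: measurable_position.
    by move=> p [].
  have cv : passage_density a (1 - n.+1%:R^-1) (1 + n.+1%:R^-1) z 2 0%R
      @[n --> \oo] --> (\int[M]_p (\1_Q0 p * kern z 0 p)%:E)%E.
    apply: (@region_dct _ _ _ _ a (C3 * z `^ (- alpha))) => //.
    - by rewrite mulr_ge0// powR_ge0.
    - by move=> n p [].
    - by move=> n; exact: measurable_kern.
    - exact: measurable_kern.
    - by move=> n p; exact: kern_bounds.
    - move=> p; have [p1|p1|p1] := ltgtP (pos p) 1.
      + have := near_add_inv p1; apply: filterS => n np; split; last by move=> [_ _ E]; rewrite E ltxx in p1.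
        by move=> [_ _ /andP[+ _]]; rewrite ltrBlDr ltNge (ltW np).
      + have := near_add_inv p1; apply: filterS => n np; split; last by move=> [_ _ E]; rewrite E ltxx in p1.
        by move=> [_ _ /andP[_ +]]; rewrite ltNge (ltW np).
      + near=> n; split; first by move=> [].
        by move=> [? ? _]; split => //; rewrite p1 gtrBl ltrDl i0.
    - by move=> p; exact: cvg_cst.
  have -> : 0%E = (\int[M]_p (\1_Q0 p * kern z 0 p)%:E)%E.
    apply/eqP; rewrite eq_le integral_ge0/=; last first.
      by move=> p _; rewrite lee_fin mulr_ge0//; have /andP[] := kern_bounds 0 p z0.
    apply: (@le_trans _ _ (\int[M]_p ((C3 * z `^ (- alpha))%:E * (\1_Q0 p)%:E))%E).
      apply: ge0_le_integral => //.
      - by move=> p _; rewrite lee_fin mulr_ge0//; have /andP[] := kern_bounds 0 p z0.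
      - apply/measurable_EFinP; apply: measurable_funM; first exact: measurable_indic.
        exact: measurable_kern.
      - by apply: emeasurable_funM => //; apply/measurable_EFinP; exact: measurable_indic.
      - move=> p _; rewrite -EFinM lee_fin mulrC ler_wpM2r//.
        by have /andP[] := kern_bounds 0 p z0.
    rewrite ge0_integralZl//; last first.
    - by rewrite lee_fin mulr_ge0// powR_ge0.
    - by apply/measurable_EFinP; exact: measurable_indic.
    rewrite integral_indic// setIT.
    by rewrite [X in (_ * X)%E](_ : _ = 0%E) ?mule0//.
  rewrite -(cvg_lim (@ereal_hausdorff R) cv); apply: lime_ge.
    by apply/cvg_ex; exists (\int[M]_p (\1_Q0 p * kern z 0 p)%:E)%E.
  near=> n.
  apply: (@le_trans _ _ (P (passage_open X a (1 - n.+1%:R^-1) (1 + n.+1%:R^-1) z 2))).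
    apply: measure_le => //; last 1 first.
    - move=> w [Ta U1 Dz]; split => //; first by rewrite U1 gtrBl ltrDl i0.
      have := passage_time_ge0 (fun t => X t) w 1.
      rewrite /pre_passage_sup; case E : passage_time Ta => [tau| |]// Ta tau0.
      apply: (@le_lt_trans _ _ 1); last by rewrite ltr1n.
      apply: run_sup_left_passage E; first by case: levyX.
      by case: levyX => ->.
    - rewrite (_ : [set w | _] = passage_time X 1 @^-1` `]-oo, a%:E[ `&`
        (pre_passage X 1 @^-1` [set 1] `&` passage_jump X 1 @^-1` `]z, +oo[)).
        apply: measurableI.
          by apply: measurable_preim; [exact: measurable_passage_time1|exact: emeasurable_itv].
        apply: measurableI; apply: measurable_preim => //.
          exact: measurable_pre_passage1.
        exact: measurable_passage_jump1.
      by apply/seteqP; split=> w; rewrite /= !in_itv/= andbT; [move=> []|move=> [? []]].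
    - exact: measurable_passage_open.
  by apply: passage_open_le_density.
have mN : measurable [set w | [/\ (passage_time X 1 w < +oo)%E, pre_passage X 1 w = 1 & 0 < passage_jump X 1 w]].
  rewrite (_ : [set w | _] = passage_time X 1 @^-1` `]-oo, +oo%E[ `&`
    (pre_passage X 1 @^-1` [set 1] `&` passage_jump X 1 @^-1` `]0, +oo[)).
    apply: measurableI.
      by apply: measurable_preim; [exact: measurable_passage_time1|exact: emeasurable_itv].
    apply: measurableI; apply: measurable_preim => //.
      exact: measurable_pre_passage1.
    exact: measurable_passage_jump1.
  by apply/seteqP; split=> w; rewrite /= !in_itv/= andbT; [move=> []|move=> [? []]].
have mn n : measurable [set w | [/\ (passage_time X 1 w < n%:R%:E)%E,
    pre_passage X 1 w = 1 & n.+1%:R^-1 < passage_jump X 1 w]].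
  rewrite (_ : [set w | _] = passage_time X 1 @^-1` `]-oo, n%:R%:E[ `&`
    (pre_passage X 1 @^-1` [set 1] `&` passage_jump X 1 @^-1` `]n.+1%:R^-1, +oo[)).
    apply: measurableI.
      by apply: measurable_preim; [exact: measurable_passage_time1|exact: emeasurable_itv].
    apply: measurableI; apply: measurable_preim => //.
      exact: measurable_pre_passage1.
    exact: measurable_passage_jump1.
  by apply/seteqP; split=> w; rewrite /= !in_itv/= andbT; [move=> []|move=> [? []]].
apply: measure_null_sub (measure_bigcup_null (m := P) mn (fun n => null n%:R n.+1%:R^-1 (ler0n _ n) (i0 n))) => //.
  exact: bigcupT_measurable.
move=> w [Tw U1 D0].
have := passage_time_ge0 (fun t => X t) w 1.
case E : passage_time Tw => [tau| |]// _ tau0.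
have [n1 _ Hn1] := near_inv_lt D0.
have [n2 Hn2] : exists n, tau < n%:R by exists (Num.truncn tau).+1; exact: truncnS_gt.
exists (maxn n1 n2) => //; split => //=.
- by rewrite E lte_fin (lt_le_trans Hn2)// ler_nat leq_maxr.
- by apply: Hn1 => /=; exact: leq_maxl.
Unshelve. all: by end_near. Qed.

End compensation.

(** * The density killed above a level *)

Section densities.
Local Open Scope ereal_scope.

(** [f] agrees almost everywhere with the Radon-Nikodym derivative, for which the change of
    variables is known. *)
Lemma density_integral {d} {T : measurableType d} {R : realType}
    (mu : {sigma_finite_measure set T -> \bar R}) (nu : {measure set T -> \bar R})
    (f g : T -> \bar R) :
  measurable_fun setT f -> (forall x, 0 <= f x) -> nu setT < +oo ->
  (forall A, measurable A -> nu A = \int[mu]_(x in A) f x) ->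
  measurable_fun setT g -> (forall x, 0 <= g x) ->
  \int[nu]_x g x = \int[mu]_x (g x * f x).
Proof.
move=> mf f0 nuoo nuE mg g0.
pose nuf : {finite_measure set T -> \bar R} := mfrestr measurableT nuoo.
have nufE A : nuf A = nu A by rewrite /nuf/= /mfrestr /mrestr setIT.
have dom : nuf `<< mu.
  apply/null_content_dominatesP => A mA A0; rewrite nufE nuE// null_set_integral//.
  exact: measurable_funTS.
have fi : mu.-integrable setT f.
  apply/integrableP; split => //.
  by under eq_integral do rewrite gee0_abs//; rewrite -nuE.
have ae_f : ae_eq mu setT f (Radon_Nikodym_SigmaFinite.f nuf mu).
  apply: integral_ae_eq => //.
    exact: measurable_int (Radon_Nikodym_SigmaFinite.f_integrable dom).
  move=> E _ mE; rewrite -nuE// -nufE; exact: (Radon_Nikodym_SigmaFinite.f_integral dom mE).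
have mRN : measurable_fun setT (Radon_Nikodym_SigmaFinite.f nuf mu).
  exact: measurable_int (Radon_Nikodym_SigmaFinite.f_integrable dom).
transitivity (\int[nuf]_x g x); first by apply: eq_measure_integral => A _ _; rewrite -nufE.
rewrite -(Radon_Nikodym_SigmaFinite.change_of_variables dom g0 measurableT mg).
apply: ge0_ae_eq_integral => //.
- exact: emeasurable_funM.
- exact: emeasurable_funM.
- by move=> x _; rewrite mule_ge0// Radon_Nikodym_SigmaFinite.f_ge0.
- by move=> x _; rewrite mule_ge0.
- by move: ae_f; apply: filterS => x E _; rewrite E.
Qed.

(** On the set where [g < f] the integral of [f - g] is at most 0, so that this set is null. *)
Lemma ae_le_of_integral {d} {T : measurableType d} {R : realType}
    (mu : {measure set T -> \bar R}) (f g : T -> \bar R) :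
  measurable_fun setT f -> measurable_fun setT g ->
  (forall x, 0 <= f x) -> (forall x, 0 <= g x) -> \int[mu]_x f x < +oo ->
  (forall A, measurable A -> \int[mu]_(x in A) f x <= \int[mu]_(x in A) g x) ->
  {ae mu, forall x, f x <= g x}.
Proof.
move=> mf mg f0 g0 foo fg.
pose A := [set x | g x < f x].
have mA : measurable A.
  by have := emeasurable_fun_lt measurableT mg mf; rewrite setTI.
have fA : \int[mu]_(x in A) f x < +oo.
  by apply: le_lt_trans foo; exact: ge0_subset_integral.
have fi : mu.-integrable A f.
  apply/integrableP; split; first exact: measurable_funTS.
  by under eq_integral do rewrite gee0_abs//.
have gi : mu.-integrable A g.
  apply/integrableP; split; first exact: measurable_funTS.
  under eq_integral do rewrite gee0_abs//.
  apply: le_lt_trans fA; apply: ge0_le_integral => //; [exact: measurable_funTS|exact: measurable_funTS|].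
  by move=> x /= /ltW.
have d0 : \int[mu]_(x in A) `|f x - g x| = 0.
  have -> : \int[mu]_(x in A) `|f x - g x| = \int[mu]_(x in A) (f x - g x).
    apply: eq_integral => x; rewrite inE => Ax; rewrite gee0_abs// sube_ge0 ?ltW//.
    by apply/orP; left; rewrite ge0_fin_numE// (lt_le_trans Ax)// leey.
  rewrite integralB//; apply/eqP; rewrite eq_le; apply/andP; split.
    by rewrite leeBlDr ?fg//; [rewrite add0e fg|exact: integrable_fin_num gi].
  rewrite sube_ge0; last by rewrite integrable_fin_num.
  by apply: ge0_le_integral => //; [exact: measurable_funTS|exact: measurable_funTS|move=> x /= /ltW].
have mfg : measurable_fun A (fun x => f x - g x).
  by apply: measurable_funTS; exact: emeasurable_funB.
have /(ae_eq_integral_abs mu mA mfg).1 := d0.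
apply: filterS => x /= H; rewrite leNgt; apply/negP => gf.
move: gf (H gf); case: (f x) (f0 x) => [a| |] // _; case: (g x) (g0 x) => [b| |] // _.
by rewrite lte_fin => ba [/eqP]; rewrite subr_eq0 => /eqP E; rewrite E ltxx in ba.
Qed.

Lemma leb_shift {R : realType} (a : R) (g : R -> \bar R) :
  measurable_fun setT g -> (forall x, 0 <= g x) ->
  \int[@leb R]_x g (a + x)%R = \int[@leb R]_x g x.
Proof.
move=> mg g0.
have ms : measurable_fun setT (fun x : measurableTypeR R => (a + x)%R : measurableTypeR R).
  exact: (measurable_funD (measurable_cst a) (@measurable_id _ R setT)).
have ms' : measurable_fun setT (fun x : R => (a + x)%R) by exact: measurable_funD.
rewrite !ge0_integral_leb//; last exact: (measurableT_comp mg ms').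
have E A : measurable A -> lebesgue_measure A = law (@lebesgue_measure R) ms A.
  apply: lebesgue_measure_unique => _ [[b c] /= bc <-]; rewrite lawE.
  have -> : (fun x : measurableTypeR R => (a + x)%R) @^-1` `]b, c]%classic = `](b - a)%R, (c - a)%R]%classic.
    by apply/seteqP; split=> x; rewrite /= !in_itv/= ltrBlDl lerBrDl.
    rewrite lebesgue_measure_itv; apply: (etrans _ (esym (lebesgue_measure_itv _))).
    rewrite /= !lte_fin ltrD2r.
    by case: ifP => // _; rewrite -!EFinB opprB addrA subrK.
  exact: ms.
transitivity (\int[law (@lebesgue_measure R) ms]_x g x).
  by rewrite ge0_integral_pushforward//; exact: ms.
by apply: eq_measure_integral => A mA _; exact: (esym (E A mA)).
Qed.

End densities.

Section killed_density.
Context {d : measure_display} {T : measurableType d} {R : realType}.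
Variables (P : probability T R) (alpha : R) (X : R -> {RV P >-> R}) (h : R -> R -> R -> R).
Hypothesis alpha12 : 1 < alpha < 2.
Hypothesis stableX : stable_process alpha X.
Hypothesis laplaceX : forall t q : R, 0 < t -> 0 <= q ->
  ('E_P[fun w => expR (- q * X t w)] = (expR (t * q `^ alpha))%:E)%E.
Hypothesis hX : is_killed_density X h.
Implicit Types (a s t u c z x y : R) (w : T) (B : set R) (p : R * R).

Let levyX : levy_process X. Proof. by case: stableX. Qed.
Let cX w : cadlag_path (fun t => X t w). Proof. by case: levyX. Qed.
Let i0 n : 0 < n.+1%:R^-1 :> R. Proof. by rewrite invr_gt0. Qed.

(** A total version of [h], with value 0 off the domain where [h] is a density; time comes first, as
    in the points of the plane. *)
Definition killed c p : R := if [&& 0 < p.1, 0 < c & p.2 < c] then h c p.2 p.1 else 0.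

Lemma killed_ge0 c p : 0 <= killed c p.
Proof.
by rewrite /killed; case: ifP => // /and3P[? ? ?]; have [h0 _ _ _] := hX; exact: h0.
Qed.

Definition ball_set n c : set ((R * R) * T) :=
  [set q | `|position X (q.1.1, q.2) - q.1.2| < n.+1%:R^-1 /\ position_sup X (q.1.1, q.2) <= c].

Lemma measurable_ball_set n c : measurable (ball_set n c).
Proof.
have mp : measurable_fun setT (fun q : (R * R) * T => (q.1.1, q.2)).
  apply: measurable_fun_pair => //; exact: (measurableT_comp measurable_fst).
have mpos := measurableT_comp (measurable_position levyX) mp.
have msup := measurableT_comp (measurable_position_sup levyX) mp.
have mx : measurable_fun setT (fun q : (R * R) * T => q.1.2) by exact: (measurableT_comp measurable_snd).
have md : measurable_fun setT (fun q : (R * R) * T => `|position X (q.1.1, q.2) - q.1.2|).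
  by apply: (measurableT_comp (@normr_measurable R setT)); exact: measurable_funB mpos mx.
rewrite (_ : ball_set n c =
  (fun q : (R * R) * T => `|position X (q.1.1, q.2) - q.1.2|) @^-1` `]-oo, n.+1%:R^-1[ `&`
  (fun q : (R * R) * T => position_sup X (q.1.1, q.2)) @^-1` `]-oo, c]); last first.
  by apply/seteqP; split=> q; rewrite /ball_set/= !in_itv.
by apply: measurableI; exact: measurable_preim.
Qed.

(** For small radii, the mean of [h c y t] over [y] in the ball of radius [1 / (n + 1)] around [x],
    written as a probability. In this form it is jointly measurable in [(t, x)], and the limit
    inherits this; comparing such probabilities also gives the monotonicity in [c]. *)
Definition ball_density n c p : R :=
  (if [&& 0 < p.1, 0 < c & p.2 < c] then 1 else 0) *
  (fine (P (xsection (ball_set n c) p)) * (n.+1%:R / 2)).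

Lemma measurable_ball_density n c : measurable_fun setT (ball_density n c).
Proof.
apply: measurable_funM.
  apply: measurable_fun_if => //.
    apply: (@measurable_fun_bool _ _ _ _ true); rewrite setTI.
    rewrite (_ : _ @^-1` _ = fst @^-1` `]0, +oo[ `&` (snd @^-1` `]-oo, c[ `&` [set _ | 0 < c])); last first.
      apply/seteqP; split=> p; rewrite /= !in_itv/= andbT; first by move=> /and3P[].
      by move=> [? [? ?]]; apply/and3P.
    apply: measurableI; first exact: measurable_preim.
    apply: measurableI; first exact: measurable_preim.
    have [c0|c0] := boolP (0 < c).
      by rewrite (_ : [set _ | _] = setT)//; apply/seteqP; split.
    by rewrite (_ : [set _ | _] = set0)//; apply/seteqP; split.
apply: measurable_funM; last exact: measurable_cst.
apply: (measurableT_comp (fine_measurable measurableT)).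
apply: measurable_fun_xsection; exact: measurable_ball_set.
Qed.

Lemma ball_density_cvg c p : ball_density n c p @[n --> \oo] --> killed c p.
Proof.
rewrite /ball_density /killed; case: ifP => [|_]; last first.
  by under eq_fun do rewrite mul0r; exact: cvg_cst.
case: p => [t x] /= /and3P[t0 c0 xc].
apply/cvgrPdist_le => e e0.
have [_ hc hP _] := hX.
have /cvgrPdist_le/(_ e e0) := hc _ _ _ c0 t0 xc.
move=> /nbhs_ballP[dl /= dl0 Hdl].
have xc0 : 0 < c - x by rewrite subr_gt0.
near=> n.
have n1 : n.+1%:R^-1 < dl by near: n; exact: near_inv_lt.
have n2 : n.+1%:R^-1 < c - x by near: n; exact: near_inv_lt.
set k := n.+1%:R^-1 in n1 n2.
have k0 : 0 < k by exact: i0.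
pose I := `]x - k, x + k[%classic.
have Ic : I `<=` `]-oo, c[ by move=> y; rewrite /I/= !in_itv/= => /andP[_ /lt_le_trans]; apply; lra.
have -> : P (xsection (ball_set n c) (t, x)) = (\int[lebesgue_measure]_(y in I) (h c y t)%:E)%E.
  rewrite -hP//; last exact: measurable_itv.
  congr (P _); apply/seteqP; split=> w.
    rewrite /xsection/= inE /ball_set /I/= /position /position_sup /= (max_l (ltW t0)) ?in_itv/=.
    by rewrite ltr_distl.
  rewrite /xsection/= inE /ball_set /I/= /position /position_sup /= (max_l (ltW t0)) ?in_itv/=.
  by rewrite ltr_distl.
have lI : lebesgue_measure I = (2 * k)%:E.
  rewrite /I lebesgue_measure_itv/= lte_fin; case: ifP; last by move/negP; case; lra.
  by move=> _; rewrite -EFinB; congr (_%:E); lra.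
have near_h y : I y -> h c x t - e <= h c y t <= h c x t + e.
  rewrite /I/= in_itv/= => Iy; have := Hdl y; rewrite /ball/= => /(_ _).
  have dxy : `|x - y| < dl by rewrite distrC ltr_distl; apply/andP; split; lra.
  by move=> /(_ dxy); rewrite distrC ler_distl.
have mI : measurable_fun I (fun y => (h c y t)%:E).
  exact: measurable_funS Ic (measurable_killed_density hX c0 t0).
have h0 y : I y -> 0 <= h c y t.
  move=> Iy; have [h0 _ _ _] := hX; apply: h0 => //.
  by have := Ic _ Iy; rewrite /= in_itv.
set J := (\int[lebesgue_measure]_(y in I) _)%E.
have J0 : (0 <= J)%E by apply: integral_ge0 => y Iy; rewrite lee_fin h0.
have hx0 : 0 <= h c x t by have [h0' _ _ _] := hX; exact: h0'.
have mIs : measurable (I : set (measurableTypeR R)) by exact: measurable_itv.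
have cstI r : (\int[lebesgue_measure]_(y in I) (cst r%:E) y = (r * (2 * k))%:E)%E.
  by rewrite integral_cst// EFinM; congr (_ * _)%E; exact: lI.
have Jle : (J <= ((h c x t + e) * (2 * k))%:E)%E.
  rewrite -cstI; apply: ge0_le_integral => //.
  by move=> y /near_h/andP[]; rewrite lee_fin.
have Jfin : J \is a fin_num by rewrite ge0_fin_numE// (le_lt_trans Jle)// ltry.
have Jge : (((h c x t - e) * (2 * k))%:E <= J)%E.
  have [e1|e1] := leP (h c x t) e.
    by apply: le_trans J0; rewrite lee_fin mulr_le0_ge0// ?subr_le0// mulr_ge0// ltW.
  rewrite -cstI; apply: ge0_le_integral => //.
  - by move=> y Iy; rewrite lee_fin subr_ge0 ltW.
  - by move=> y /near_h/andP[]; rewrite lee_fin.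
rewrite mul1r -[n.+1%:R]invrK -/k.
move: Jle Jge; rewrite -(fineK Jfin) !lee_fin => Jle Jge.
have kk : 2 * k * (k^-1 / 2) = 1 by rewrite -mulrA mulVKf ?lt0r_neq0// divff.
have k2 : 0 < k^-1 / 2 by rewrite divr_gt0// invr_gt0.
rewrite ler_distlC; apply/andP; split.
  by have := ler_wpM2r (ltW k2) Jge; rewrite -mulrA kk mulr1.
by have := ler_wpM2r (ltW k2) Jle; rewrite -mulrA kk mulr1.
Unshelve. all: by end_near. Qed.

Lemma measurable_killed c : measurable_fun setT (killed c).
Proof.
apply: (measurable_fun_cvg (h := ball_density ^~ c)) => [n|p _].
  exact: measurable_ball_density.
exact: ball_density_cvg.
Qed.

Lemma killed_le c c' p : c <= c' -> killed c p <= killed c' p.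
Proof.
move=> cc'; have [cond|ncond] := boolP [&& 0 < p.1, 0 < c & p.2 < c]; last first.
  by rewrite {1}/killed (negbTE ncond) killed_ge0.
have cond' : [&& 0 < p.1, 0 < c' & p.2 < c'].
  by move/and3P: cond => [-> /lt_le_trans-> // /lt_le_trans->].

apply: (ler_cvg_to (@ball_density_cvg c p) (@ball_density_cvg c' p)).
near=> n; rewrite /ball_density cond cond' !mul1r ler_wpM2r ?divr_ge0//.
have mb c1 := measurable_xsection p (measurable_ball_set n c1).
apply: fine_le; [exact: fin_num_measure|exact: fin_num_measure|].
apply: measure_le => // w; rewrite /xsection/= !inE /ball_set/= => -[-> /le_trans]; by split => //; auto.
Unshelve. all: by end_near. Qed.

Let measurable_killed2 c t : measurable_fun setT (fun x => (killed c (t, x))%:E).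
Proof.
apply/measurable_EFinP; apply: (measurableT_comp (measurable_killed c)).
by apply: measurable_fun_pair.
Qed.

Let Sset t c : set T := [set w | run_sup X t w <= c].

Let mS t c : 0 <= t -> measurable (Sset t c).
Proof.
move=> t0; rewrite (_ : Sset t c = run_sup X t @^-1` `]-oo, c]); last first.
  by apply/seteqP; split=> w; rewrite /Sset/= in_itv.
by apply: measurable_preim => //; exact: (measurable_S stableX).
Qed.

(** Two cases go beyond the hypothesis on [h]. For [c <= 0] both sides vanish, as the supremum is
    almost surely positive; for positions at or above [c] the event forces [X_t = c], which is
    null. *)
Lemma killed_measure t c B : 0 < t -> measurable B ->
  P (X t @^-1` B `&` Sset t c) = (\int[leb]_(x in B) (killed c (t, x))%:E)%E.
Proof.
move=> t0 mB; have mSc := mS c (ltW t0).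
have mXB C : measurable C -> measurable (X t @^-1` C) by exact: measurable_preim.
have [c0|c0] := ltP 0 c; last first.
  rewrite integral0_eq//; last by move=> x _; rewrite /killed (ltNge 0 c) c0 andbF.
  apply: measure_null_sub (run_sup_pos alpha12 stableX laplaceX hX t0) => //.
  - by apply: measurableI => //; exact: mXB.
  - exact: (mS 0 (ltW t0)).
  - by move=> w [_ /= /le_trans]; exact.
rewrite (_ : B = (B `&` `]-oo, c[) `|` (B `&` `[c, +oo[)); last first.
  by rewrite -setIUr -setCitvl setUv setIT.
have mB1 : measurable (B `&` `]-oo, c[) by exact: measurableI.
have mB2 : measurable (B `&` `[c, +oo[) by exact: measurableI.
rewrite ge0_integral_setU//; last 3 first.
- exact: measurable_funTS.
- by move=> x _; rewrite lee_fin killed_ge0.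
- apply/eqP; rewrite -subset0 => x [[_ /=]]; rewrite in_itv/= => xc [_ /=].
  by rewrite in_itv/= andbT leNgt xc.
rewrite [X in (_ + X)%E]integral0_eq ?adde0; last first.
  move=> x [_ /=]; rewrite in_itv/= andbT => cx.
  by rewrite /killed (ltNge x c) cx !andbF.
rewrite ge0_integral_leb//; last 2 first.
- exact: measurable_funTS.
- by move=> x _; rewrite lee_fin killed_ge0.
transitivity (\int[lebesgue_measure]_(x in B `&` `]-oo, c[) (h c x t)%:E)%E; last first.
  apply: eq_integral => x; rewrite inE => -[_ /=]; rewrite in_itv/= => xc.
  by rewrite /killed/= t0 c0 xc.
have [_ _ hP _] := hX; rewrite -hP//.
rewrite preimage_setU setIUl.
have mC : measurable [set w | (B `&` `]-oo, c[%classic) (X t w) /\ run_sup X t w <= c].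
  by have := measurableI _ _ (mXB _ mB1) mSc.
apply/eqP; rewrite eq_le; apply/andP; split.
  apply: (measureU_le (m := P)) => //; first by apply: measurableI => //; exact: mXB.
  apply: measure_null_sub (process_no_atom stableX hX c t0) => //.
    by apply: measurableI => //; exact: mXB.
  move=> w [[_ /=]]; rewrite in_itv/= andbT => cx Sc.
  by apply/eqP; rewrite eq_le cx andbT (le_trans _ Sc)//; apply: path_le_run_sup => //; rewrite ltW//=.
apply: measure_le => //.
by apply: measurableU; apply: measurableI => //; exact: mXB.
Qed.

End killed_density.

(** The shells decrease to the level set of [v], which is null; [m] is the dominating function. *)
Lemma thin_shell_cvg {d} {T : measurableType d} {R : realType}
    (mu : {measure set T -> \bar R}) (V : T -> R) (m : T -> \bar R) (v : R) :
  measurable_fun setT V -> measurable_fun setT m -> (forall y, 0 <= m y)%E ->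
  (\int[mu]_y m y < +oo)%E -> mu (V @^-1` [set v]) = 0%E ->
  (\int[mu]_y ((\1_[set y | (`|V y - v| <= n.+1%:R^-1)%R] y)%:E * m y))%E @[n --> \oo] --> 0%E.
Proof.
move=> mV mm m0 moo V0.
have mS n : measurable [set y | `|V y - v| <= n.+1%:R^-1].
  rewrite (_ : [set _ | _] = (fun y => `|V y - v|) @^-1` `]-oo, n.+1%:R^-1]); last first.
    by apply/seteqP; split=> y; rewrite /= in_itv.
  apply: measurable_preim => //; apply: (measurableT_comp (@normr_measurable R setT)).
  by apply: measurable_funB.
have mv : measurable (V @^-1` [set v]) by exact: measurable_preim.
pose f_ n y := ((\1_[set y | (`|V y - v| <= n.+1%:R^-1)%R] y)%:E * m y)%E.
pose f y := ((\1_(V @^-1` [set v]) y)%:E * m y)%E.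
have mf_ n : measurable_fun setT (f_ n).
  by apply: emeasurable_funM => //; apply/measurable_EFinP; exact: measurable_indic.
have mf : measurable_fun setT f.
  by apply: emeasurable_funM => //; apply/measurable_EFinP; exact: measurable_indic.
have cf : {ae mu, forall y, setT y -> f_ n y @[n --> \oo] --> f y}.
  apply: aeW => y _; apply: cvg_near_cst.
  have [Vv|Vv] := eqVneq (V y) v.
    near=> n; rewrite /f_ /f !indicE !mem_set//=.
    by rewrite Vv subrr normr0.
  have : 0 < `|V y - v| by rewrite normr_gt0 subr_eq0.
  move=> /near_inv_lt; apply: filterS => n nV.
  rewrite /f_ /f !indicE !memNset//=; first by move/eqP; rewrite (negbTE Vv).
  by rewrite leNgt nV.
have im : mu.-integrable setT m.
  apply/integrableP; split => //; by under eq_integral do rewrite gee0_abs//.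
have dom : {ae mu, forall y n, setT y -> (`|f_ n y| <= m y)%E}.
  apply: aeW => y n _; rewrite gee0_abs ?mule_ge0// /f_ indicE.
  by case: (_ \in _); rewrite ?mul1e// mul0e.
have [_ _] := dominated_convergence measurableT mf_ mf cf im dom.
suff -> : (\int[mu]_y f y = 0)%E by [].
have -> : (\int[mu]_y f y = \int[mu]_(y in V @^-1` [set v]) m y)%E.
  by rewrite [RHS]integral_mkcond; apply: eq_integral => y _; rewrite epatch_indic /f muleC.
by apply: null_set_integral => //; exact: measurable_funTS.
Unshelve. all: by end_near. Qed.

(** * Continuity of the killed density in the level *)

Section regularity.
Context {d : measure_display} {T : measurableType d} {R : realType}.
Variables (P : probability T R) (alpha : R) (X : R -> {RV P >-> R}) (h : R -> R -> R -> R).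
Hypothesis alpha12 : 1 < alpha < 2.
Hypothesis stableX : stable_process alpha X.
Hypothesis laplaceX : forall t q : R, 0 < t -> 0 <= q ->
  ('E_P[fun w => expR (- q * X t w)] = (expR (t * q `^ alpha))%:E)%E.
Hypothesis hX : is_killed_density X h.
Implicit Types (a s t u c x y : R) (w : T) (B : set R) (p : R * R).

Let levyX : levy_process X. Proof. by case: stableX. Qed.
Let mX t : measurable_fun setT (X t). Proof. exact: measurable_funPT. Qed.
Let i0 n : 0 < n.+1%:R^-1 :> R. Proof. by rewrite invr_gt0. Qed.

Let shell_bound (c0 c x b m : R) : `|c0 - c| < m / 4 -> `|c - x| <= b -> b < m / 4 ->
  c0 - m <= x /\ x + b <= c0 + m.
Proof.
rewrite ltr_norml ler_norml => /andP[h1 h2] /andP[h3 h4] h5; split; lra.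
Qed.

Let shell_mem (c0 c c' i v : R) : c0 - i <= c -> c' <= c0 + i -> c < v <= c' -> `|v - c0| <= i.
Proof.
by move=> h1 h2 /andP[h3 h4]; rewrite ler_norml; apply/andP; split; lra.
Qed.

Section half_time.
Variables (u : R) (u0 : 0 < u).

Let L : probability (R * R)%type R := sup_law levyX (ltW u0).

Lemma process_density : exists p : R -> \bar R, [/\ measurable_fun setT p,
  (forall x, 0 <= p x)%E & forall A, measurable A -> P (X u @^-1` A) = (\int[leb]_(x in A) p x)%E].
Proof.
pose nu : {finite_measure set R -> \bar R} := plaw P (mX u).
have dom : nu `<< (@leb R).
  by apply/null_content_dominatesP => A mA A0; exact: (process_dominated stableX hX u0 mA A0).
exists (Radon_Nikodym_SigmaFinite.f nu (@leb R)); split.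
- exact: measurable_int (Radon_Nikodym_SigmaFinite.f_integrable dom).
- exact: Radon_Nikodym_SigmaFinite.f_ge0.
- by move=> A mA; rewrite -(Radon_Nikodym_SigmaFinite.f_integral dom mA).
Qed.

Variable p : R -> \bar R.
Hypotheses (mp : measurable_fun setT p) (p0 : forall x, (0 <= p x)%E)
  (pE : forall A, measurable A -> P (X u @^-1` A) = (\int[leb]_(x in A) p x)%E).

(** The density at [x] of [X_(2 u)] on the event [E], which may depend on the whole block [q] of one
    half and on the increment [x - q.1] of the other. *)
Definition split_density (E : set ((R * R) * R)) x : \bar R :=
  (\int[L]_q ((\1_E (q, (x - q.1)%R))%:E * p (x - q.1)%R))%E.

Let shifted (E : set ((R * R) * R)) (z : R * (R * R)) : \bar R :=
  ((\1_E (z.2, (z.1 - z.2.1)%R))%:E * p (z.1 - z.2.1)%R)%E.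

Let mdiff : measurable_fun setT (fun z : R * (R * R) => z.1 - z.2.1).
Proof.
by apply: measurable_funB => //; exact: (measurableT_comp measurable_fst).
Qed.

Let measurable_shifted E : measurable E -> measurable_fun setT (shifted E).
Proof.
move=> mE; apply: emeasurable_funM; last exact: (measurableT_comp mp mdiff).
apply/measurable_EFinP; apply: (measurableT_comp (measurable_indic mE)).
exact: measurable_fun_pair.
Qed.

Let shifted_ge0 E z : (0 <= shifted E z)%E.
Proof. by rewrite mule_ge0// lee_fin. Qed.

Lemma measurable_split_density E : measurable E -> measurable_fun setT (split_density E).
Proof.
move=> mE; exact: (measurable_fun_fubini_tonelli_F (m2 := L) _ (measurable_shifted mE) (shifted_ge0 E)).
Qed.

Lemma split_density_ge0 E x : (0 <= split_density E x)%E.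
Proof. by apply: integral_ge0 => q _; rewrite mule_ge0// lee_fin. Qed.

(** Fubini and the translation [x = q.1 + y], after which the inner integral is the law of an
    increment, of density [p]. *)
Lemma split_density_integral (E : set ((R * R) * R)) (A : set R) : measurable E -> measurable A ->
  (L \x L)%E [set z | A (z.1.1 + z.2.1) /\ E (z.1, z.2.1)] =
  (\int[leb]_(x in A) split_density E x)%E.
Proof.
move=> mE mA; rewrite integral_mkcond.
transitivity (\int[leb]_x \int[L]_q ((\1_A x)%:E * shifted E (x, q)))%E; last first.
  apply: eq_integral => x _; rewrite epatch_indic /split_density.
  rewrite ge0_integralZl//; first by rewrite muleC.
  exact: (measurableT_comp (measurable_shifted mE) (measurable_pair1 x)).
have mF : measurable_fun setT (fun z : R * (R * R) => ((\1_A z.1)%:E * shifted E z)%E).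
  apply: emeasurable_funM; last exact: measurable_shifted.
  by apply/measurable_EFinP; exact: (measurableT_comp (measurable_indic mA)).
have F0 (z : R * (R * R)) : (0 <= (\1_A z.1)%:E * shifted E z)%E.
  by rewrite mule_ge0 ?lee_fin.
rewrite (fubini_tonelli (m1 := @leb R) (m2 := L) _ mF F0).
apply: eq_integral => q _ /=.
have mFq : measurable_fun setT (fun x => (\1_A x)%:E * shifted E (x, q))%E.
  exact: (measurableT_comp mF (measurable_pair2 q)).
rewrite -(leb_shift q.1 mFq); last by move=> x; exact: (F0 (x, q)).
pose C := [set y | A (q.1 + y) /\ E (q, y)].
have mC : measurable C.
  apply: measurableI.
    by apply: (measurable_preim (f := fun y => q.1 + y)) => //; exact: measurable_funD.
  by apply: (measurable_preim (f := fun y => (q, y))) => //; exact: measurable_pair1.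
transitivity (P (X u @^-1` C)).
  transitivity (P (block X 0 u @^-1` (fst @^-1` C))).
    congr (P _); apply/seteqP; split=> w; by rewrite /xsection/= inE.
  congr (P _); apply/seteqP; split=> w /=; by rewrite (increment_path0 levyX).
rewrite pE// integral_mkcond; apply: eq_integral => y _.
rewrite epatch_indic /shifted/= addrAC subrr add0r muleA -EFinM muleC; congr (_%:E * _)%E.
rewrite !indicE -natrM mulnb; congr (_%:R); congr nat_of_bool.
apply/idP/idP => [/set_mem[? ?]|/andP[/set_mem ? /set_mem ?]]; last by rewrite mem_set.
by rewrite !mem_set.
Qed.

(* The supremum over [0, 2 u] lies in ]c, c'] only if the supremum over one of
   the halves does; the second half is seen from the end point [x]. *)
Definition early_sup c c' : set ((R * R) * R) := [set z | c < z.1.2 <= c'].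
Definition late_sup c c' : set ((R * R) * R) := [set z | c < z.2 + z.1.2 <= c'].

Lemma measurable_early_sup c c' : measurable (early_sup c c').
Proof.
rewrite (_ : early_sup c c' = (fun z : (R * R) * R => z.1.2) @^-1` `]c, c']); last first.
  by apply/seteqP; split=> z; rewrite /early_sup/= in_itv.
apply: measurable_preim => //; exact: (measurableT_comp measurable_snd).
Qed.

Lemma measurable_late_sup c c' : measurable (late_sup c c').
Proof.
rewrite (_ : late_sup c c' = (fun z : (R * R) * R => z.2 + z.1.2) @^-1` `]c, c']); last first.
  by apply/seteqP; split=> z; rewrite /late_sup/= in_itv.
apply: measurable_preim => //; apply: measurable_funD => //.
exact: (measurableT_comp measurable_snd).
Qed.

Let cut c c' x := (split_density (early_sup c c') x + split_density (late_sup c c') x)%E.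

Let mcut c c' : measurable_fun setT (cut c c').
Proof.
apply: emeasurable_funD; apply: measurable_split_density.
  exact: measurable_early_sup.
exact: measurable_late_sup.
Qed.

(** By [run_sup_block_split] a supremum in []c, c']] comes from the first half or from the second,
    and [split_density] is the density of either event. Comparing integrals over all [A] gives the
    inequality for almost every [x]. *)
Lemma killed_increment c c' : c <= c' ->
  {ae @leb R, forall x, ((killed h c' ((u + u)%R, x))%:E <= (killed h c ((u + u)%R, x))%:E + cut c c' x)%E}.
Proof.
move=> cc'; have uu0 : 0 < u + u by rewrite addr_gt0.
have kE c1 B := @killed_measure _ _ _ _ _ _ _ alpha12 stableX laplaceX hX (u + u) c1 B uu0.
have mk c1 : measurable_fun setT (fun x => (killed h c1 (u + u, x))%:E).
  apply/measurable_EFinP; apply: (measurableT_comp (measurable_killed stableX hX c1)).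
  by apply: measurable_fun_pair.
have k0 c1 x : (0 <= (killed h c1 (u + u, x))%:E)%E by rewrite lee_fin (killed_ge0 hX).
have cut0 x : (0 <= cut c c' x)%E by rewrite adde_ge0// split_density_ge0.
have mS c1 : measurable [set w | run_sup X (u + u) w <= c1].
  rewrite (_ : [set _ | _] = run_sup X (u + u) @^-1` `]-oo, c1]); last first.
    by apply/seteqP; split=> w; rewrite /= in_itv.
  by apply: measurable_preim => //; apply: (measurable_S stableX); exact: ltW.
apply: ae_le_of_integral => //.
- by apply: emeasurable_funD => //; exact: mk.
- by move=> x; rewrite adde_ge0.
- rewrite -kE// ltey_eq fin_num_measure//; apply: measurableI => //.
  exact: measurable_preim.
move=> A mA; have mXA : measurable (X (u + u) @^-1` A) by exact: measurable_preim.
rewrite ge0_integralD//; [|exact: measurable_funTS|exact: measurable_funTS].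
rewrite -!kE//.
rewrite ge0_integralD//; last 4 first.
- by move=> x _; exact: split_density_ge0.
- by apply: measurable_funTS; apply: measurable_split_density; exact: measurable_early_sup.
- by move=> x _; exact: split_density_ge0.
- by apply: measurable_funTS; apply: measurable_split_density; exact: measurable_late_sup.
rewrite -!split_density_integral//; [|exact: measurable_late_sup|exact: measurable_early_sup].
pose B1 := [set z : (R * R) * (R * R) | A (z.1.1 + z.2.1) /\ early_sup c c' (z.1, z.2.1)].
pose B2 := [set z : (R * R) * (R * R) | A (z.1.1 + z.2.1) /\ late_sup c c' (z.1, z.2.1)].
have msum : measurable_fun setT (fun z : (R * R) * (R * R) => z.1.1 + z.2.1).
  by apply: measurable_funD; apply: (measurableT_comp measurable_fst).
have mpr : measurable_fun setT (fun z : (R * R) * (R * R) => (z.1, z.2.1)).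
  by apply: measurable_fun_pair => //; exact: (measurableT_comp measurable_fst).
have mB E : measurable E -> measurable [set z : (R * R) * (R * R) | A (z.1.1 + z.2.1) /\ E (z.1, z.2.1)].
  by move=> mE; apply: measurableI; [exact: (measurable_preim msum)|exact: (measurable_preim mpr)].
have mB1 : measurable B1 by apply: mB; exact: measurable_early_sup.
have mB2 : measurable B2 by apply: mB; exact: measurable_late_sup.
have u0' := ltW u0.
have e1 : ((L \x L) B1 = P [set w | B1 (block X 0 u w, block X u u w)])%E.
  by rewrite (block_independent levyX u0' u0' mB1).
(* For the late supremum the halves are exchanged: the block seen in full is that of the second
   half. *)
pose B2s := (fun z : (R * R) * (R * R) => (z.2, z.1)) @^-1` B2.
have mB2s : measurable B2s by apply: measurable_preim => //; exact: measurable_swap.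
have e2 : ((L \x L) B2 = P [set w | B2s (block X 0 u w, block X u u w)])%E.
  by rewrite (block_independent levyX u0' u0' mB2s) product_swap.
have mb : measurable_fun setT (fun w => (block X 0 u w, block X u u w)).
  by apply: measurable_fun_pair; exact: measurable_block.
have mE1 : measurable [set w | B1 (block X 0 u w, block X u u w)] by exact: (measurable_preim mb).
have mE2 : measurable [set w | B2s (block X 0 u w, block X u u w)] by exact: (measurable_preim mb).
rewrite [X in (_ <= _ + (X + _))%E]e1 [X in (_ <= _ + (_ + X))%E]e2.
have mAS c1 : measurable (X (u + u) @^-1` A `&` [set w | run_sup X (u + u) w <= c1]).
  exact: measurableI.
have mU : measurable ([set w | B1 (block X 0 u w, block X u u w)] `|`
   [set w | B2s (block X 0 u w, block X u u w)]) by exact: measurableU.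
apply: (@le_trans _ _ (P ((X (u + u) @^-1` A `&` [set w | run_sup X (u + u) w <= c]) `|`
  ([set w | B1 (block X 0 u w, block X u u w)] `|`
   [set w | B2s (block X 0 u w, block X u u w)])))).
  apply: measure_le => //; first exact: measurableU.
  move=> w [Aw Sc']; have [Sc|Sc] := leP (run_sup X (u + u) w) c; [by left|right].
  have Ss := run_sup_block_split stableX w u0' u0'.
  have Xs := process_block_split X u u w.
  have b0 := block0E stableX u w.
  move: Sc Sc'; rewrite /= Ss ge_max lt_max => /orP[Sc|Sc] /andP[S1 S2].
    have : B1 ((X u w, run_sup X u w), block X u u w).
      by split; [change (A (X u w + (block X u u w).1)); rewrite -Xs|rewrite /early_sup/= Sc S1].
    by rewrite -b0; left.
  have : B2s ((X u w, run_sup X u w), block X u u w).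
    split; first by change (A ((block X u u w).1 + X u w)); rewrite addrC -Xs.
    by change (c < X u w + (block X u u w).2 <= c'); rewrite Sc S2.
  by rewrite -b0; right.
apply: le_trans (measureU2 _ _ _) _ => //.
by rewrite leeD2l// measureU2.
Qed.

Let half_law_sup v : L (snd @^-1` [set v]) = 0%E.
Proof.
transitivity (P (run_sup X u @^-1` [set v])).
  transitivity (P (block X 0 u @^-1` (snd @^-1` [set v]))) => //; congr (P _).
  by apply/seteqP; split=> w /=; rewrite (increment_path0 levyX).
have mSv v' : measurable (run_sup X u @^-1` [set v']).
  by apply: measurable_preim => //; apply: (measurable_S stableX); exact: ltW.
have [v0|v0] := ltP 0 v; first exact: (run_sup_no_atom stableX hX).
have mS0 : measurable [set w | run_sup X u w <= 0].
  rewrite (_ : [set _ | _] = run_sup X u @^-1` `]-oo, 0]); last first.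
    by apply/seteqP; split=> w; rewrite /= in_itv.
  by apply: measurable_preim => //; apply: (measurable_S stableX); exact: ltW.
apply: measure_null_sub (run_sup_pos alpha12 stableX laplaceX hX u0) => //.
by move=> w /= ->.
Qed.

(** [x - q.1] is the position from which the second half must start to end at [x]; the equation says
    that the drawdown of that half equals [v - x]. *)
Let half_law_drawdown x v : L ((fun q => x - q.1 + q.2) @^-1` [set v]) = 0%E.
Proof.
pose D w := run_sup X u w - X u w.
have mD : measurable_fun setT D := measurable_D stableX (ltW u0).
transitivity (P (D @^-1` [set (v - x)])).
  transitivity (P (block X 0 u @^-1` ((fun q => x - q.1 + q.2) @^-1` [set v]))) => //; congr (P _).
  apply/seteqP; split=> w /=; rewrite (increment_path0 levyX) /D => E; apply/eqP.
    by rewrite -E; apply/eqP; lra.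
  by rewrite addrAC -addrA E addrC subrK.
have [v0|v0] := ltP 0 (v - x); first exact: (drawdown_no_atom stableX hX).
have mS0 : measurable [set w | D w <= 0].
  rewrite (_ : [set _ | _] = D @^-1` `]-oo, 0]); last first.
    by apply/seteqP; split=> w; rewrite /= in_itv.
  exact: measurable_preim.
have D0 : P [set w | D w <= 0] = 0%E by exact: (drawdown_pos alpha12 stableX laplaceX u0).
apply: measure_null_sub D0 => //.
- exact: measurable_preim.
- by move=> w /= ->.
Qed.

Lemma split_density_finite : {ae @leb R, forall x, (split_density setT x < +oo)%E}.
Proof.
have i : (@leb R).-integrable setT (split_density setT).
  apply/integrableP; split; first exact: measurable_split_density.
  under eq_integral do rewrite gee0_abs ?split_density_ge0//.
  rewrite -split_density_integral//.
  apply: le_lt_trans (ltry 1); apply: probability_le1.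
  by rewrite (_ : [set z | _] = setT)//; apply/seteqP; split.
have := integrable_ae measurableT i; apply: filterS => x /(_ Logic.I).
by rewrite ge0_fin_numE// split_density_ge0.
Qed.

(** Where the full split density is finite, thin shells around [c0] have a small integral. The bound
    is uniform in [c] and [c'] near [c0], and the exceptional set of [x] does not depend on the
    levels. *)
Lemma cut_vanishes x c0 e : (split_density setT x < +oo)%E -> 0 < e ->
  exists m, forall c c', c0 - m.+1%:R^-1 <= c -> c' <= c0 + m.+1%:R^-1 -> (cut c c' x < e%:E)%E.
Proof.
move=> foo e0.
have mm : measurable_fun setT (fun q : R * R => p (x - q.1)).
  by apply: (measurableT_comp mp); apply: measurable_funB.
have moo : (\int[L]_q p (x - q.1)%R < +oo)%E.
  apply: le_lt_trans foo; rewrite le_eqVlt; apply/orP; left; apply/eqP.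
  by apply: eq_integral => q _; rewrite indicT mul1e.
have mV2 : measurable_fun setT (fun q : R * R => x - q.1 + q.2).
  by apply: measurable_funD => //; exact: measurable_funB.
have e2 : 0 < e / 2 by rewrite divr_gt0.
have near_small (V : R * R -> R) : measurable_fun setT V -> L (V @^-1` [set c0]) = 0%E ->
  \forall n \near \oo, (\int[L]_q ((\1_[set q | (`|V q - c0| <= n.+1%:R^-1)%R] q)%:E * p (x - q.1)%R) < (e / 2)%:E)%E.
  move=> mV V0; have := thin_shell_cvg mV mm (fun q => p0 (x - q.1)) moo V0.
  move=> /fine_cvgP[Ifin /cvgrPdist_lt/(_ _ e2) Ie].
  near=> n; rewrite -[X in (X < _)%E]fineK; last by near: n.
  rewrite lte_fin; apply: le_lt_trans (ler_norm _) _.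
  by rewrite -normrN -sub0r; near: n.
have := filterI (near_small _ measurable_snd (half_law_sup c0)) (near_small _ mV2 (half_law_drawdown x c0)).
move=> [m _ /(_ m (leqnn m))/= [s1 s2]].
exists m => c c' cm cm'; rewrite [e]splitr EFinD; apply: lteD.
  apply: le_lt_trans s1; apply: ge0_le_integral => //.
  - by move=> q _; rewrite mule_ge0// lee_fin.
  - apply: emeasurable_funM => //; apply/measurable_EFinP.
    apply: (measurableT_comp (measurable_indic (measurable_early_sup c c'))).
    by apply: measurable_fun_pair => //; exact: measurable_funB.
  - apply: emeasurable_funM => //; apply/measurable_EFinP; apply: measurable_indic.
    rewrite (_ : [set q | _] = (fun q : R * R => `|q.2 - c0|) @^-1` `]-oo, m.+1%:R^-1]); last first.
      by apply/seteqP; split=> q; rewrite /= in_itv.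
    apply: measurable_preim => //; apply: (measurableT_comp (@normr_measurable R setT)).
    by apply: measurable_funB.
  - move=> q _; apply: lee_wpmul2r => //; rewrite lee_fin !indicE.
    case: (boolP (_ \in early_sup _ _)) => // /set_mem; rewrite /early_sup/= => cv.
    by rewrite mem_set//=; exact: shell_mem cm cm' cv.
apply: le_lt_trans s2; apply: ge0_le_integral => //.
- by move=> q _; rewrite mule_ge0// lee_fin.
- apply: emeasurable_funM => //; apply/measurable_EFinP.
  apply: (measurableT_comp (measurable_indic (measurable_late_sup c c'))).
  by apply: measurable_fun_pair => //; exact: measurable_funB.
- apply: emeasurable_funM => //; apply/measurable_EFinP; apply: measurable_indic.
  rewrite (_ : [set q | _] = (fun q : R * R => `|x - q.1 + q.2 - c0|) @^-1` `]-oo, m.+1%:R^-1]); last first.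
    by apply/seteqP; split=> q; rewrite /= in_itv.
  apply: measurable_preim => //; apply: (measurableT_comp (@normr_measurable R setT)).
  by apply: measurable_funB.
- move=> q _; apply: lee_wpmul2r => //; rewrite lee_fin !indicE.
  case: (boolP (_ \in late_sup _ _)) => // /set_mem; rewrite /late_sup/= => cv.
  by rewrite mem_set//=; exact: shell_mem cm cm' cv.
Unshelve. all: by end_near. Qed.

End half_time.

Definition grid_jump N k p : R := killed h (k.+1%:R / N.+1%:R) p - killed h (k%:R / N.+1%:R) p.

(* The continuity of [c |-> killed h c p] on [0, 1], stated with countably many
   conditions. *)
Definition regular : set (R * R) :=
  \bigcap_j \bigcup_N \bigcap_(k in [set k | (k <= N)%N]) [set p | grid_jump N k p < j.+1%:R^-1].

Lemma measurable_regular : measurable regular.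
Proof.
apply: bigcapT_measurable => j; apply: bigcupT_measurable => N.
apply: bigcap_measurable => [|k _]; first by exists 0%N.
rewrite (_ : [set p | _] = grid_jump N k @^-1` `]-oo, j.+1%:R^-1[); last first.
  by apply/seteqP; split=> p; rewrite /= in_itv.
apply: measurable_preim => //; apply: measurable_funB; exact: (measurable_killed stableX hX).
Qed.

(** Almost every [x] satisfies the bound on increments for all grid levels, which are countably
    many. Then [cut_vanishes] makes the grid jumps near each [c0] small, and compactness of [[0, 1]]
    yields one mesh for all of them. *)
Lemma regular_section t : leb (xsection (~` regular) t) = 0%E.
Proof.
have [t0|t0] := ltP 0 t; last first.
  rewrite (_ : xsection _ t = set0) ?measure0// -subset0 => x.
  rewrite /xsection/= inE; apply => j _; exists 0%N => // k _ /=.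
  by rewrite /grid_jump /killed/= (ltNge 0 t) t0/= subrr.
have u0 : 0 < t / 2 by rewrite divr_gt0.
have [p [mp p0 pE]] := process_density u0.
have tE : t = t / 2 + t / 2 by rewrite -splitr.
have mreg : measurable (xsection (~` regular) t).
  by apply: measurable_xsection; apply: measurableC; exact: measurable_regular.
apply/negligibleP => //.
have ae1 : {ae @leb R, forall x (N k : nat), ((killed h (k.+1%:R / N.+1%:R)%R (t, x))%:E <=
    (killed h (k%:R / N.+1%:R)%R (t, x))%:E +
    (split_density u0 p (early_sup (k%:R / N.+1%:R)%R (k.+1%:R / N.+1%:R)%R) x +
     split_density u0 p (late_sup (k%:R / N.+1%:R)%R (k.+1%:R / N.+1%:R)%R) x))%E}.
  apply/ae_foralln => N; apply/ae_foralln => k.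
  have kk : k%:R / N.+1%:R <= k.+1%:R / N.+1%:R :> R by rewrite ler_pM2r// ler_nat.
  by have := killed_increment u0 mp p0 pE kk; rewrite -splitr.
have [N0 [mN0 N00 subN0]] := filterI ae1 (split_density_finite u0 mp p0 pE).
exists N0; split => // x; rewrite /xsection/= inE => nreg.
apply: contrapT => xN0.
have [inc fin] := contrapT (fun nx => xN0 (subN0 x nx)).
apply: nreg => j _ /=.
have j0 := i0 j.
have /compact_near_coveringP := @segment_compact R 0 1.
move=> /(_ nat \oo (fun N c => forall k : nat, (k <= N)%N -> `|c - k%:R / N.+1%:R| <= N.+1%:R^-1 ->
  grid_jump N k (t, x) < j.+1%:R^-1)).
case.
- move=> c0 _.
  have [m Hm] := cut_vanishes mp p0 c0 fin j0.
  (* A quarter for the distance to [c0] and a quarter for the mesh keep both ends of a grid cell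
     within [1 / (m + 1)] of [c0]. *)
  have m4 : 0 < (m.+1%:R^-1 : R) / 4 by rewrite divr_gt0.
  exists (ball c0 (m.+1%:R^-1 / 4), [set N | N.+1%:R^-1 < m.+1%:R^-1 / 4 :> R]).
    by split => /=; [exact: nbhsx_ballx|exact: near_inv_lt].
  move=> [c N] /= [cc0 N4] k kN ck.
  have kS : k.+1%:R / N.+1%:R = k%:R / N.+1%:R + N.+1%:R^-1 :> R by rewrite -natr1 mulrDl mul1r.
  have [h1 h2] : c0 - m.+1%:R^-1 <= k%:R / N.+1%:R /\ k.+1%:R / N.+1%:R <= c0 + m.+1%:R^-1.
    by rewrite kS; apply: shell_bound ck N4.
  rewrite /grid_jump -lte_fin EFinB lteBlDr//; apply: le_lt_trans (inc N k) _.
  by rewrite addeC lteD2rE//; exact: Hm.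
move=> N _ HN; exists N => // k /= kN.
have k1 : `[0, 1]%classic (k%:R / N.+1%:R : R).
  by rewrite /= in_itv/= divr_ge0//= ler_pdivrMr// mul1r ler_nat ltnW.
by apply: (HN N (leqnn N) _ k1 k kN); rewrite subrr normr0 ltW.
Unshelve. all: by end_near. Qed.

End regularity.

(** * The joint law at the passage time *)

Section weighted_measure.
Context {d : measure_display} {T : measurableType d} {R : realType}.
Variables (mu : {measure set T -> \bar R}) (f : T -> \bar R).

(** The proofs [mf] and [f0] are arguments so that the measure structure can be attached to the set
    function. *)
Definition weighted (mf : measurable_fun setT f) (f0 : forall x, (0 <= f x)%E) (A : set T) : \bar R :=
  (\int[mu]_(x in A) f x)%E.

Hypotheses (mf : measurable_fun setT f) (f0 : forall x, (0 <= f x)%E).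

Let weighted0 : weighted mf f0 set0 = 0%E. Proof. exact: integral_set0. Qed.

Let weighted_ge0 A : (0 <= weighted mf f0 A)%E. Proof. exact: integral_ge0. Qed.

Let weighted_sigma_additive : semi_sigma_additive (weighted mf f0).
Proof.
move=> F mF tF mUF; rewrite /weighted ge0_integral_bigcup//; last exact: measurable_funTS.
by apply: is_cvg_nneseries => n _ _; exact: integral_ge0.
Qed.

HB.instance Definition _ := isMeasure.Build _ _ _ (weighted mf f0)
  weighted0 weighted_ge0 weighted_sigma_additive.

End weighted_measure.

Section open_intervals.
Context {R : realType}.

Lemma measure_eq_open_intervals (m1 m2 : {measure set R -> \bar R}) :
  (m1 setT < +oo)%E -> (forall b1 b2, m1 `]b1, b2[%classic = m2 `]b1, b2[%classic) ->
  forall A, measurable A -> m1 A = m2 A.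
Proof.
move=> m1oo m12 A mA.
pose G := [set B : set R | exists b1 b2, B = `]b1, b2[%classic].
apply: (@finite_measure_unique _ _ _ G (fun n => `]- n%:R, n%:R[%classic)) mA => //.
- apply/seteqP; split.
    rewrite [X in X `<=` _](RGenInftyO.measurableE R); apply: smallest_sub.
      exact: smallest_sigma_algebra.
    move=> _ [c ->].
    rewrite (_ : `]-oo, c[%classic = \bigcup_n `]- n%:R, c[%classic); last first.
      apply/seteqP; split=> x /=; rewrite in_itv/=.
        move=> xc; exists (Num.truncn (- x)).+1 => //=; rewrite in_itv/= xc andbT.
        by rewrite ltrNl truncnS_gt.
      by move=> [n _]; rewrite /= in_itv/= => /andP[].
    apply: sigma_algebra_bigcup => n; apply: sub_sigma_algebra; by exists (- n%:R), c.
  apply: smallest_sub; first exact: sigma_algebra_measurable.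
  by move=> _ [b1 [b2 ->]]; exact: measurable_itv.
- move=> _ _ [a1 [a2 ->]] [b1 [b2 ->]]; exists (Num.max a1 b1), (Num.min a2 b2).
  apply/seteqP; split=> x /=; rewrite !in_itv/= gt_max lt_min.
    by move=> [/andP[-> ->] /andP[-> ->]].
  by move=> /andP[/andP[-> ->] /andP[-> ->]].
- by move=> n; exists (- n%:R), n%:R.
- apply/seteqP; split=> // x _; exists (Num.truncn `|x|).+1 => //=.
  by rewrite in_itv/= -ltr_norml truncnS_gt.
- by move=> _ [b1 [b2 ->]]; exact: m12.
Qed.

End open_intervals.

Section joint_law.
Context {d : measure_display} {T : measurableType d} {R : realType}.
Variables (P : probability T R) (alpha : R) (X : R -> {RV P >-> R}) (h : R -> R -> R -> R).
Hypothesis alpha12 : 1 < alpha < 2.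
Hypothesis stableX : stable_process alpha X.
Hypothesis laplaceX : forall t q : R, 0 < t -> 0 <= q ->
  ('E_P[fun w => expR (- q * X t w)] = (expR (t * q `^ alpha))%:E)%E.
Hypothesis hX : is_killed_density X h.
Implicit Types (a s t u c x y z : R) (w : T) (B : set R) (p : R * R).

Variable C : R.
Hypothesis C0 : 0 <= C.
Hypothesis C_rate : forall e : nat -> R,
  (forall n, 0 < e n) -> e n @[n --> \oo] --> 0 -> tail_rate X (e n) @[n --> \oo] --> C.

Let levyX : levy_process X. Proof. by case: stableX. Qed.
Let mX t : measurable_fun setT (X t). Proof. exact: measurable_funPT. Qed.

Let tau := passage_time X 1.
Let U := pre_passage X 1.
Let D := passage_jump X 1.
Let SL := pre_passage_sup X 1.

(* [C] is the limit of [P (X_e > 3) / e], whence the factor [3 `^ alpha]. *)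
Definition jump_rate z x : R := C * 3 `^ alpha * (Num.max z (1 - x)) `^ (- alpha).

Lemma jump_rate_ge0 z x : 0 <= jump_rate z x.
Proof. by rewrite !mulr_ge0// powR_ge0. Qed.

Lemma measurable_jump_rate z : measurable_fun setT (jump_rate z).
Proof.
apply: measurable_funM; first exact: measurable_cst.
apply: (measurableT_comp (f := fun x => x `^ (- alpha)) (measurable_powR (- alpha))).
apply: measurable_maxr; first exact: measurable_cst.
by apply: measurable_funB.
Qed.

Definition plane : {measure set (R * R) -> \bar R} := (@leb R \x @leb R)%E.

Definition jump_density z c p : \bar R := (jump_rate z p.2 * killed h c p)%:E.

Lemma jump_density_ge0 z c p : (0 <= jump_density z c p)%E.
Proof. by rewrite lee_fin mulr_ge0 ?jump_rate_ge0// (killed_ge0 hX). Qed.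

Lemma measurable_jump_density z c : measurable_fun setT (jump_density z c).
Proof.
apply/measurable_EFinP; apply: measurable_funM; last exact: (measurable_killed stableX hX).
exact: (measurableT_comp (measurable_jump_rate z)).
Qed.

Lemma killed_integral t c (g : R -> \bar R) : 0 < t ->
  measurable_fun setT g -> (forall x, (0 <= g x)%E) ->
  (\int[P]_w (g (X t w) * (\1_[set w | (run_sup X t w <= c)%R] w)%:E) =
   \int[leb]_x (g x * (killed h c (t, x))%:E))%E.
Proof.
move=> t0 mg g0.
have mS : measurable [set w | run_sup X t w <= c].
  rewrite (_ : [set _ | _] = run_sup X t @^-1` `]-oo, c]); last first.
    by apply/seteqP; split=> w; rewrite /= in_itv.
  by apply: measurable_preim => //; apply: (measurable_S stableX); exact: ltW.
have m1S : measurable_fun setT (fun w => (\1_[set w | (run_sup X t w <= c)%R] w)%:E : \bar R).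
  by apply/measurable_EFinP; exact: measurable_indic.
have mgX : measurable_fun setT (g \o X t) by exact: measurableT_comp.
rewrite -(density_integral (mu := P) (nu := mrestr P mS) (g := g \o X t) m1S)//.
- transitivity (\int[law (mrestr P mS) (mX t)]_x g x)%E.
    by rewrite ge0_integral_pushforward.
  apply: density_integral => //.
  + apply/measurable_EFinP; apply: (measurableT_comp (measurable_killed stableX hX c)).
    by apply: measurable_fun_pair.
  + by move=> x; rewrite lee_fin (killed_ge0 hX).
  + rewrite lawE /mrestr; apply: le_lt_trans (ltry 1); apply: probability_le1.
    by apply: measurableI => //; exact: measurable_preim.
  + move=> B mB; rewrite lawE /mrestr.
    exact: (killed_measure alpha12 stableX laplaceX hX).
- rewrite /mrestr; apply: le_lt_trans (ltry 1); apply: probability_le1.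
  exact: measurableI.
- by move=> A mA; rewrite /mrestr integral_indic// setIC.
- by move=> w; exact: g0.
Qed.

(** At each fixed time the integral over sample points becomes an integral over positions, with
    density [killed]. *)
Lemma passage_density_plane a b1 b2 z c : 0 <= a -> 0 < z ->
  passage_density alpha X C a b1 b2 z c 1 =
  (\int[plane]_(p in `]-oo, a]%classic `*` `]b1, b2[%classic) jump_density z c p)%E.
Proof.
move=> a0 z0.
have mK := measurable_kern stableX C z 1.
rewrite /passage_density fubini_tonelli1; last 2 first.
- apply/measurable_EFinP; apply: measurable_funM; last exact: mK.
  by apply: measurable_indic; exact: measurable_start_region.
- by move=> p; rewrite lee_fin mulr_ge0// !mulr_ge0// powR_ge0.
have mA : measurable (`]-oo, a]%classic `*` `]b1, b2[%classic) by exact: measurableX.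
rewrite [RHS]integral_mkcond.
rewrite [RHS]fubini_tonelli1; last 2 first.
- by apply/(measurable_restrictT _ _).1 => //; apply: measurable_funTS; exact: measurable_jump_density.
- by move=> p; apply: erestrict_ge0 => q _; exact: jump_density_ge0.
apply: ge0_ae_eq_integral => //.
- apply: measurable_fun_fubini_tonelli_F; last first.
    by move=> p; rewrite lee_fin mulr_ge0// !mulr_ge0// powR_ge0.
  apply/measurable_EFinP; apply: measurable_funM; last exact: mK.
  by apply: measurable_indic; exact: measurable_start_region.
- apply: measurable_fun_fubini_tonelli_F; last first.
    by move=> p; apply: erestrict_ge0 => q _; exact: jump_density_ge0.
  by apply/(measurable_restrictT _ _).1 => //; apply: measurable_funTS; exact: measurable_jump_density.
- by move=> t _; apply: integral_ge0 => w _; rewrite lee_fin mulr_ge0// !mulr_ge0// powR_ge0.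
- by move=> t _; apply: integral_ge0 => x _; apply: erestrict_ge0 => q _; exact: jump_density_ge0.
(* At time 0 the start region need not be empty, while [killed] is 0 by definition. *)
exists [set 0]; split => //; first exact: lebesgue_measure_set1.
move=> t /= /not_implyP[_ neq]; apply: contrapT => /eqP tn0; apply: neq.
rewrite /fubini_F/=.
have [t0|t0] := ltP 0 t; last first.
  rewrite integral0_eq; last first.
    move=> w _; rewrite indicE memNset ?mul0r// => -[/= /andP[t0' _] _ _].
    by move: tn0; rewrite eq_le t0 t0'.
  rewrite integral0_eq// => x _; rewrite epatch_indic /jump_density /killed/= ltNge t0/=.
  by rewrite mulr0 mul0e.
have [ta|ta] := leP t a; last first.
  rewrite integral0_eq; last first.
    by move=> w _; rewrite indicE memNset ?mul0r// => -[/= /andP[_]]; rewrite leNgt ta.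
  rewrite integral0_eq// => x _; rewrite patchE memNset//.
  by move=> [/=]; rewrite in_itv/= leNgt ta.
pose g x := ((\1_(`]b1, b2[%classic) x * jump_rate z x)%:E : \bar R).
transitivity (\int[P]_w (g (X t w) * (\1_[set w | (run_sup X t w <= c)%R] w)%:E))%E.
  apply: eq_integral => w _; rewrite /g -EFinM mulrAC; congr (_%:E).
  rewrite /kern /jump_rate /position/= (max_l (ltW t0)); congr (_ * _).
  rewrite !indicE -natrM mulnb; congr (_%:R); congr nat_of_bool.
  apply/idP/idP => [/set_mem[]|/andP[/set_mem + /set_mem]].
    rewrite /position_sup /position/= (max_l (ltW t0)) => _ Sc Xb.
    by rewrite !mem_set//= in_itv.
  rewrite /= in_itv/= => Xb Sc; rewrite mem_set//; split => /=; rewrite ?ta ?(ltW t0)//.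
    by rewrite /position_sup/= (max_l (ltW t0)).
  by rewrite /position/= (max_l (ltW t0)).
rewrite killed_integral//; last 2 first.
- apply/measurable_EFinP; apply: measurable_funM; last exact: measurable_jump_rate.
  exact: measurable_indic.
- by move=> x; rewrite lee_fin mulr_ge0// jump_rate_ge0.
apply: eq_integral => x _; rewrite epatch_indic /= /g /jump_density -!EFinM; congr (_%:E).
rewrite -mulrA mulrC; congr (_ * _).
rewrite !indicE; congr (_%:R); congr nat_of_bool.
apply/idP/idP => [/set_mem xb|/set_mem[]//= _ xb]; last by rewrite mem_set.
by rewrite mem_set//; split => //=; rewrite in_itv.
Qed.

Let mtau : measurable_fun setT tau. Proof. exact: measurable_passage_time1. Qed.
Let mU : measurable_fun setT U. Proof. exact: measurable_pre_passage1. Qed.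
Let mD : measurable_fun setT D. Proof. exact: measurable_passage_jump1. Qed.
Let mSL : measurable_fun setT SL. Proof. exact: measurable_pre_passage_sup1. Qed.

Definition passage_point w : R * R := (fine (passage_time X 1 w), pre_passage X 1 w).

Lemma measurable_passage_point : measurable_fun setT passage_point.
Proof.
apply: measurable_fun_pair; last exact: mU.
exact: (measurableT_comp (fine_measurable measurableT) mtau).
Qed.

Definition jumping z c : set T :=
  [set w | [/\ (passage_time X 1 w < +oo)%E, z < passage_jump X 1 w & pre_passage_sup X 1 w <= c]].

Lemma measurable_jumping z c : measurable (jumping z c).
Proof.
rewrite (_ : jumping z c = tau @^-1` `]-oo, +oo%E[ `&` (D @^-1` `]z, +oo[ `&` SL @^-1` `]-oo, c])).
  apply: measurableI; first by apply: measurable_preim => //; exact: emeasurable_itv.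
  by apply: measurableI; exact: measurable_preim.
by apply/seteqP; split=> w; rewrite /jumping/= !in_itv/= andbT; [move=> []|move=> [? []]].
Qed.

Lemma joint_law (A : set (R * R)) z c : measurable A -> 0 < z -> c <= 1 ->
  P (passage_point @^-1` A `&` jumping z c) = (\int[plane]_(p in A) jump_density z c p)%E.
Proof.
move=> mA z0 c1; have mJ := measurable_jumping z c.
(* [passage_half] bounds the time by a ray, and [measure_eq_rect_rays] expects rays in the second
   coordinate. *)
pose sw (p : R * R) := (p.2, p.1).
have msw : measurable_fun setT sw by exact: measurable_swap.
pose m1 := law (mrestr P mJ) measurable_passage_point.
pose m2 : {measure set (R * R) -> \bar R} :=
  weighted plane (measurable_jump_density z c) (jump_density_ge0 z c).
suff H (B : set (R * R)) : measurable B -> law m1 msw B = law m2 msw B.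
  have mB : measurable (sw @^-1` A) by exact: measurable_preim.
  have E : P (passage_point @^-1` (sw @^-1` (sw @^-1` A)) `&` jumping z c) =
    m2 (sw @^-1` (sw @^-1` A)) by exact: (H _ mB).
  transitivity (P (passage_point @^-1` (sw @^-1` (sw @^-1` A)) `&` jumping z c)).
    by congr (P (_ `&` _)); apply/seteqP; split=> w /=; case: passage_point.
  rewrite E /m2/= /weighted; congr integral.
  by apply/seteqP; split=> -[].
have m1oo (B1 : set (R * R)) : measurable B1 -> (m1 B1 < +oo)%E.
  move=> mB'; rewrite /m1 lawE /mrestr; apply: le_lt_trans (ltry 1); apply: probability_le1.
  by apply: measurableI => //; apply: measurable_preim => //; exact: measurable_passage_point.
apply: measure_eq_rect_rays => [|B' a mB'].
  by rewrite lawE; apply: m1oo; exact: measurable_preim.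
have mS : measurable (`]-oo, a]%classic `*` [set: R]) by exact: measurableX.
have E (m : {measure set (R * R) -> \bar R}) K :
    law (mrestr m mS) measurable_snd K = law m msw (K `*` `]-oo, a]%classic).
  transitivity (m (snd @^-1` K `&` (`]-oo, a]%classic `*` setT))) => //.
  transitivity (m (sw @^-1` (K `*` `]-oo, a]%classic))) => //.
  congr (m _); apply/seteqP; split=> -[x y] /=; first by move=> [? []].
  by move=> [].
(* With the time confined to a ray, the law of the position is determined by the open intervals of
   [passage_half]. *)
rewrite -!E; apply: measure_eq_open_intervals mB'.
  by rewrite E lawE; apply: m1oo; apply: measurable_preim => //; exact: measurableX.
move=> b1 b2; rewrite !E.
transitivity (P (passage_point @^-1` (sw @^-1` (`]b1, b2[%classic `*` `]-oo, a]%classic)) `&` jumping z c)) => //.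
transitivity (\int[plane]_(p in sw @^-1` (`]b1, b2[%classic `*` `]-oo, a]%classic)) jump_density z c p)%E => //.
have -> : sw @^-1` (`]b1, b2[%classic `*` `]-oo, a]%classic) = `]-oo, a]%classic `*` `]b1, b2[%classic.
  by apply/seteqP; split=> -[x y] /= [].
have [a0|a0] := leP 0 a; last first.
  rewrite (_ : _ `&` _ = set0).
    rewrite measure0 integral0_eq// => -[t x] [/=]; rewrite in_itv/= => ta _.
    by rewrite /jump_density /killed/= ltNge (le_trans ta (ltW a0)) mulr0.
  rewrite -subset0 => w [[/=]]; rewrite in_itv/= => ta _ [].
  have := passage_time_ge0 (fun t => X t) w 1.
  case: passage_time ta => [r /= ra| |]//; rewrite lee_fin => r0.
  by have := lt_le_trans a0 (le_trans r0 ra); rewrite ltxx.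
rewrite -passage_density_plane// -(passage_half_measure alpha12 stableX laplaceX C0 C_rate)//.
congr (P _); apply/seteqP; split=> w.
  move=> [[/=]]; rewrite !in_itv/= => ta Ub [tf Dz Sc]; split => //.
  have := passage_time_ge0 (fun t => X t) w 1.
  by case: passage_time ta tf => [r| |]//=; rewrite lee_fin.
move=> [ta Ub Dz Sc]; split; last by split => //; exact: le_lt_trans ta (ltry a).
split; rewrite /= in_itv//=.
have := passage_time_ge0 (fun t => X t) w 1.
by case: passage_time ta => [r| |]//=; rewrite lee_fin.
Qed.

End joint_law.

(** * The conditional kernel *)

Section uniform_law.
Context {R : realType}.

Definition unif : set R -> \bar R := mrestr (@leb R) (measurable_itv `[0%R, 1%R]).

HB.instance Definition _ := Measure.on unif.

Let unif_setT : unif setT = 1%E.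
Proof.
rewrite /unif /mrestr setTI; apply: (etrans (lebesgue_measure_itv _)).
by rewrite /= lte_fin ltr01 -EFinB subr0.
Qed.

HB.instance Definition _ := Measure_isProbability.Build _ _ _ unif unif_setT.

(** Only the values in []0, 1[] matter, so that the maps below need no control at the end points,
    where powers take default values. *)
Lemma unif_initial (q : R) (A : set R) : 0 <= q <= 1 ->
  (forall v, 0 < v < 1 -> (A v <-> v < q)) -> measurable A -> unif A = q%:E.
Proof.
move=> /andP[q0 q1] HA mA.
have lq : leb `]0, q[%classic = q%:E.
  apply: (etrans (lebesgue_measure_itv _)); rewrite /= lte_fin; case: ltP => [_|h].
    by rewrite -EFinB subr0.
  by congr (_%:E); apply/eqP; rewrite eq_le q0 h.
rewrite -lq /unif /mrestr.
have l01 : leb ([set 0; 1] : set R) = 0%E.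
  apply/eqP; rewrite eq_le measure_ge0 andbT.
  apply: le_trans (measureU2 _ _ _) _; [exact: measurable_set1|exact: measurable_set1|].
  rewrite [X in (X + _)%E](_ : _ = 0%E); last exact: lebesgue_measure_set1.
  by rewrite [X in (_ + X)%E](_ : _ = 0%E) ?adde0//; exact: lebesgue_measure_set1.
have m01 : measurable ([set 0; 1] : set R) by apply: measurableU; exact: measurable_set1.
apply/eqP; rewrite eq_le; apply/andP; split.
  apply: (@le_trans _ _ (leb (`]0, q[%classic `|` [set 0; 1]))).
    apply: measure_le; [exact: measurableI|exact: measurableU|].
    move=> v [Av]; rewrite /= in_itv/= => /andP[v0 v1].
    have [e0|n0] := eqVneq v 0; first by right; left.
    have [e1|n1] := eqVneq v 1; first by right; right.
    have v01 : 0 < v < 1 by rewrite !lt_neqAle v0 v1 n1 eq_sym n0.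
    by left; rewrite in_itv/=; case/andP: (v01) => -> _ /=; apply/HA.
  exact: measureU_le.
apply: measure_le; [exact: measurable_itv|exact: measurableI|].
move=> v; rewrite /= in_itv/= => /andP[v0 vq].
have v1 := lt_le_trans vq q1.
by split; [apply/HA; rewrite ?v0|rewrite in_itv/= !ltW].
Qed.

Definition unif2 : probability (R * R)%type R := (unif \x unif)%E.

Lemma unif2X (A B : set R) : measurable A -> measurable B -> unif2 (A `*` B) = (unif A * unif B)%E.
Proof. by move=> mA mB; exact: product_measure1E. Qed.

End uniform_law.

Section conditional_kernel.
Context {d : measure_display} {T : measurableType d} {R : realType}.
Variables (P : probability T R) (alpha : R) (X : R -> {RV P >-> R}) (h : R -> R -> R -> R).
Hypothesis alpha12 : 1 < alpha < 2.
Hypothesis stableX : stable_process alpha X.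
Hypothesis hX : is_killed_density X h.
Implicit Types (a s t u c x v z : R) (w : T) (B : set R) (p : R * R) (y : \bar R * R).

Let alpha0 : 0 < alpha. Proof. by case/andP: alpha12 => /(lt_trans _)->. Qed.

Local Notation kil := (killed h).

(** The generalised inverse of the distribution function [r |-> killed r p / killed 1 p] on
    [[0, 1]], written without division; the element 0 keeps the set nonempty. *)
Definition quantile p v : R :=
  sup [set r | r = 0 \/ (0 <= r <= 1 /\ kil r p < v * kil 1 p)].

Lemma quantile_le p v c :
  quantile p v <= c <-> 0 <= c /\ (forall r, 0 <= r <= 1 -> c < r -> v * kil 1 p <= kil r p).
Proof.
rewrite /quantile; set E := [set r | _].
have E0 : E !=set0 by exists 0; left.
have Eub : has_ubound E by exists 1 => r [->//|[/andP[]]].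
split=> [qc|[c0 H]].
  split; first by apply: le_trans qc; apply: ub_le_sup => //; left.
  move=> r r01 cr; rewrite leNgt; apply/negP => kr; move: cr; apply/negP; rewrite -leNgt.
  by apply: le_trans qc; apply: ub_le_sup => //; right.
apply: ge_sup => // r [->//|[r01 kr]]; rewrite leNgt; apply/negP => /(H _ r01).
by rewrite leNgt kr.
Qed.

Let level c n : R := c + (1 - c) / n.+1%:R.

Let level_gt c n : c < 1 -> c < level c n.
Proof. by move=> c1; rewrite ltrDl divr_gt0// subr_gt0. Qed.

Let level_le c n : c < 1 -> level c n <= 1.
Proof.
by move=> c1; rewrite /level -lerBrDl ler_pdivrMr// ler_peMr ?ler1n// subr_ge0 ltW.
Qed.

(** Monotonicity in the level reduces the condition on all [r > c] to a sequence decreasing to [c],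
    which gives measurability. *)
Lemma quantile_le_level p v c : 0 <= c < 1 ->
  quantile p v <= c <-> forall n, v * kil 1 p <= kil (level c n) p.
Proof.
move=> /andP[c0 c1]; rewrite quantile_le; split=> [[_ H] n|H].
  by apply: H; [rewrite level_le// andbT (le_trans c0)// ltW ?level_gt|exact: level_gt].
split=> // r /andP[r0 r1] cr.
have rc : 0 < (r - c) / (1 - c) by rewrite divr_gt0// subr_gt0.
have [n _ /(_ n (leqnn n))/= nr] := near_inv_lt rc.
apply: le_trans (H n) _; apply: (killed_le stableX hX).
rewrite /level -lerBrDl mulrC -ler_pdivlMr ?subr_gt0//; exact: ltW.
Qed.

Lemma measurable_quantile : measurable_fun setT (fun q : (R * R) * R => quantile q.1 q.2).
Proof.
apply: (measurability _ measurable_rays) => _ [_ [c ->] <-]; rewrite setTI.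
have [c0|c0] := ltP c 0.
  rewrite (_ : _ @^-1` _ = set0)// -subset0 => q /=; rewrite in_itv/= => /quantile_le[].
  by rewrite leNgt c0.
have [c1|c1] := leP 1 c.
  rewrite (_ : _ @^-1` _ = setT)//; apply/seteqP; split=> // q _ /=; rewrite in_itv/=.
  by apply/quantile_le; split=> // r /andP[_ r1] cr; have := le_lt_trans c1 cr; rewrite ltNge r1.
rewrite (_ : _ @^-1` _ = \bigcap_n [set q : (R * R) * R | q.2 * kil 1 q.1 <= kil (level c n) q.1]).
  apply: bigcapT_measurable => n.
  have mk c' : measurable_fun setT (fun q : (R * R) * R => kil c' q.1).
    exact: (measurableT_comp (measurable_killed stableX hX c')).
  rewrite (_ : [set q | _] =
    (fun q : (R * R) * R => kil (level c n) q.1 - q.2 * kil 1 q.1) @^-1` `[0, +oo[).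
    apply: measurable_preim => //; apply: measurable_funB; first exact: mk.
    by apply: measurable_funM => //; exact: mk.
  by apply/seteqP; split=> q; rewrite /= in_itv/= andbT subr_ge0.
have c01 : 0 <= c < 1 by rewrite c0.
apply/seteqP; split=> q /=; rewrite in_itv/=.
  by move=> /(quantile_le_level _ _ c01) H n _; exact: H.
by move=> H; apply/(quantile_le_level _ _ c01) => n; exact: H.
Qed.

(** The points at which the quotient [h_c / h_1] makes sense and is a continuous distribution
    function in [c]. *)
Definition good : set (R * R) := [set p | 0 < kil 1 p] `&` regular h.

Lemma measurable_good : measurable good.
Proof.
apply: measurableI; last exact: (measurable_regular stableX hX).
rewrite (_ : [set p | _] = kil 1 @^-1` `]0, +oo[); last first.
  by apply/seteqP; split=> q; rewrite /= in_itv/= andbT.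
by apply: measurable_preim => //; exact: (measurable_killed stableX hX).
Qed.

Lemma good_domain t x : good (t, x) -> 0 < t /\ x < 1.
Proof. by move=> [+ _]; rewrite /= /killed; case: ifP => [/and3P[]//|]; rewrite ltxx. Qed.

(** [c] lies in a grid cell over which [killed] grows by less than [e], and the levels decreasing to
    [c] end up in that cell. *)
Lemma regular_right_continuous p c e : regular h p -> 0 <= c < 1 -> 0 < e ->
  exists n, kil (level c n) p - kil c p < e.
Proof.
move=> rp /andP[c0 c1] e0.
have [j _ /(_ j (leqnn j))/= je] := near_inv_lt e0.
have [N _ HN] := rp j I.
pose k := Num.truncn (c * N.+1%:R).
have cN0 : 0 <= c * N.+1%:R by rewrite mulr_ge0.
have /andP[k1 k2] := truncn_itv cN0.
have kN : (k <= N)%N.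
  rewrite -ltnS -(ltr_nat R); apply: le_lt_trans k1 _.
  by rewrite gtr_pMl.
have := HN k kN; rewrite /= /grid_jump => jump.
have cl : k%:R / N.+1%:R <= c by rewrite ler_pdivrMr.
have cr : c < k.+1%:R / N.+1%:R by rewrite ltr_pdivlMr.
have rc : 0 < (k.+1%:R / N.+1%:R - c) / (1 - c) by rewrite divr_gt0// subr_gt0.
have [n _ /(_ n (leqnn n))/= nr] := near_inv_lt rc.
exists n; apply: le_lt_trans (lt_trans jump je).
apply: lerB; apply: (killed_le stableX hX) => //.
rewrite /level -lerBrDl mulrC -ler_pdivlMr ?subr_gt0//; exact: ltW.
Qed.

Lemma quantile_law p c : good p ->
  unif [set v | quantile p v <= c] = (kil (Num.min c 1) p / kil 1 p)%:E.
Proof.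
move=> [/= k0 rp].
have mA : measurable [set v | quantile p v <= c].
  rewrite (_ : [set v | _] = (fun v => quantile p v) @^-1` `]-oo, c]); last first.
    by apply/seteqP; split=> v; rewrite /= in_itv.
  apply: measurable_preim => //.
  exact: (measurableT_comp measurable_quantile (measurable_pair1 p)).
have [c0|c0] := ltP c 0.
  rewrite (_ : [set v | _] = set0).
    rewrite measure0 (_ : kil _ p = 0) ?mul0r//.
    by rewrite /killed lt_min (ltNge 0 c) (ltW c0) /= andbF.
  by rewrite -subset0 => v /quantile_le[]; rewrite leNgt c0.
have [c1|c1] := leP 1 c.
  rewrite divff ?lt0r_neq0// (_ : [set v | _] = setT) ?probability_setT//.
  apply/seteqP; split=> // v _; apply/quantile_le; split=> // r /andP[_ r1] cr.
  by have := le_lt_trans c1 cr; rewrite ltNge r1.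
have c01 : 0 <= c < 1 by rewrite c0.
have kc0 := killed_ge0 hX c p.
have kc1 : kil c p <= kil 1 p by apply: (killed_le stableX hX); exact: ltW.
have E v : quantile p v <= c <-> v <= kil c p / kil 1 p.
  rewrite quantile_le_level// ler_pdivlMr//; split=> [H|H n]; last first.
    by apply: le_trans H _; apply: (killed_le stableX hX); apply: ltW; exact: level_gt.
  apply/ler_addgt0Pr => e e0; have [n Hn] := regular_right_continuous rp c01 e0.
  by apply: le_trans (H n) _; rewrite -lerBlDl ltW.
have q01 : 0 <= kil c p / kil 1 p <= 1.
  by apply/andP; split; [rewrite divr_ge0// ltW|rewrite ler_pdivrMr// mul1r].
have mset1 : measurable [set kil c p / kil 1 p] by exact: measurable_set1.
have mD : measurable ([set v | quantile p v <= c] `\` [set kil c p / kil 1 p]).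
  exact: measurableD.
(* The equivalence [E] has a weak inequality and [unif_initial] a strict one; the boundary point is
   removed as a null set. *)
transitivity (unif ([set v | quantile p v <= c] `\` [set kil c p / kil 1 p])).
  apply/eqP; rewrite eq_le; apply/andP; split; last by apply: measure_le.
  apply: (@le_trans _ _ (unif (([set v | quantile p v <= c] `\` [set kil c p / kil 1 p]) `|`
    [set kil c p / kil 1 p]))).
    apply: measure_le => //; first exact: measurableU.
    move=> v qv; have [->|vq] := eqVneq v (kil c p / kil 1 p); [by right|left].
    by split => //; apply/eqP.
  apply: measureU_le => //; apply/eqP; rewrite eq_le measure_ge0 andbT /unif /mrestr.
  apply: (@le_trans _ _ (leb [set kil c p / kil 1 p])).
    by apply: measure_le => //; exact: measurableI.
  by rewrite [X in (X <= _)%E](_ : _ = 0%E)//; exact: lebesgue_measure_set1.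
apply: unif_initial => // v v01; split=> [[/E + /eqP]|vq].
  by rewrite le_eqVlt => /orP[->|].
by split; [apply/E; exact: ltW|apply/eqP; rewrite lt_eqF].
Qed.

(** The inverse of the Pareto tail [v = ((1 - x) / z)^alpha], which turns a uniform variable into
    the jump. *)
Definition pareto_map x v : R := (1 - x) * v `^ (- alpha^-1).

Lemma measurable_pareto_map : measurable_fun setT (fun q : R * R => pareto_map q.1 q.2).
Proof.
apply: measurable_funM; first by apply: measurable_funB.
exact: (measurableT_comp (f := fun v => v `^ (- alpha^-1)) (measurable_powR (- alpha^-1))).
Qed.

Lemma pareto_map_law x z : x < 1 ->
  unif [set v | z < pareto_map x v] = (((1 - x) / Num.max z (1 - x)) `^ alpha)%:E.
Proof.
move=> x1; set m := 1 - x; have m0 : 0 < m by rewrite subr_gt0.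
set M := Num.max z m; have mM : m <= M by rewrite le_max lexx orbT.
have M0 : 0 < M := lt_le_trans m0 mM.
have mA : measurable [set v | z < pareto_map x v].
  rewrite (_ : [set v | _] = (fun v => pareto_map x v) @^-1` `]z, +oo[); last first.
    by apply/seteqP; split=> v; rewrite /= in_itv/= andbT.
  apply: measurable_preim => //.
  exact: (measurableT_comp measurable_pareto_map (measurable_pair1 x)).
have q1 : (m / M) `^ alpha <= 1.
  have e1 : 1 = 1 `^ alpha :> R by rewrite powR1.
  rewrite [leRHS]e1; apply: ge0_ler_powR; rewrite ?nnegrE//; first exact: ltW.
    by rewrite divr_ge0// ltW.
  by rewrite ler_pdivrMr// mul1r.
apply: unif_initial => //; first by rewrite powR_ge0.
move=> v /andP[v0 v1]; rewrite /= /pareto_map -/m powRN; set s := v `^ alpha^-1.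
have s0 : 0 < s by exact: powR_gt0.
have vs : v = s `^ alpha by rewrite -powRrM mulVf ?lt0r_neq0// powRr1// ltW.
have s1 : s < 1.
  have e1 : 1 = 1 `^ alpha^-1 :> R by rewrite powR1.
  by rewrite [ltRHS]e1; apply: gt0_ltr_powR; rewrite ?invr_gt0// ?nnegrE// ltW.
have -> : (z < m / s) = (M < m / s).
  by rewrite gt_max [X in _ && X]ltr_pdivlMr// gtr_pMr// s1 andbT.
rewrite ltr_pdivlMr// mulrC -ltr_pdivlMr// vs.
have mM0 : 0 <= m / M by rewrite divr_ge0// ltW.
split=> [h1|]; first by apply: gt0_ltr_powR; rewrite ?nnegrE// ltW.
apply: contraTT; rewrite -!leNgt => h1.
by apply: ge0_ler_powR; rewrite ?nnegrE//; exact: ltW.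
Qed.

(* Off [good] the value is (0, 1) if the level is passed and (0, 0) if it is
   never passed: this is almost surely what the two variables are there. *)
Definition kernel_map (q : (\bar R * R) * (R * R)) : R * R :=
  let: (y, v) := q in let p := (fine y.1, y.2) in
  (\1_good p * pareto_map y.2 v.1,
   \1_good p * quantile p v.2 + \1_(~` good) p * \1_[set y' : \bar R * R | (y'.1 < +oo)%E] y).

Lemma measurable_kernel_map : measurable_fun setT kernel_map.
Proof.
rewrite (_ : kernel_map = fun q : (\bar R * R) * (R * R) =>
  (\1_good (fine q.1.1, q.1.2) * pareto_map q.1.2 q.2.1,
   \1_good (fine q.1.1, q.1.2) * quantile (fine q.1.1, q.1.2) q.2.2 +
   \1_(~` good) (fine q.1.1, q.1.2) * \1_[set y' : \bar R * R | (y'.1 < +oo)%E] q.1)); last first.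
  by apply/funext => -[].
have mp : measurable_fun setT (fun q : (\bar R * R) * (R * R) => (fine q.1.1, q.1.2)).
  apply: measurable_fun_pair; last exact: (measurableT_comp measurable_snd).
  apply: (measurableT_comp (fine_measurable measurableT)).
  exact: (measurableT_comp measurable_fst).
have mg A : measurable A -> measurable_fun setT (fun q : (\bar R * R) * (R * R) => \1_A (fine q.1.1, q.1.2) : R).
  by move=> mA; exact: (measurableT_comp (measurable_indic mA)).
have mgood := measurable_good.
apply: measurable_fun_pair.
  apply: measurable_funM; first exact: mg.
  apply: (measurableT_comp measurable_pareto_map (g := fun q : (\bar R * R) * (R * R) => (q.1.2, q.2.1))).
  apply: measurable_fun_pair; first exact: (measurableT_comp measurable_snd).
  exact: (measurableT_comp measurable_fst).
apply: measurable_funD; apply: measurable_funM.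
- exact: mg.
- apply: (measurableT_comp measurable_quantile
    (g := fun q : (\bar R * R) * (R * R) => ((fine q.1.1, q.1.2), q.2.2))).
  by apply: measurable_fun_pair => //; exact: (measurableT_comp measurable_snd).
- by apply: mg; exact: measurableC.
- apply: (measurableT_comp (measurable_indic _)) => //.
  rewrite (_ : [set y' | _] = fst @^-1` `]-oo, +oo%E[); last first.
    by apply/seteqP; split=> y'; rewrite /= in_itv.
  by apply: measurable_preim => //; exact: emeasurable_itv.
Qed.

Lemma measurable_kernel_section y : measurable_fun setT (fun q : R * R => kernel_map (y, q)).
Proof. exact: (measurableT_comp measurable_kernel_map (measurable_pair1 y)). Qed.

Definition jump_kernel y : {measure set (R * R) -> \bar R} := law unif2 (measurable_kernel_section y).

Let measurable_jump_kernel A : measurable A -> measurable_fun setT (jump_kernel ^~ A).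
Proof.
move=> mA.
have mK : measurable (kernel_map @^-1` A) by apply: measurable_preim => //; exact: measurable_kernel_map.
rewrite (_ : jump_kernel ^~ A = unif2 \o xsection (kernel_map @^-1` A)).
  exact: measurable_fun_xsection.
apply/funext => y; rewrite /jump_kernel lawE /=; congr (unif2 _).
by apply/seteqP; split=> v; rewrite /xsection/= inE.
Qed.

HB.instance Definition _ := isKernel.Build _ _ _ _ _ jump_kernel measurable_jump_kernel.

Let jump_kernel_setT y : jump_kernel y setT = 1%E.
Proof. exact: probability_setT. Qed.

HB.instance Definition _ := Kernel_isProbability.Build _ _ _ _ _ jump_kernel jump_kernel_setT.

Definition jump_pkernel : R.-pker (\bar R * R)%type ~> (R * R)%type := jump_kernel.

Local Notation point y := (fine y.1, y.2).

Lemma kernel_map_good y (q : R * R) : good (point y) ->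
  kernel_map (y, q) = (pareto_map y.2 q.1, quantile (point y) q.2).
Proof.
move=> gy; rewrite /kernel_map !indicE mem_set// memNset; last exact.
by rewrite !mul1r mul0r addr0.
Qed.

Let mpareto x A : measurable A -> measurable (pareto_map x @^-1` A).
Proof.
move=> mA; apply: measurable_preim => //.
exact: (measurableT_comp measurable_pareto_map (measurable_pair1 x)).
Qed.

Let mquantile p A : measurable A -> measurable (quantile p @^-1` A).
Proof.
move=> mA; apply: measurable_preim => //.
exact: (measurableT_comp measurable_quantile (measurable_pair1 p)).
Qed.

(** On [good] the two coordinates are functions of different uniform variables, whence the
    conditional independence. *)
Lemma jump_kernelX y A B : good (point y) -> measurable A -> measurable B ->
  jump_kernel y (fst @^-1` A `&` snd @^-1` B) =
  (unif (pareto_map y.2 @^-1` A) * unif (quantile (point y) @^-1` B))%E.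
Proof.
move=> gy mA mB; rewrite -unif2X; [|exact: mpareto|exact: mquantile].
transitivity (unif2 ((fun q => kernel_map (y, q)) @^-1` (fst @^-1` A `&` snd @^-1` B))) => //.
have -> : (fun q : R * R => kernel_map (y, q)) =
    (fun q => (pareto_map y.2 q.1, quantile (point y) q.2)).
  by apply/funext => q; rewrite kernel_map_good.
by congr (unif2 _); apply/seteqP; split=> q [].
Qed.

Lemma jump_kernel_fst y A : good (point y) -> measurable A ->
  jump_kernel y (fst @^-1` A) = unif (pareto_map y.2 @^-1` A).
Proof.
move=> gy mA; have := jump_kernelX gy mA (@measurableT _ R).
by rewrite !preimage_setT setIT => ->; rewrite [X in (_ * X)%E]probability_setT mule1.
Qed.

Lemma jump_kernel_snd y B : good (point y) -> measurable B ->
  jump_kernel y (snd @^-1` B) = unif (quantile (point y) @^-1` B).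
Proof.
move=> gy mB; have := jump_kernelX gy (@measurableT _ R) mB.
by rewrite !preimage_setT setTI => ->; rewrite [X in (X * _)%E]probability_setT mul1e.
Qed.

Lemma jump_kernel_independent y : good (point y) -> independent (jump_kernel y) fst snd.
Proof. by move=> gy A B mA mB; rewrite jump_kernelX// jump_kernel_fst// jump_kernel_snd. Qed.

Lemma jump_kernel_cdf y c : good (point y) ->
  jump_kernel y (snd @^-1` `]-oo, c]) = (kil (Num.min c 1) (point y) / kil 1 (point y))%:E.
Proof.
by move=> gy; rewrite jump_kernel_snd// -quantile_law.
Qed.

Lemma pareto_map_ray x z : x < 1 ->
  unif (pareto_map x @^-1` `]z, +oo[) = (((1 - x) / Num.max z (1 - x)) `^ alpha)%:E.
Proof.
move=> x1; rewrite -pareto_map_law//; congr (unif _).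
by apply/seteqP; split=> v; rewrite /= in_itv/= andbT.
Qed.

Lemma jump_kernel_quadrant y z c : good (point y) ->
  jump_kernel y (fst @^-1` `]z, +oo[ `&` snd @^-1` `]-oo, c]) =
  (((1 - y.2) / Num.max z (1 - y.2)) `^ alpha * (kil (Num.min c 1) (point y) / kil 1 (point y)))%:E.
Proof.
move=> gy; have [_ y1] := good_domain gy.
by rewrite jump_kernelX// pareto_map_ray// EFinM -jump_kernel_cdf// jump_kernel_snd.
Qed.

Lemma pareto_map_ray_le x a : x < 1 ->
  unif (pareto_map x @^-1` `]-oo, a]) = (1 - ((1 - x) / Num.max a (1 - x)) `^ alpha)%:E.
Proof.
move=> x1; have mR := mpareto x (measurable_itv `]a, +oo[).
rewrite -setCitvr preimage_setC probability_setC//.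
by rewrite EFinB -pareto_map_ray.
Qed.

Lemma jump_kernel_pos y : good (point y) -> jump_kernel y (fst @^-1` `]-oo, 0]) = 0%E.
Proof.
move=> gy; have [_ y1] := good_domain gy; have m0 : 0 < 1 - y.2 by rewrite subr_gt0.
rewrite jump_kernel_fst// pareto_map_ray_le// max_r ?ltW// divff ?lt0r_neq0//.
by rewrite powR1 subrr.
Qed.

(** Above [m] the primitive is [- m^alpha z^(- alpha)]; below, the density vanishes. *)
Lemma pareto_integral m a : 0 < m ->
  (\int[leb]_(z in `]-oo, a]) (pareto_density alpha m z)%:E = (1 - (m / Num.max a m) `^ alpha)%:E)%E.
Proof.
move=> m0.
have pd0 z : z <= m -> pareto_density alpha m z = 0.
  by move=> zm; rewrite /pareto_density indicE memNset ?mulr0//= in_itv/= ltNge zm.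
have [am|ma] := leP a m.
  rewrite divff ?lt0r_neq0// powR1 subrr integral0_eq// => z /=; rewrite in_itv/= => za.
  by rewrite pd0// (le_trans za).
pose f z := alpha * m `^ alpha * z `^ (- alpha - 1).
pose F z := - (m `^ alpha) * z `^ (- alpha).
have dF z : 0 < z -> is_derive z 1 F (f z).
  move=> z0; have dp := is_derive1_powR (- alpha) z0.
  have -> : f z = - (m `^ alpha) *: (- alpha * z `^ (- alpha - 1)) by rewrite /f /GRing.scale/=; lra.
  exact: is_deriveZ.
have mf : measurable_fun setT (fun z => (pareto_density alpha m z)%:E).
  apply/measurable_EFinP; apply: measurable_funM; last exact: measurable_indic.
  apply: measurable_funM; first exact: measurable_cst.
  exact: (measurable_powR (- alpha - 1)).
have f0 z : 0 <= pareto_density alpha m z.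
  by rewrite /pareto_density !mulr_ge0 ?powR_ge0// ltW.
have cf z : 0 < z -> {for z, continuous f}.
  move=> z0; apply: cvgMr.
  have : derivable (fun x => x `^ (- alpha - 1)) z 1.
    by have [] := is_derive1_powR (- alpha - 1) z0.
  by move=> /derivable1_diffP/differentiable_continuous.
rewrite ge0_integral_leb//; last 2 first.
- exact: measurable_funTS.
- by move=> z _; rewrite lee_fin f0.
transitivity (\int[lebesgue_measure]_(z in `]m, a]) (f z)%:E)%E.
  rewrite integral_mkcond [RHS]integral_mkcond; apply: eq_integral => z _.
  rewrite !patchE; case: (leP z m) => zm.
    rewrite [in RHS]memNset; last by rewrite /= in_itv/= ltNge zm.
    by case: ifP => // _; rewrite pd0.
  case: (leP z a) => za.
    rewrite !mem_set/= ?in_itv/= ?za ?zm//.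
    by rewrite /pareto_density indicE mem_set ?mulr1//= in_itv/= andbT.
  by rewrite !memNset//= in_itv/= leNgt za ?andbF.
have fc : {within `[m, a], continuous f}.
  apply: continuous_in_subspaceT => z; rewrite inE/= in_itv/= => /andP[mz _].
  by apply: cf; exact: lt_le_trans mz.
rewrite integral_itv_obnd_cbnd; last first.
  apply/measurable_EFinP; apply: (@measurable_funS _ _ _ _ `[m, a]%classic) => //.
    exact: subset_itv_oc_cc.
  exact: subspace_continuous_measurable_fun fc.
rewrite (continuous_FTC2 ma fc (F := F)).
- have a0 : 0 < a := lt_trans m0 ma.
  rewrite /F -EFinB; congr (_%:E).
  rewrite powRM ?invr_ge0 ?(ltW m0) ?(ltW a0)// -powR_inv1 ?(ltW a0)// -powRrM mulN1r.
  rewrite [m `^ (- alpha)]powRN mulNr mulNr divff ?lt0r_neq0 ?powR_gt0//.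
  by rewrite opprK addrC.
- have Fc z : 0 < z -> {for z, continuous F}.
    move=> z0; have [/derivable1_diffP/differentiable_continuous] := dF z z0; exact.
  split=> [z| |].
  + by rewrite in_itv/= => /andP[mz _]; have [] := dF z (lt_trans m0 mz).
  + by apply: cvg_at_right_filter; exact: Fc.
  + by apply: cvg_at_left_filter; apply: Fc; exact: lt_trans ma.
- by move=> z; rewrite in_itv/= => /andP[mz _]; have := dF z (lt_trans m0 mz) => -[_]; rewrite derive1E.
Qed.

Lemma jump_kernel_pareto y A : good (point y) -> measurable A ->
  jump_kernel y (fst @^-1` A) =
  (\int[lebesgue_measure]_(z in A) (pareto_density alpha (1 - y.2) z)%:E)%E.
Proof.
move=> gy mA; have [_ y1] := good_domain gy; have m0 : 0 < 1 - y.2 by rewrite subr_gt0.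
have mf : measurable_fun setT (fun z => (pareto_density alpha (1 - y.2) z)%:E).
  apply/measurable_EFinP; apply: measurable_funM; last exact: measurable_indic.
  apply: measurable_funM; first exact: measurable_cst.
  exact: (measurable_powR (- alpha - 1)).
have f0 z : (0 <= (pareto_density alpha (1 - y.2) z)%:E)%E.
  by rewrite lee_fin /pareto_density !mulr_ge0 ?powR_ge0// ltW.
rewrite -ge0_integral_leb//; last exact: measurable_funTS.
have mp : measurable_fun setT (pareto_map y.2).
  exact: (measurableT_comp measurable_pareto_map (measurable_pair1 y.2)).
transitivity (law unif mp A); first by rewrite jump_kernel_fst.
transitivity (weighted (@leb R) mf f0 A) => //.
apply: measure_eq_rays mA; first by rewrite lawE [X in (X < _)%E]probability_setT ltry.
move=> c; transitivity (unif (pareto_map y.2 @^-1` `]-oo, c])) => //.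
by rewrite pareto_map_ray_le// -pareto_integral.
Qed.

End conditional_kernel.

(** * Quadrants and uniqueness of conditional laws *)

Section quadrants.
Context {R : realType}.

Lemma measure_cvg_at0 (m : {measure set R -> \bar R}) : (m setT < +oo)%E ->
  m `]n.+1%:R^-1, +oo[%classic @[n --> \oo] --> m `]0, +oo[%classic.
Proof.
move=> moo; rewrite (_ : `]0, +oo[%classic = \bigcup_n `]n.+1%:R^-1, +oo[%classic); last first.
  apply/seteqP; split=> x /=; rewrite in_itv/= andbT.
    move=> /near_inv_lt[n _ /(_ n (leqnn n))/= nx]; exists n => //=.
    by rewrite in_itv/= nx.
  by move=> [n _]; rewrite /= in_itv/= andbT; apply: lt_trans; rewrite invr_gt0.
apply: nondecreasing_cvg_mu => //; first exact: bigcupT_measurable.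
move=> i j ij; apply/subsetPset => x /=; rewrite !in_itv/= !andbT; apply: le_lt_trans.
by rewrite lef_pV2 ?posrE// ler_nat ltnS.
Qed.

(** Fitted to [joint_law], which sees jumps only through []z, +oo[] with [z > 0]: the half-plane of
    nonpositive jumps is null by hypothesis, and [z] tends to 0 to recover the total mass. *)
Lemma measure_eq_quadrants (m1 m2 : {measure set (R * R) -> \bar R}) :
  (m1 setT < +oo)%E -> (m2 setT < +oo)%E ->
  m1 (fst @^-1` `]-oo, 0]) = 0%E -> m2 (fst @^-1` `]-oo, 0]) = 0%E ->
  (forall z c, 0 < z -> m1 (fst @^-1` `]z, +oo[ `&` snd @^-1` `]-oo, c]) =
                        m2 (fst @^-1` `]z, +oo[ `&` snd @^-1` `]-oo, c])) ->
  forall A, measurable A -> m1 A = m2 A.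
Proof.
move=> m1oo m2oo m10 m20 m12; apply: measure_eq_rect_rays => // A c mA.
have mc : measurable (snd @^-1` `]-oo, c]%classic : set (R * R)) by exact: measurable_preim.
pose n (m : {measure set (R * R) -> \bar R}) := law (mrestr m mc) (@measurable_fst _ _ R R).
have nE m B : n m B = m (fst @^-1` B `&` snd @^-1` `]-oo, c]) by [].
have nA m : n m A = m (A `*` `]-oo, c]%classic) by [].
have fin (m : {measure set (R * R) -> \bar R}) B : (m setT < +oo)%E -> measurable B -> (n m B < +oo)%E.
  move=> moo mB; rewrite nE; apply: le_lt_trans moo; apply: measure_le => //.
  by apply: measurableI => //; exact: measurable_preim.
have n0 (m : {measure set (R * R) -> \bar R}) : m (fst @^-1` `]-oo, 0]) = 0%E ->
    forall a, a <= 0 -> n m `]-oo, a]%classic = 0%E.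
  move=> m0 a a0; rewrite nE; apply: measure_null_sub m0.
  - by apply: measurableI => //; exact: measurable_preim.
  - exact: measurable_preim.
  - by move=> p [/=]; rewrite !in_itv/= => /le_trans + _; apply.
have npos z : 0 < z -> n m1 `]z, +oo[%classic = n m2 `]z, +oo[%classic.
  by move=> z0; rewrite !nE m12.
have n0oo : n m1 `]0, +oo[%classic = n m2 `]0, +oo[%classic.
  have c1 := measure_cvg_at0 (fin _ _ m1oo measurableT).
  have c2 := measure_cvg_at0 (fin _ _ m2oo measurableT).
  apply: (cvg_unique (@ereal_hausdorff R) c1).
  rewrite (_ : (fun k : nat => n m1 `]k.+1%:R^-1, +oo[%classic) = (fun k => n m2 `]k.+1%:R^-1, +oo[%classic))//.
  by apply/funext => k; rewrite npos// invr_gt0.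
rewrite -!nA; apply: measure_eq_rays mA; first exact: fin.
move=> a; have [a0|a0] := leP a 0; first by rewrite !n0.
have split_half (m : {measure set (R * R) -> \bar R}) : m (fst @^-1` `]-oo, 0]) = 0%E ->
    (n m `]-oo, a]%classic + n m `]a, +oo[%classic = n m `]0%R, +oo[%classic)%E.
  move=> m0; have full b : (n m `]-oo, b]%classic + n m `]b, +oo[%classic = n m setT)%E.
    rewrite -measureU//; first by rewrite -setCitvl setUv.
    by rewrite -setCitvl setICr.
  by rewrite full -(full 0) n0// add0e.
have fa : n m2 `]a, +oo[%classic \is a fin_num by rewrite ge0_fin_numE//; exact: fin.
have e12 : (n m1 `]-oo, a]%classic + n m2 `]a, +oo[%classic =
            n m2 `]-oo, a]%classic + n m2 `]a, +oo[%classic)%E.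
  by rewrite split_half// -npos// split_half.
by rewrite -[LHS](addeK _ fa) -[RHS](addeK _ fa) e12.
Qed.

(** Countably many corners, so that countably many null sets can be united in
    [regular_conditional_law_unique]. A real corner is approached from above, which gives one
    inequality; exchanging the measures gives the other. *)
Lemma measure_le_rational_quadrants (m1 m2 : {measure set (R * R) -> \bar R}) :
  (m2 setT < +oo)%E ->
  (forall a c : rat, m1 (`]-oo, ratr a]%classic `*` `]-oo, ratr c]%classic) =
                     m2 (`]-oo, ratr a]%classic `*` `]-oo, ratr c]%classic)) ->
  forall a c : R, (m1 (`]-oo, a]%classic `*` `]-oo, c]%classic) <=
                   m2 (`]-oo, a]%classic `*` `]-oo, c]%classic))%E.
Proof.
move=> m2oo m12 a c.
pose F (n : nat) : set (R * R) := `]-oo, a + n.+1%:R^-1]%classic `*` `]-oo, c + n.+1%:R^-1]%classic.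
have i0 n : 0 < n.+1%:R^-1 :> R by rewrite invr_gt0.
have mF n : measurable (F n) by exact: measurableX.
have cv : m2 (F n) @[n --> \oo] --> m2 (`]-oo, a]%classic `*` `]-oo, c]%classic).
  rewrite (_ : `]-oo, a]%classic `*` `]-oo, c]%classic = \bigcap_n F n).
    apply: nonincreasing_cvg_mu => //.
    - apply: le_lt_trans m2oo; exact: measure_le.
    - exact: bigcapT_measurable.
    - move=> i j ij; apply/subsetPset => -[x y]; rewrite /F/= !in_itv/=.
      have ij' : j.+1%:R^-1 <= i.+1%:R^-1 :> R by rewrite lef_pV2 ?posrE// ler_nat ltnS.
      by move=> [h1 h2]; split; [apply: le_trans h1 _|apply: le_trans h2 _]; rewrite lerD2l.
  apply/seteqP; split=> -[x y] /=; rewrite !in_itv/=.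
    by move=> [xa yc] n _; rewrite /F/= !in_itv/=; split; rewrite ler_wpDr// ltW.
  move=> H; have near_le (u v : R) : (forall n, u <= v + n.+1%:R^-1) -> u <= v.
    move=> uv; apply/ler_addgt0Pr => e e0; have [n _ /(_ n (leqnn n))/= ne] := near_inv_lt e0.
    by apply: le_trans (uv n) _; rewrite lerD2l ltW.
  by split; apply: near_le => n; have [] := H n I; rewrite /= !in_itv.
rewrite -(cvg_lim (@ereal_hausdorff R) cv); apply: lime_ge.
  by apply/cvg_ex; exists (m2 (`]-oo, a]%classic `*` `]-oo, c]%classic)).
near=> n.
have /rat_in_itvoo[p] : a < a + n.+1%:R^-1 by rewrite ltrDl.
have /rat_in_itvoo[q] : c < c + n.+1%:R^-1 by rewrite ltrDl.
rewrite !in_itv/= => /andP[q1 q2] /andP[p1 p2].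
apply: (@le_trans _ _ (m1 (`]-oo, ratr p]%classic `*` `]-oo, ratr q]%classic))).
  apply: measure_le; [exact: measurableX|exact: measurableX|].
  by move=> [x y] /=; rewrite !in_itv/= => -[h1 h2]; split; [apply: le_trans h1 _|apply: le_trans h2 _]; exact: ltW.
rewrite m12; apply: measure_le; [exact: measurableX|exact: mF|].
by move=> [x y]; rewrite /F/= !in_itv/= => -[h1 h2]; split; [apply: le_trans h1 _|apply: le_trans h2 _]; exact: ltW.
Unshelve. all: by end_near. Qed.

Lemma measure_eq_rational_quadrants (m1 m2 : {measure set (R * R) -> \bar R}) :
  (m1 setT < +oo)%E -> (m2 setT < +oo)%E ->
  (forall a c : rat, m1 (`]-oo, ratr a]%classic `*` `]-oo, ratr c]%classic) =
                     m2 (`]-oo, ratr a]%classic `*` `]-oo, ratr c]%classic)) ->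
  forall A, measurable A -> m1 A = m2 A.
Proof.
move=> m1oo m2oo m12; apply: measure_eq_rect_rays => // A c mA.
have mc : measurable ([set: R] `*` `]-oo, c]%classic) by exact: measurableX.
have E (m : {measure set (R * R) -> \bar R}) B :
    law (mrestr m mc) (@measurable_fst _ _ R R) B = m (B `*` `]-oo, c]%classic).
  by rewrite lawE /mrestr; congr (m _); apply/seteqP; split=> -[x y] /=; [move=> [? []]|move=> []].
rewrite -!E; apply: measure_eq_rays mA.
  by rewrite E; apply: le_lt_trans m1oo; apply: measure_le => //; exact: measurableX.
move=> a; rewrite !E; apply/eqP; rewrite eq_le; apply/andP; split.
  exact: measure_le_rational_quadrants.
by apply: measure_le_rational_quadrants.
Qed.

End quadrants.

Section uniqueness.
Context {d : measure_display} {T : measurableType d} {R : realType} (P : probability T R).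
Context {d1 : measure_display} {T1 : measurableType d1}.

(** For a fixed set, both kernels have equal integrals over all events in [Y], hence agree almost
    everywhere; rational quadrants make the exceptional set independent of the set. *)
Lemma regular_conditional_law_unique (Z : T -> R * R) (Y : T -> T1)
    (k k' : R.-pker T1 ~> (R * R)%type) (mY : measurable_fun setT Y) :
  regular_conditional_law P Z Y k -> regular_conditional_law P Z Y k' ->
  {ae law P mY, forall y A, measurable A -> k y A = k' y A}.
Proof.
move=> [_ _ kE] [_ _ k'E].
have mk (l : R.-pker T1 ~> (R * R)%type) B : measurable B -> measurable_fun setT (l ^~ B).
  by move=> mB; exact: measurable_kernel.
have ae1 B : measurable B -> {ae law P mY, forall y, k y B = k' y B}.
  move=> mB.
  have ik : (law P mY).-integrable setT (k ^~ B).
    apply/integrableP; split; first exact: mk.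
    apply: (@le_lt_trans _ _ (\int[law P mY]_y cst 1 y)%E).
      apply: ge0_le_integral => //.
      - by apply: measurableT_comp => //; exact: mk.
      - by move=> y _; rewrite gee0_abs// /cst -(prob_kernel (s := k) y); apply: measure_le.
    rewrite integral_cst// mul1e lawE preimage_setT.
    by rewrite [X in (X < _)%E]probability_setT ltry.
  have := integral_ae_eq measurableT ik (mk k' B mB).
  suff : forall E, E `<=` setT -> measurable E -> (\int[law P mY]_(x in E) k x B = \int[law P mY]_(x in E) k' x B)%E.
    by move=> H /(_ H); apply: filterS => y; exact.
  move=> E _ mE; rewrite !ge0_integral_pushforward//.
  - by rewrite -[LHS]kE// -[RHS]k'E.
  - by apply: measurable_funTS; exact: mk.
  - by apply: measurable_funTS; exact: mk.
have ae2 : {ae law P mY, forall y (n : nat),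
    match @unpickle (rat * rat)%type n with
    | Some (a, c) => k y (`]-oo, ratr a]%classic `*` `]-oo, ratr c]%classic) =
                     k' y (`]-oo, ratr a]%classic `*` `]-oo, ratr c]%classic)
    | None => True end}.
  apply/ae_foralln => n; case: unpickle => [[a c]|]; last exact: aeW.
  by apply: ae1; exact: measurableX.
move: ae2; apply: filterS => y H; apply: measure_eq_rational_quadrants.
- by rewrite prob_kernel ltry.
- by rewrite prob_kernel ltry.
by move=> a c; have := H (pickle (a, c)); rewrite pickleK.
Qed.

End uniqueness.

Section plane_sigma_finite.
Context {R : realType}.

(* [plane] as a sigma-finite measure, which products are not canonically. *)
Definition sf_plane : set (R * R) -> \bar R := plane.

HB.instance Definition _ := Measure.on sf_plane.

Let plane_sigma_finite : sigma_finite setT sf_plane.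
Proof.
exists (fun n => `[- n%:R, n%:R]%classic `*` `[- n%:R, n%:R]%classic).
  apply/seteqP; split=> // -[x y] _; exists (Num.truncn (Num.max `|x| `|y|)).+1 => //=.
  have : Num.max `|x| `|y| < (Num.truncn (Num.max `|x| `|y|)).+1%:R by exact: truncnS_gt.
  by rewrite gt_max => /andP[/ltW hx /ltW hy]; rewrite !in_itv/= -!ler_norml.
move=> n; split; first exact: measurableX.
have fin : (leb (`[(- n%:R)%R, n%:R%R]%classic : set R) < +oo)%E.
  have -> : leb (`[- n%:R, n%:R]%classic : set R) = (n%:R - - n%:R)%:E.
    apply: (etrans (lebesgue_measure_itv _)); rewrite /= lte_fin; case: ltP => [_|h].
      by rewrite EFinB.
    have : n%:R = 0 :> R by apply/eqP; rewrite eq_le ler0n andbT; have := ler0n R n; lra.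
    by move=> ->; rewrite oppr0 subr0.
  exact: ltry.
have -> : sf_plane (`[- n%:R, n%:R]%classic `*` `[- n%:R, n%:R]%classic) =
  (leb (`[(- n%:R)%R, n%:R%R]%classic : set R) * leb (`[(- n%:R)%R, n%:R%R]%classic : set R))%E.
  exact: product_measure1E.
by rewrite lte_mul_pinfty// ge0_fin_numE.
Qed.

HB.instance Definition _ := Measure_isSigmaFinite.Build _ _ _ sf_plane plane_sigma_finite.

End plane_sigma_finite.

(** * The kernel as conditional law at the passage *)

Section passage_kernel.
Context {d : measure_display} {T : measurableType d} {R : realType}.
Variables (P : probability T R) (alpha : R) (X : R -> {RV P >-> R}) (h : R -> R -> R -> R).
Hypothesis alpha12 : 1 < alpha < 2.
Hypothesis stableX : stable_process alpha X.
Hypothesis laplaceX : forall t q : R, 0 < t -> 0 <= q ->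
  ('E_P[fun w => expR (- q * X t w)] = (expR (t * q `^ alpha))%:E)%E.
Hypothesis hX : is_killed_density X h.
Implicit Types (a s t u c x z : R) (w : T) (p : R * R) (y : \bar R * R).

Variable C : R.
Hypothesis C0 : 0 <= C.
Hypothesis C_rate : forall e : nat -> R,
  (forall n, 0 < e n) -> e n @[n --> \oo] --> 0 -> tail_rate X (e n) @[n --> \oo] --> C.

Let levyX : levy_process X. Proof. by case: stableX. Qed.
Let X0 w : X 0 w = 0. Proof. by case: levyX. Qed.
Let X01 w : X 0 w < 1. Proof. by rewrite X0. Qed.
Let cX w : cadlag_path (fun t => X t w). Proof. by case: levyX. Qed.
Let i0 n : 0 < n.+1%:R^-1 :> R. Proof. by rewrite invr_gt0. Qed.

Local Notation tau := (passage_time X 1).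
Local Notation U := (pre_passage X 1).
Local Notation D := (passage_jump X 1).
Local Notation SL := (pre_passage_sup X 1).
Local Notation pp := (passage_point X).
Local Notation Y := (fun w => (tau w, U w)).
Local Notation Z := (fun w => (D w, SL w)).
Local Notation jd z c := (jump_density alpha h C z c).
Local Notation k0 := (jump_pkernel stableX hX).

Lemma passage_facts w : (tau w < +oo)%E ->
  [/\ (fine (tau w))%:E = tau w, U w <= 1, 1 - U w <= D w, SL w <= 1 & U w <= SL w].
Proof.
have := passage_time_ge0 (fun t => X t) w 1.
have := @passage_time_gt0 _ _ (fun t => X t) w 1 (cX w) (X01 w).
rewrite /U /passage_jump /SL /pre_passage_sup /pre_passage.
case E : (passage_time X 1 w) => [r| |]//= r0 _ _; split => //.
- exact: left_value_passage E.
- by rewrite /jump lerD2r; exact: at_passage E.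
- exact: run_sup_left_passage E.
- exact: left_value_le_run_sup_left.
Qed.

(** The default time [fine +oo = 0] produces the value [(0, 0)], the one that [kernel_map] takes
    there. *)
Lemma no_passage_facts w : tau w = +oo%E -> D w = 0 /\ SL w = 0.
Proof.
move=> tw; rewrite /passage_jump /pre_passage_sup tw/= run_sup_left0.
by rewrite /jump /left_value ltxx X0 subr0.
Qed.

Let mtau : measurable_fun setT tau. Proof. exact: measurable_passage_time1. Qed.
Let mU : measurable_fun setT U. Proof. exact: measurable_pre_passage1. Qed.
Let mD : measurable_fun setT D. Proof. exact: measurable_passage_jump1. Qed.
Let mSL : measurable_fun setT SL. Proof. exact: measurable_pre_passage_sup1. Qed.
Let mY : measurable_fun setT Y. Proof. exact: measurable_fun_pair. Qed.
Let mZ : measurable_fun setT Z. Proof. exact: measurable_fun_pair. Qed.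
Let mpp : measurable_fun setT pp. Proof. exact: (measurable_passage_point stableX). Qed.
Let mgood : measurable (good h) := measurable_good stableX hX.
Let mjd z c : measurable_fun setT (jd z c). Proof. exact: (measurable_jump_density stableX hX). Qed.
Let jd0 z c p : (0 <= jd z c p)%E. Proof. exact: (jump_density_ge0 _ hX C0). Qed.

Definition passed : set T := [set w | (passage_time X 1 w < +oo)%E].

Lemma measurable_passed : measurable passed.
Proof.
rewrite (_ : passed = tau @^-1` `]-oo, +oo%E[); last first.
  by apply/seteqP; split=> w; rewrite /passed/= in_itv.
by apply: measurable_preim => //; exact: emeasurable_itv.
Qed.

(** On [good] the jump is at least [1 - U > 0]. Where [1 - x > 1 / (n + 1)], the condition that the
    jump exceeds [1 / (n + 1)] is automatic and does not change [jump_rate]; then [n] grows. *)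
Lemma passage_point_law B : measurable B -> B `<=` good h ->
  P (pp @^-1` B `&` passed) = (\int[plane]_(p in B) jd 0 1 p)%E.
Proof.
move=> mB Bg.
pose Bn n := B `&` [set p | n.+1%:R^-1 < 1 - p.2].
have mBn n : measurable (Bn n).
  apply: measurableI => //.
  rewrite (_ : [set p | _] = (fun p : R * R => 1 - p.2) @^-1` `]n.+1%:R^-1, +oo[); last first.
    by apply/seteqP; split=> p; rewrite /= in_itv/= andbT.
  by apply: measurable_preim => //; exact: measurable_funB.
have BE : B = \bigcup_n Bn n.
  apply/seteqP; split=> [[t x] Bp|p [n _ []//]].
  have [_ x1] := good_domain (Bg _ Bp).
  have : 0 < 1 - x by rewrite subr_gt0.
  by move=> /near_inv_lt[n _ /(_ n (leqnn n))/= nx]; exists n.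
have Bmono : nondecreasing_seq Bn.
  move=> i j ij; apply/subsetPset => p [Bp /= ip]; split => //=.
  by apply: le_lt_trans ip; rewrite lef_pV2 ?posrE// ler_nat ltnS.
have mps := measurable_passed.
have step n : P (pp @^-1` Bn n `&` passed) = (\int[plane]_(p in Bn n) jd 0 1 p)%E.
  transitivity (P (pp @^-1` Bn n `&` jumping X n.+1%:R^-1 1)).
    congr (P _); apply/seteqP; split=> w [[Bw /= nw]].
      move=> tw; have [_ U1 UD S1 _] := passage_facts tw.
      by split => //; split => //; exact: lt_le_trans UD.
    by move=> [tw _ _].
  transitivity (\int[plane]_(p in Bn n) jd n.+1%:R^-1 1 p)%E.
    exact: (joint_law alpha12 stableX laplaceX hX C0 C_rate (mBn n) (i0 n) (lexx 1)).
  apply: eq_integral => p /set_mem[_ /= np]; rewrite /jump_density /jump_rate.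
  by rewrite !max_r// ltW// (lt_trans _ np).
have c1 : P (pp @^-1` Bn n `&` passed) @[n --> \oo] --> P (pp @^-1` B `&` passed).
  rewrite BE; pose m := law (mrestr P mps) mpp.
  have := nondecreasing_cvg_mu (mu := m) mBn (bigcupT_measurable _ mBn) Bmono.
  exact.
have c2 : (\int[plane]_(p in Bn n) jd 0 1 p)%E @[n --> \oo] --> (\int[plane]_(p in B) jd 0 1 p)%E.
  rewrite BE; apply: ge0_nondecreasing_set_cvg_integral => //.
  by move=> n; exact: measurable_funTS.
have stepf : (fun n => P (pp @^-1` Bn n `&` passed)) = (fun n => (\int[plane]_(p in Bn n) jd 0 1 p)%E).
  by apply/funext => n; exact: step.
by rewrite stepf in c1; exact: (cvg_unique (@ereal_hausdorff R) c1 c2).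
Qed.

Let mk0 B : measurable B -> measurable_fun setT (k0 ^~ B).
Proof. by move=> mB; exact: measurable_kernel. Qed.

Lemma integral_restricted (E : set T) (mE : measurable E) (g : T -> \bar R) :
  measurable_fun setT g -> (forall w, (0 <= g w)%E) ->
  (\int[mrestr P mE]_w g w = \int[P]_(w in E) g w)%E.
Proof.
move=> mg g0.
have m1 : measurable_fun setT (fun w => (\1_E w)%:E : \bar R).
  by apply/measurable_EFinP; exact: measurable_indic.
rewrite (density_integral (mu := P) (nu := mrestr P mE) (f := fun w => (\1_E w)%:E))//.
- by rewrite [RHS]integral_mkcond; apply: eq_integral => w _; rewrite epatch_indic.
- suff : (P (setT `&` E) < +oo)%E by [].
  by rewrite setTI; apply: le_lt_trans (probability_le1 P mE) _; rewrite ltry.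
- by move=> A mA; rewrite /mrestr integral_indic// setIC.
Qed.

Let passed_good A : measurable A -> exists2 A' : set (R * R), measurable A' &
  Y @^-1` A `&` (pp @^-1` good h `&` passed) = pp @^-1` (good h `&` A') `&` passed.
Proof.
move=> mA; exists [set p | A (p.1%:E, p.2)].
  have mf : measurable_fun setT (fun p : R * R => (p.1%:E, p.2)).
    by apply: measurable_fun_pair => //; exact: (measurableT_comp _ measurable_fst).
  exact: (measurable_preim mf mA).
apply/seteqP; split=> w.
  move=> [Aw [gw tw]]; have [tE _ _ _ _] := passage_facts tw.
  by split=> //; split => //=; rewrite tE.
move=> [[gw Aw] tw]; have [tE _ _ _ _] := passage_facts tw.
by split=> //=; move: Aw; rewrite /= tE.
Qed.

(** Both sides are finite measures of [B], compared on quadrants. Up to the constant, the passage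
    point has density [(1 - x)^(- alpha) h_1] and the kernel contributes
    [((1 - x) / M)^alpha h_c / h_1] with [M = max (z, 1 - x)]; the product is the joint density
    [M^(- alpha) h_c]. *)
Lemma conditional_law_good A B : measurable A -> measurable B ->
  P (Y @^-1` A `&` (pp @^-1` good h `&` passed) `&` Z @^-1` B) =
  (\int[P]_(w in Y @^-1` A `&` (pp @^-1` good h `&` passed)) k0 (Y w) B)%E.
Proof.
move=> mA mB; have [A' mA' EA] := passed_good mA; rewrite EA.
set G := good h `&` A'; set E := pp @^-1` G `&` passed.
have mG : measurable G by exact: measurableI.
have GS : G `<=` good h by move=> p [].
have mps := measurable_passed.
have mE : measurable E by apply: measurableI => //; exact: measurable_preim.
pose Psi (q : T * (R * R)) := kernel_map alpha h (Y q.1, q.2).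
have mPsi : measurable_fun setT Psi.
  apply: (measurableT_comp (f := kernel_map alpha h) (measurable_kernel_map stableX hX)
    (g := fun q : T * (R * R) => (Y q.1, q.2))).
  by apply: measurable_fun_pair => //; exact: (measurableT_comp mY).
pose m1 := law (mrestr P mE) mZ.
pose m2 := law (mrestr P mE \x unif2)%E mPsi.
have kY B' : measurable B' -> measurable_fun setT (fun w => k0 (Y w) B').
  by move=> mB'; exact: (measurableT_comp (mk0 mB') mY).
have m2E B' : measurable B' -> m2 B' = (\int[P]_(w in E) k0 (Y w) B')%E.
  move=> mB'; transitivity (\int[mrestr P mE]_w k0 (Y w) B')%E; last first.
    by apply: integral_restricted; [exact: kY|move=> w; exact: measure_ge0].
  have e : m2 B' = (\int[mrestr P mE]_w unif2 (xsection (Psi @^-1` B') w))%E.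
    by rewrite /m2 lawE.
  rewrite e; apply: eq_integral => w _.
  have e2 : k0 (Y w) B' = unif2 ((fun q => kernel_map alpha h (Y w, q)) @^-1` B') by [].
  rewrite e2; congr (unif2 _).
  by apply/seteqP; split=> q; rewrite /xsection/= inE.
have m1E B' : m1 B' = P (E `&` Z @^-1` B') by rewrite setIC.
rewrite -m2E// -m1E.
have PE : (P E < +oo)%E by apply: le_lt_trans (probability_le1 P mE) _; rewrite ltry.
apply: measure_eq_quadrants mB.
- by rewrite m1E preimage_setT setIT.
- rewrite m2E//; apply: le_lt_trans PE.
  rewrite -[leRHS]mul1e -integral_cst//; apply: ge0_le_integral => //.
  + by apply: measurable_funTS; exact: kY.
  + by move=> w _; rewrite /cst prob_kernel.
- rewrite m1E (_ : E `&` _ = set0) ?measure0// -subset0 => w [[[gw _] tw] /=]; rewrite in_itv/=.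
  have [_ _ UD _ _] := passage_facts tw; have [_ /= U1] := good_domain gw.
  by move=> /(le_trans UD); rewrite leNgt subr_gt0 U1.
- rewrite m2E; last exact: measurable_preim.
  rewrite integral0_eq// => w [[gw _] _]; exact: (jump_kernel_pos alpha12 stableX hX (y := Y w) gw).
move=> z c z0; have mq : measurable (fst @^-1` `]z, +oo[ `&` snd @^-1` `]-oo, c] : set (R * R)).
  by apply: measurableI; exact: measurable_preim.
set q := fst @^-1` _ `&` _ in mq *.
(* [joint_law] asks for levels at most 1, and the supremum before the passage never exceeds 1. *)
pose c1 := Num.min c 1; have mc1 : c1 <= 1 by rewrite ge_min lexx orbT.
transitivity (\int[plane]_(p in G) jd z c1 p)%E.
  rewrite -(joint_law alpha12 stableX laplaceX hX C0 C_rate mG z0 mc1).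
  rewrite m1E; congr (P _); apply/seteqP; split=> w.
    move=> [[Gw tw] [/=]]; rewrite !in_itv/= andbT => zD Sc.
    have [_ _ _ S1 _] := passage_facts tw.
    by split=> //; split => //; rewrite le_min Sc S1.
  move=> [Gw [tw zD]]; rewrite le_min => /andP[Sc _].
  by split => //; split; rewrite /= in_itv//= andbT.
pose K p := k0 (p.1%:E, p.2) q.
have mK : measurable_fun setT K.
  apply: (measurableT_comp (mk0 mq) (g := fun p : R * R => (p.1%:E, p.2))).
  by apply: measurable_fun_pair => //; exact: (measurableT_comp _ measurable_fst).
pose nu := law (mrestr P mE) mpp.
have mjG : measurable_fun setT (jd 0 1 \_ G).
  by apply/(measurable_restrictT _ _).1 => //; exact: measurable_funTS.
have jG0 p : (0 <= (jd 0 1 \_ G) p)%E by apply: erestrict_ge0 => r _; exact: jd0.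
have nuE B' : measurable B' -> nu B' = (\int[sf_plane]_(p in B') (jd 0 1 \_ G) p)%E.
  move=> mB'; transitivity (P (pp @^-1` (B' `&` G) `&` passed)).
    transitivity (P (pp @^-1` B' `&` E)) => //.
    by congr (P _); apply/seteqP; split=> w [] => [? []|[]].
  rewrite passage_point_law; [|exact: measurableI|by move=> p [_ /GS]].
  by rewrite -integral_mkcondr.
rewrite m2E//.
transitivity (\int[nu]_p K p)%E.
  rewrite (density_integral (mu := sf_plane) (nu := nu) mjG)//; last first.
    have : (P (pp @^-1` setT `&` E) < +oo)%E by rewrite preimage_setT setTI.
    by [].
  transitivity (\int[plane]_p ((jd z c1) \_ G) p)%E; first by rewrite [LHS]integral_mkcond.
  apply: eq_integral => -[t x] _; rewrite !patchE; case: ifPn => [/set_mem Gp|_]; last by rewrite mule0.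
  have gp := GS _ Gp; have [t0 x1] := good_domain gp.
  rewrite /K (jump_kernel_quadrant alpha12 stableX hX)//.
  rewrite /jump_density /jump_rate -EFinM; congr (_%:E).
  have k1 : 0 < killed h 1 (t, x) by case: gp.
  have m0 : 0 < 1 - x by rewrite subr_gt0.
  rewrite /= (max_r (ltW m0)).
  set M := Num.max z (1 - x); have M0 : 0 < M by rewrite lt_max z0.
  rewrite powRM ?invr_ge0 ?(ltW m0) ?(ltW M0)// -[M^-1]powR_inv1 ?(ltW M0)// -powRrM mulN1r.
  have mm : (1 - x) `^ alpha * (1 - x) `^ (- alpha) = 1.
    by rewrite powRN divff// lt0r_neq0// powR_gt0.
  have kk : (killed h 1 (t, x))^-1 * killed h 1 (t, x) = 1 by rewrite mulVf// lt0r_neq0.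
  set mc := killed h c1 (t, x).
  set a := (1 - x) `^ alpha in mm *; set b := (1 - x) `^ (- alpha) in mm *.
  set ik := (killed h 1 (t, x))^-1 in kk *; set k := killed h 1 (t, x) in kk *.
  transitivity (C * 3 `^ alpha * M `^ (- alpha) * mc * (a * b) * (ik * k)); first by rewrite mm kk !mulr1.
  ring.
have K0 p : (0 <= K p)%E by exact: measure_ge0.
transitivity (\int[mrestr P mE]_w K (pp w))%E.
  have := @ge0_integral_pushforward _ _ T (R * R)%type R pp mpp (mrestr P mE) setT K measurableT mK.
  by rewrite preimage_setT; apply=> p _; exact: K0.
have mKpp : measurable_fun setT (fun w => K (pp w)) by exact: (measurableT_comp mK mpp).
rewrite (integral_restricted mE mKpp (fun w => K0 (pp w))).
apply: eq_integral => w /set_mem[_ tw].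
have [tE _ _ _ _] := passage_facts tw.
have e : ((pp w).1%:E, (pp w).2) = (tau w, U w) by rewrite /passage_point/= tE.
by rewrite /K e.
Qed.

(** The value [(0, 1)] stands for passage without a jump, the supremum then being the level
    itself. *)
Definition exceptional : set T :=
  pp @^-1` (~` good h) `&` (passed `&` [set w | Z w <> (0, 1)]).

Lemma measurable_exceptional : measurable exceptional.
Proof.
apply: measurableI; first by apply: measurable_preim => //; exact: measurableC.
apply: measurableI; first exact: measurable_passed.
rewrite (_ : [set w | _] = Z @^-1` (~` [set (0, 1)])).
  apply: measurable_preim => //; apply: measurableC.
  rewrite (_ : [set (0, 1)] = fst @^-1` [set 0] `&` snd @^-1` [set 1]).
    by apply: measurableI; apply: measurable_preim.
  by apply/seteqP; split=> -[x y] /= [-> ->].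
by apply/seteqP; split.
Qed.

(** Off [good] positive jumps have density 0 or come from the null set of irregular points. With
    [U < 1] the jump is positive; with [U = 1] it is almost surely 0 by [passage_from_level_null],
    and the supremum is 1. *)
Lemma exceptional_null : P exceptional = 0%E.
Proof.
have mps := measurable_passed.
have mng : measurable (pp @^-1` (~` good h)).
  by apply: measurable_preim => //; exact: measurableC.
pose F n := pp @^-1` (~` good h) `&` jumping X n.+1%:R^-1 1.
have mF n : measurable (F n) by apply: measurableI => //; exact: (measurable_jumping stableX).
have planeN : plane (~` regular h) = 0%E.
  rewrite /plane/= /product_measure1 integral0_eq// => t _ /=.
  exact: (regular_section alpha12 stableX laplaceX hX t).
have mreg : measurable (regular h) := measurable_regular stableX hX.
have F0 n : P (F n) = 0%E.
  transitivity (\int[plane]_(p in ~` good h) jd n.+1%:R^-1 1 p)%E.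
    exact: (joint_law alpha12 stableX laplaceX hX C0 C_rate (measurableC mgood) (i0 n) (lexx 1)).
  transitivity (\int[plane]_(p in ~` good h) cst 0%E p)%E; last exact: integral0.
  apply: ge0_ae_eq_integral => //; first exact: measurableC.
    by apply: measurable_funTS.
  exists (~` regular h); split => //; first exact: measurableC.
  move=> p /= /not_implyP[ngp jp] rp; apply: jp; rewrite /jump_density.
  have : killed h 1 p = 0.
    apply/eqP; rewrite eq_le (killed_ge0 hX) andbT leNgt; apply/negP => kp; exact: ngp.
  by move=> ->; rewrite mulr0.
have N1 := passage_from_level_null alpha12 stableX laplaceX hX C0 C_rate.
set L := [set w | _] in N1.
have mL : measurable L.
  rewrite (_ : L = passed `&` (U @^-1` [set 1] `&` D @^-1` `]0, +oo[)).
    by apply: measurableI => //; apply: measurableI; exact: measurable_preim.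
  by apply/seteqP; split=> w; rewrite /L/= in_itv/= andbT; [move=> []|move=> [? []]].
have mUF : measurable (\bigcup_n F n) by exact: bigcupT_measurable.
apply: (measure_null_sub (m := P) (B := L `|` \bigcup_n F n)).
- exact: measurable_exceptional.
- exact: measurableU.
- move=> w [ngw [tw Zw]]; have [_ U1 UD S1 US] := passage_facts tw.
  have [U1e|U1n] := eqVneq (U w) 1.
    left; split => //; rewrite lt_neqAle; apply/andP; split; last by apply: le_trans UD; rewrite subr_ge0.
    apply/eqP => D0; apply: Zw; congr (_, _); first by [].
    by apply/eqP; rewrite eq_le S1 -{1}U1e US.
  right; have : 0 < D w.
    by apply: lt_le_trans UD; rewrite subr_gt0 lt_neqAle U1n.
  by move=> /near_inv_lt[n _ /(_ n (leqnn n))/= nD]; exists n => //; split.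
- apply: measureU_null => //; exact: measure_bigcup_null.
Qed.

(** On [good] this is [conditional_law_good]; elsewhere the kernel is a point mass, almost surely at
    the actual value of [Z]. *)
Lemma jump_kernel_conditional : regular_conditional_law P Z Y k0.
Proof.
split=> // A B mA mB.
have mps := measurable_passed.
pose E := pp @^-1` good h `&` passed.
have mE : measurable E by apply: measurableI => //; exact: measurable_preim.
have mYA : measurable (Y @^-1` A) by exact: measurable_preim.
have mZB : measurable (Z @^-1` B) by exact: measurable_preim.
have mAE : measurable (Y @^-1` A `&` E) by exact: measurableI.
have mAEc : measurable (Y @^-1` A `&` ~` E) by apply: measurableI => //; exact: measurableC.
have YAE : Y @^-1` A = (Y @^-1` A `&` E) `|` (Y @^-1` A `&` ~` E) by rewrite -setIUr setUv setIT.
have dis : [disjoint Y @^-1` A `&` E & Y @^-1` A `&` ~` E].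
  by apply/eqP; rewrite -subset0 => w [[_ ?] [_]].
have kY : measurable_fun setT (fun w => k0 (Y w) B) by exact: (measurableT_comp (mk0 mB) mY).
transitivity (P (Y @^-1` A `&` E `&` Z @^-1` B) + P (Y @^-1` A `&` ~` E `&` Z @^-1` B))%E.
  rewrite {1}YAE setIUl measureU//; [exact: measurableI|exact: measurableI|].
  by rewrite -subset0 => w [[[_ ?] _] [[_ ?] _]].
rewrite [in RHS]YAE ge0_integral_setU//; last exact: measurable_funTS.
congr (_ + _)%E; first exact: conditional_law_good.
transitivity (\int[P]_(w in Y @^-1` A `&` ~` E) (\1_(Z @^-1` B) w)%:E)%E.
  by rewrite integral_indic// setIC.
apply: ge0_ae_eq_integral => //.
- by apply: measurable_funTS; apply/measurable_EFinP; exact: measurable_indic.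
- exact: measurable_funTS.
exists exceptional; split; [exact: measurable_exceptional|exact: exceptional_null|].
move=> w /= /not_implyP[[Aw nEw] neq]; apply: contrapT => nbad; apply: neq.
have dirac (v : R * R) : Z w = v -> (forall q : R * R, kernel_map alpha h (Y w, q) = v) ->
    (\1_(Z @^-1` B) w)%:E = k0 (Y w) B.
  move=> Zv kv; transitivity (unif2 ((fun q => kernel_map alpha h (Y w, q)) @^-1` B)) => //.
  rewrite indicE; case: (boolP (w \in _)) => [/set_mem|/negP] Bw.
    rewrite (_ : _ @^-1` B = setT) ?probability_setT//; apply/seteqP; split=> // q _.
    by change (B (kernel_map alpha h (Y w, q))); rewrite kv -Zv.
  rewrite (_ : _ @^-1` B = set0) ?measure0// -subset0 => q.
  change (B (kernel_map alpha h (Y w, q)) -> False); rewrite kv -Zv => BZ.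
  by apply: Bw; rewrite inE.
have [tw|tw] := pselect (passed w); last first.
  have tE : tau w = +oo%E by apply/eqP; rewrite -leye_eq leNgt; apply/negP.
  have [D0 S0] := no_passage_facts tE.
  apply: (dirac (0, 0)); first by rewrite D0 S0.
  move=> q; rewrite /kernel_map tE/= !indicE (memNset (A := good h)); last first.
    by move=> /good_domain[]; rewrite ltxx.
  by rewrite [X in _ * (nat_of_bool X)%:R]memNset/= ?ltxx// !mul0r mulr0 addr0.
have ngw : ~ good h (pp w) by move=> gw; apply: nEw.
have Zw : Z w = (0, 1) by apply: contrapT => Zw; apply: nbad; split.
apply: (dirac (0, 1)) => // q.
rewrite /kernel_map/= !indicE (memNset (A := good h))//.
by rewrite !mem_set//= !mul0r mul1r add0r.
Qed.

End passage_kernel.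

Theorem corollary5 (R : realType) (d : measure_display) (T : measurableType d)
  (P : probability T R) (alpha : R) (X : R -> {RV P >-> R})
  (h : R -> R -> R -> R)
  (alpha12 : 1 < alpha < 2)
  (stableX : stable_process alpha X)
  (laplaceX : forall t q : R, 0 < t -> 0 <= q ->
     ('E_P[fun w => expR (- q * X t w)] = (expR (t * q `^ alpha))%:E)%E)
  (hX : is_killed_density X h) :
  let Y := fun w : T => (passage_time X 1 w, pre_passage X 1 w) in
  let Z := fun w : T => (passage_jump X 1 w, pre_passage_sup X 1 w) in
  (exists k : R.-pker (\bar R * R)%type ~>
             (R * R)%type,
     regular_conditional_law P Z Y k) /\
  forall k : R.-pker (\bar R * R)%type ~>
             (R * R)%type,
    regular_conditional_law P Z Y k ->
    {ae pushforward P Y, forall y : \bar R * R,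
      forall t x : R, y = (t%:E, x) -> x < 1 ->
      [/\ independent (k y) fst snd,
          forall A : set R, measurable A ->
            k y (fst @^-1` A) =
            (\int[lebesgue_measure]_(z in A)
               (pareto_density alpha (1 - x) z)%:E)%E &
          forall c : R, Num.max x 0 <= c <= 1 ->
            k y (snd @^-1` `]-oo, c]) = (h c x t / h 1 x t)%:E]}.
Proof.
move=> Y Z.
have levyX : levy_process X by case: stableX.
have [C C0 C_rate] := tail_rate_cvg alpha12 stableX laplaceX hX.
have rcl : regular_conditional_law P Z Y (jump_pkernel stableX hX).
  exact: (jump_kernel_conditional alpha12 stableX laplaceX hX C0 C_rate).
split; first by exists (jump_pkernel stableX hX).
move=> k rclk.
have mtau := measurable_passage_time1 levyX.
have mU := measurable_pre_passage1 levyX.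
have mY : measurable_fun setT Y by exact: measurable_fun_pair.
have mgood := measurable_good stableX hX.
pose B : set (\bar R * R) := [set y | (y.1 < +oo)%E] `&`
  ([set y | y.2 < 1] `&` (fun y => (fine y.1, y.2)) @^-1` (~` good h)).
have mf : measurable_fun setT (fun y : \bar R * R => (fine y.1, y.2)).
  apply: measurable_fun_pair => //.
  exact: (measurableT_comp (fine_measurable measurableT) measurable_fst).
have mB : measurable B.
  apply: measurableI.
    rewrite (_ : [set y | _] = fst @^-1` `]-oo, +oo%E[); last first.
      by apply/seteqP; split=> y; rewrite /= in_itv.
    by apply: measurable_preim => //; exact: emeasurable_itv.
  apply: measurableI.
    rewrite (_ : [set y | _] = snd @^-1` `]-oo, 1[); last first.
      by apply/seteqP; split=> y; rewrite /= in_itv.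
    exact: measurable_preim.
  by apply: (measurable_preim mf); exact: measurableC.
have B0 : P (Y @^-1` B) = 0%E.
  apply: measure_null_sub (exceptional_null alpha12 stableX laplaceX hX C0 C_rate).
  - exact: measurable_preim.
  - exact: (measurable_exceptional stableX hX).
  (* A position below 1 at the passage means a positive jump, so that [Z] differs from [(0, 1)]. *)
  move=> w [tw [U1 ngw]]; split=> //; split=> //= -[D0 S1].
  have [_ _ UD _ _] := passage_facts stableX tw.
  by move: UD; rewrite D0 leNgt subr_gt0 U1.
have ae_B : {ae law P mY, forall y, ~ B y}.
  exists B; split => //.
  by move=> y /= /contrapT.
have ae_eq := regular_conditional_law_unique mY rclk rcl.
have [N [mN N0 subN]] := filterI ae_B ae_eq.
exists N; split => // y ny; apply: contrapT => yN; apply: ny.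
have [nBy keq] := contrapT (fun n => yN (subN y n)).
move=> t x yE x1.
have gy : good h (fine y.1, y.2).
  apply: contrapT => ngy; apply: nBy; split; first by rewrite yE/= ltry.
  by split => //=; rewrite yE.
have [t0 _] : 0 < t /\ x < 1 by move: gy; rewrite yE => /good_domain.
have fstM A : measurable A -> measurable (fst @^-1` A : set (R * R)) by exact: measurable_preim.
have sndM A : measurable A -> measurable (snd @^-1` A : set (R * R)) by exact: measurable_preim.
split.
- move=> A1 A2 mA1 mA2; rewrite !keq; [|exact: sndM|exact: fstM|by apply: measurableI; [exact: fstM|exact: sndM]].
  exact: (jump_kernel_independent stableX hX gy).
- move=> A mA; rewrite keq; last exact: fstM.
  rewrite [LHS](jump_kernel_pareto alpha12 stableX hX gy mA).
  by rewrite yE.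
- move=> c /andP[xc c1]; rewrite keq; last exact: sndM.
  rewrite [LHS](jump_kernel_cdf stableX hX c gy) min_l// yE /=.
  have -> : killed h 1 (t, x) = h 1 x t by rewrite /killed/= t0 ltr01 x1.
  congr (_ / _)%:E; rewrite /killed/= t0/=.
  (* [killed] switches to 0 only at the boundary value [c = max (x, 0)], where [h] is 0 by its last
     property. *)
  case: ifPn => // nc.
  have -> : c = Num.max x 0.
    apply/eqP; rewrite eq_le xc andbT leNgt; apply: contra nc.
    by rewrite gt_max andbC.
  by have [_ _ _ ->] := hX.
Qed.
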